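(* Let $u$ be a non-constant inner function and let $\Phi,\Psi\in L^2(\mathbb{T})$ be such that $A_\Phi,A_\Psi\in\mathcal{T}_u$. Then $A_\Phi A_\Psi\in\mathcal{T}_u$ if and only if one of the following two (not mutually exclusive) cases holds: (Trivial case) either $A_\Phi$ or $A_\Psi$ is equal to $cI$ for some $c\in\mathbb{C}$; (Non-trivial case) $A_\Phi$ and $A_\Psi$ are both of type $\alpha$ for some $\alpha\in\mathbb{C}\cup\{\infty\}$, in which case their product $A_\Phi A_\Psi$ is of type $\alpha$ as well.
   Context: $\mathbb{T}$ is the unit circle with normalized Lebesgue measure $m$, $H^2\subset L^2(\mathbb{T})$ is the Hardy space, $u$ is a non-constant inner function, $K_u^2=H^2\ominus uH^2$, $P_u:L^2(\mathbb{T})\to K_u^2$ is the orthogonal projection, and $K_u^\infty$ is the (dense) set of bounded functions in $K_u^2$. For $\Phi\in L^2(\mathbb{T})$, the truncated Toeplitz operator $A_\Phi$ is defined on $K_u^\infty$ by $A_\Phi f=P_u(\Phi f)$. $\mathcal{T}_u$ is the set of those operators $A_\Phi$ that extend to bounded operators on $K_u^2$ (identified with their bounded extensions). $\Phi$ is called a symbol of $A$ if $A=A_\Phi$; symbols are not unique. On $K_u^2$: $Cf=u\overline{zf}$ (an antilinear isometric involution of $K_u^2$), and $S_uf=P_u(zf)$. Type: an operator $A\in\mathcal{T}_u$ is of type $\alpha\in\mathbb{C}$ if it has a symbol of the form $\varphi+\alpha\overline{S_uC\varphi}+c$ with $\varphi\in K_u^2$ and $c\in\mathbb{C}$. $A\in\mathcal{T}_u$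 is of type $\infty$ if it has an antiholomorphic symbol, i.e. a symbol $\overline{\psi}$ with $\psi\in H^2$. *)

(* Defs.v *)
(* Functions on the unit circle T are functions of an
   angle: t in [0, 1] stands for the point e^(2 i pi t), so that the normalized
   Lebesgue measure of T is the Lebesgue measure on [0, 1].  Elements of L^2(T)
   are representatives R -> R[i] whose values outside [0, 1] are irrelevant;
   equality in L^2(T) is [aeT]. *)
From HB Require Import structures.
From mathcomp Require Import all_boot all_order all_algebra complex.
From mathcomp Require Import all_classical all_reals all_analysis.
Set Implicit Arguments.
Unset Strict Implicit.
Unset Printing Implicit Defensive.
Import Order.TTheory GRing.Theory Num.Theory.
Local Open Scope complex_scope.
Local Open Scope classical_set_scope.
Local Open Scope ring_scope.

Section Circle.
Variable R : realType.

Definition Tfun := R -> R[i].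

Definition arcT : set R := `[0, 1]%classic.

Definition zT : Tfun :=
  fun t => cos (2 * pi * t) +i* sin (2 * pi * t).

Definition conjT (f : Tfun) : Tfun := fun t => (f t)^*.

Definition aeT (P : R -> Prop) : Prop :=
  {ae @lebesgue_measure R, forall t, arcT t -> P t}.

Definition eqT (f g : Tfun) : Prop := aeT (fun t => f t = g t).

Definition intT (f : Tfun) : R[i] :=
  (\int[@lebesgue_measure R]_(t in arcT) complex.Re (f t)) +i*
  (\int[@lebesgue_measure R]_(t in arcT) complex.Im (f t)).

Definition sqnormc (w : R[i]) : R := complex.Re w ^+ 2 + complex.Im w ^+ 2.

Definition L2 : set Tfun := [set f |
  [/\ measurable_fun arcT (fun t => complex.Re (f t)),
      measurable_fun arcT (fun t => complex.Im (f t)) &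
      (\int[@lebesgue_measure R]_(t in arcT) (sqnormc (f t))%:E < +oo)%E]].

Definition dotT (f g : Tfun) : R[i] := intT (f \* conjT g).

Definition normT (f : Tfun) : R :=
  Num.sqrt (\int[@lebesgue_measure R]_(t in arcT) sqnormc (f t)).

Definition fourier (f : Tfun) (n : int) : R[i] := dotT f (fun t => zT t ^ n).

Definition H2 : set Tfun :=
  [set f | L2 f /\ forall n : int, n < 0 -> fourier f n = 0].

Definition inner (u : Tfun) : Prop := H2 u /\ aeT (fun t => `|u t| = 1).

Definition constantT (u : Tfun) : Prop := exists c : R[i], eqT u (cst c).

Section ModelSpace.
Variable u : Tfun.

Definition Ku : set Tfun :=
  [set f | H2 f /\ forall g, H2 g -> dotT f (u \* g) = 0].

Definition Kuoo : set Tfun :=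
  [set f | Ku f /\ exists M : R, aeT (fun t => `|f t| <= M%:C)].

(* A representative, unique up to a.e. equality, of the orthogonal projection
   of f onto K_u^2. *)
Definition Pu (f : Tfun) : Tfun :=
  xget (cst 0) [set g | Ku g /\ forall h, Ku h -> dotT (f \- g) h = 0].

Definition Cu (f : Tfun) : Tfun := u \* conjT (zT \* f).

Definition Su (f : Tfun) : Tfun := Pu (zT \* f).

Definition Atrunc (Phi f : Tfun) : Tfun := Pu (Phi \* f).

(* Operators on K_u^2 act on representatives.  Linearity and boundedness up to
   a.e. equality force them to respect a.e. equality on K_u^2. *)
Definition bounded_op (A : Tfun -> Tfun) : Prop :=
  [/\ forall f, Ku f -> Ku (A f),
      forall (c : R[i]) f g, Ku f -> Ku g ->
        eqT (A (cst c \* f \+ g)) (cst c \* A f \+ A g) &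
      exists M : R, forall f, Ku f -> normT (A f) <= M * normT f].

Definition symbol (Phi : Tfun) (A : Tfun -> Tfun) : Prop :=
  L2 Phi /\ forall f, Kuoo f -> eqT (A f) (Atrunc Phi f).

Definition Tu : set (Tfun -> Tfun) :=
  [set A | bounded_op A /\ exists Phi, symbol Phi A].

Definition scalar_op (A : Tfun -> Tfun) : Prop :=
  exists c : R[i], forall f, Ku f -> eqT (A f) (cst c \* f).

(* [None] is the point at infinity of the set of types. *)
Definition of_type (alpha : option R[i]) (A : Tfun -> Tfun) : Prop :=
  Tu A /\
  match alpha with
  | Some a => exists phi (c : R[i]), Ku phi /\
      symbol (phi \+ cst a \* conjT (Su (Cu phi)) \+ cst c) A
  | None => exists psi, H2 psi /\ symbol (conjT psi) A
  end.

End ModelSpace.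
End Circle.

(* Main.v *)
(* Every question about A_Phi on bounded elements of K_u is one about the
   sesquilinear form (f, g) |-> int Phi f conj(g).  Write k0 = P_u 1 and let
   ck0 = C k0.  For f in K_u the compressed shift is S f = z f - <f, ck0> u, and
     <A S f, g> - <A f, S^* g> = <k0, g> L(f) - <f, ck0> L(C g),
   where L(f) = int Phi z f; with J(f) = int Phi conj(u) z f one also has
     <A f, ck0> = J(f) - conj(u(0)) L(f).
   Let W be the orthogonal complement of ck0 in K_u.  Then A is of type a iff
   L = a J on W, of type oo iff J = 0 on W, and scalar iff L = J = 0 on W.  If A,
   B and A B all have symbols, comparing the three commutator formulas gives
   J_A(h) L_B(f) = J_B(f) L_A(h) for f, h in W, whence the dichotomy.

   Conversely, if 1 - conj(u(0)) a <> 0, a bounded operator of type a commutes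
   with X = (1 - conj(u(0)) a) S + a k0 (x) ck0.  So does the product A B of two
   of them, and it agrees on k0, hence on all X^n k0, with the truncated Toeplitz
   operator of a symbol of type a; the X^n k0 span a dense subspace.  The
   remaining types, oo and 1 / conj(u(0)), reduce to these by A |-> C A C, which
   is multiplicative and exchanges the types a and 1 / conj(a).

   A function with vanishing Fourier coefficients is zero because polynomials in
   cos approximate indicators of arcs boundedly and pointwise. *)
Require Import Defs.
From mathcomp Require Import all_boot all_order all_algebra complex.
From mathcomp Require Import all_classical all_reals all_analysis.
From mathcomp Require Import measurable_realfun.
From mathcomp Require Import ring lra.
Set Implicit Arguments.
Unset Strict Implicit.
Unset Printing Implicit Defensive.
Import Order.TTheory GRing.Theory Num.Theory.
Import numFieldNormedType.Exports.
Local Open Scope complex_scope.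
Local Open Scope classical_set_scope.
Local Open Scope ring_scope.

(** * Integration of complex functions on the circle *)

(** The obstacle is that Phi f leaves L^2 when f is unbounded, and that A f is not known to be
    bounded when f is. The integral form is therefore used only with a bounded argument, while L and
    J, scalar products of z f with fixed elements of L^2, make sense on all of K_u. Bounded
    arguments are freed one variable at a time, by two facts: P_u z^n is bounded, and a bounded A
    with a symbol has adjoint C A C, which has a symbol too.

    The operator X comes from the commutator formula. Put b = 1 - conj(u(0)) a. If L - a J = kappa
    <., ck0> on K_u, the formula for <A f, ck0> gives b L(f) = a <A f, ck0> + kappa <f, ck0>.
    Substituted into b (A S - S A), the terms in kappa cancel, and what is left is -a times the
    commutator of A with k0 (x) ck0.

    The truncated Toeplitz operator with which A B is compared is not known to be bounded, so
    density of the X^n k0 is used with a fixed bounded g, for which f -> int Phi f conj(g) is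
    continuous. Non-constancy of u enters through 1 - |u(0)|^2 <> 0, that is, k0 <> 0. *)

Section Integration.
Variable R : realType.
Implicit Types (f g h : Tfun R) (a b c : R[i]).

Local Notation mu := (@lebesgue_measure R).
Local Notation Re := (@complex.Re R).
Local Notation Im := (@complex.Im R).

Lemma measurable_arcT : measurable (@arcT R : set (measurableTypeR R)).
Proof. exact: measurable_itv. Qed.

Lemma mu_arcT : lebesgue_measure (@arcT R) = 1%E.
Proof. by rewrite /arcT lebesgue_measure_itv /= lte_fin ltr01 oppr0 adde0. Qed.

Hint Resolve measurable_arcT : core.

#[global] Instance lebesgue_ae_filter :
  Filter (nbhs (almost_everywhere mu)) := ae_filter_ringOfSetsType mu.

Lemma aeTW (P : R -> Prop) : (forall t, P t) -> aeT P.
Proof. by move=> PT; apply: aeW => t _. Qed.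

Lemma aeTS (P Q : R -> Prop) : (forall t, P t -> Q t) -> aeT P -> aeT Q.
Proof.
by move=> PQ; rewrite /aeT; apply: filterS => t Pt /Pt /PQ.
Qed.

Lemma aeTS2 (P P' Q : R -> Prop) :
  (forall t, P t -> P' t -> Q t) -> aeT P -> aeT P' -> aeT Q.
Proof.
move=> PQ; rewrite /aeT; apply: filterS2 => t Pt P't tT; exact: PQ (Pt tT) (P't tT).
Qed.

Lemma eqT_refl f : eqT f f. Proof. exact: aeTW. Qed.
Lemma eqT_sym f g : eqT f g -> eqT g f.
Proof. exact: aeTS. Qed.
Lemma eqT_trans g f h : eqT f g -> eqT g h -> eqT f h.
Proof. by apply: aeTS2 => t -> ->. Qed.
Hint Resolve eqT_refl : core.

Definition measT f :=
  measurable_fun (@arcT R) (fun t => Re (f t)) /\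
  measurable_fun (@arcT R) (fun t => Im (f t)).

Definition L1 f :=
  mu.-integrable (@arcT R) (EFin \o (fun t => Re (f t))) /\
  mu.-integrable (@arcT R) (EFin \o (fun t => Im (f t))).

Lemma ReD a b : Re (a + b) = Re a + Re b. Proof. by case: a; case: b. Qed.
Lemma ImD a b : Im (a + b) = Im a + Im b. Proof. by case: a; case: b. Qed.
Lemma ReN a : Re (- a) = - Re a. Proof. by case: a. Qed.
Lemma ImN a : Im (- a) = - Im a. Proof. by case: a. Qed.
Lemma ReM a b : Re (a * b) = Re a * Re b - Im a * Im b.
Proof. by case: a; case: b. Qed.
Lemma ImM a b : Im (a * b) = Re a * Im b + Im a * Re b.
Proof. by case: a => x y; case: b => z t /=; rewrite addrC addrC. Qed.
Lemma ReJ a : Re a^* = Re a. Proof. by case: a. Qed.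
Lemma ImJ a : Im a^* = - Im a. Proof. by case: a. Qed.

Lemma complex_eqP a b : Re a = Re b -> Im a = Im b -> a = b.
Proof. by case: a => ? ?; case: b => ? ? /= -> ->. Qed.

Definition ReIm := (ReD, ImD, ReN, ImN, ReM, ImM, ReJ, ImJ).

Lemma conjcD a b : (a + b)^* = a^* + b^*.
Proof. exact: rmorphD. Qed.
Lemma conjcN a : (- a)^* = - a^*.
Proof. exact: rmorphN. Qed.
Lemma conjcB a b : (a - b)^* = a^* - b^*.
Proof. exact: rmorphB. Qed.
Lemma conjcM a b : (a * b)^* = a^* * b^*.
Proof. exact: rmorphM. Qed.
Lemma conjcKK a : a^*^* = a. Proof. exact: conjCK. Qed.
Lemma conjc_0 : (0 : R[i])^* = 0. Proof. exact: conjC0. Qed.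
Lemma conjc_1 : (1 : R[i])^* = 1. Proof. exact: conjC1. Qed.
Lemma conjcV a : (a^-1)^* = (a^*)^-1. Proof. exact: fmorphV. Qed.
Definition conjcE := (conjcD, conjcN, conjcM, conjcKK, conjc_0, conjc_1).

Lemma measTD f g : measT f -> measT g -> measT (f \+ g).
Proof.
move=> [fR fI] [gR gI]; split.
  under eq_fun do rewrite /= ReD; exact: measurable_funD.
under eq_fun do rewrite /= ImD; exact: measurable_funD.
Qed.

Lemma measTM f g : measT f -> measT g -> measT (f \* g).
Proof.
move=> [fR fI] [gR gI]; split.
  under eq_fun do rewrite /= ReM.
  by apply: measurable_funB; apply: measurable_funM.
under eq_fun do rewrite /= ImM.
by apply: measurable_funD; apply: measurable_funM.
Qed.

Lemma measT_conj f : measT f -> measT (conjT f).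
Proof.
move=> [fR fI]; split.
  by under eq_fun do rewrite /conjT ReJ.
by under eq_fun do rewrite /conjT ImJ; exact: measurableT_comp.
Qed.

Lemma measT_cst c : measT (cst c).
Proof. by split; exact: measurable_cst. Qed.

Lemma measT_sqnormc f : measT f -> measurable_fun (@arcT R) (fun t => sqnormc (f t)).
Proof.
by move=> [fR fI]; apply: measurable_funD; apply: measurable_funX.
Qed.

Lemma le_I1 (p q : R -> R) : measurable_fun (@arcT R) p ->
  aeT (fun t => `|p t| <= q t) ->
  mu.-integrable (@arcT R) (EFin \o q) -> mu.-integrable (@arcT R) (EFin \o p).
Proof.
move=> mp pq /integrableP[mq iq]; apply/integrableP; split.
  exact/measurable_EFinP.
apply: le_lt_trans iq; apply: ae_ge0_le_integral => //.
- by apply: measurableT_comp => //; exact/measurable_EFinP.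
- exact: measurableT_comp.
- apply: aeTS pq => t; rewrite /= lee_fin => /le_trans; apply.
  exact: ler_norm.
Qed.

Lemma I1D (p q : R -> R) : mu.-integrable (@arcT R) (EFin \o p) ->
  mu.-integrable (@arcT R) (EFin \o q) ->
  mu.-integrable (@arcT R) (EFin \o (fun t => p t + q t)).
Proof. move=> ip iq; exact: (integrableD measurable_arcT ip iq). Qed.

Lemma I1Z (k : R) (p : R -> R) : mu.-integrable (@arcT R) (EFin \o p) ->
  mu.-integrable (@arcT R) (EFin \o (fun t => k * p t)).
Proof. move=> ip; exact: (integrableZl measurable_arcT k ip). Qed.

Lemma I1_cst (k : R) : mu.-integrable (@arcT R) (EFin \o cst k).
Proof.
apply: measurable_bounded_integrable => //; first by rewrite [X in (X < _)%E]mu_arcT ltry.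
exact: bounded_cst.
Qed.

Lemma intTD f g : L1 f -> L1 g -> intT (f \+ g) = intT f + intT g.
Proof.
move=> [fR fI] [gR gI]; apply: complex_eqP; rewrite ?ReIm /=.
  by under eq_Rintegral do rewrite /= ReD; rewrite RintegralD.
by under eq_Rintegral do rewrite /= ImD; rewrite RintegralD.
Qed.

Lemma intTZ c f : L1 f -> intT (cst c \* f) = c * intT f.
Proof.
move=> [fR fI]; apply: complex_eqP; rewrite ?ReIm /=.
  under eq_Rintegral do rewrite /= ReM.
  by rewrite RintegralB ?RintegralZl //; exact: I1Z.
under eq_Rintegral do rewrite /= ImM.
by rewrite RintegralD ?RintegralZl //; exact: I1Z.
Qed.

Lemma intT_conj f : L1 f -> intT (conjT f) = (intT f)^*.
Proof.
move=> [fR fI]; apply: complex_eqP; rewrite ?ReIm /=.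
  by under eq_Rintegral do rewrite /conjT ReJ.
under eq_Rintegral do rewrite /conjT ImJ -mulN1r.
by rewrite RintegralZl // mulN1r.
Qed.

Lemma eq_intT_meas f g : measT f -> measT g -> eqT f g -> intT f = intT g.
Proof.
move=> [fR fI] [gR gI] fg; rewrite /intT /Rintegral; congr (fine _ +i* fine _).
  apply: ae_eq_integral => //; try exact/measurable_EFinP.
  by apply: aeTS fg => t /= ->.
apply: ae_eq_integral => //; try exact/measurable_EFinP.
by apply: aeTS fg => t /= ->.
Qed.

Lemma sqnormc_ge0 c : 0 <= sqnormc c.
Proof. by rewrite addr_ge0 // sqr_ge0. Qed.

Lemma L2_meas f : L2 f -> measT f. Proof. by case. Qed.

Lemma L2_sq f : L2 f -> mu.-integrable (@arcT R) (EFin \o (fun t => sqnormc (f t))).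
Proof.
move=> [fR fI fi]; have ms := measT_sqnormc (conj fR fI).
apply/integrableP; split; first exact/measurable_EFinP.
apply: le_lt_trans fi; apply: ge0_le_integral => //=.
- by apply: measurableT_comp => //; exact: measurableT_comp.
- exact: measurableT_comp.
- by move=> t _; rewrite lee_fin ger0_norm // sqnormc_ge0.
Qed.

Lemma L2P f : measT f ->
  mu.-integrable (@arcT R) (EFin \o (fun t => sqnormc (f t))) -> L2 f.
Proof.
by move=> [mR mI] /(integrable_lty measurable_arcT) ?; split.
Qed.

Lemma le_L2 f (q : R -> R) : measT f -> aeT (fun t => sqnormc (f t) <= q t) ->
  mu.-integrable (@arcT R) (EFin \o q) -> L2 f.
Proof.
move=> mf fq iq; apply: L2P => //; apply: le_I1 iq; first exact: measT_sqnormc.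
by apply: aeTS fq => t; rewrite ger0_norm // sqnormc_ge0.
Qed.

Lemma L2D f g : L2 f -> L2 g -> L2 (f \+ g).
Proof.
move=> f2 g2; apply: (@le_L2 _ (fun t => 2 * sqnormc (f t) + 2 * sqnormc (g t))).
- by apply: measTD; exact: L2_meas.
- apply: aeTW => t; rewrite /sqnormc !ReIm /=.
  have := sqr_ge0 (Re (f t) - Re (g t)); have := sqr_ge0 (Im (f t) - Im (g t)).
  by nra.
- by apply: I1D; apply: I1Z; exact: L2_sq.
Qed.

Lemma L2_conj f : L2 f -> L2 (conjT f).
Proof.
move=> f2; apply: (le_L2 _ _ (L2_sq f2)); first exact/measT_conj/L2_meas.
by apply: aeTW => t; rewrite /sqnormc /conjT !ReIm sqrrN.
Qed.

(** The bound is put on the squared modulus so that it is an inequality in [R]; [KuooP] matches it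
    with the bound on the modulus in [Kuoo]. *)
Definition Linf f := measT f /\ exists M : R, aeT (fun t => sqnormc (f t) <= M).

Lemma sqnormc_le0 a : sqnormc a <= 0 -> a = 0.
Proof.
rewrite /sqnormc => a0; have r0 := sqr_ge0 (Re a); have i0 := sqr_ge0 (Im a).
by apply: complex_eqP => /=; apply/eqP; rewrite -sqrf_eq0 eq_le ?r0 ?i0 andbT; lra.
Qed.

Lemma sqnormcM a b : sqnormc (a * b) = sqnormc a * sqnormc b.
Proof. by rewrite /sqnormc !ReIm; ring. Qed.

Lemma sqnormcJ a : sqnormc a^* = sqnormc a.
Proof. by rewrite /sqnormc !ReIm sqrrN. Qed.

Lemma sqnormcE a : (sqnormc a)%:C = a * a^*.
Proof. by apply: complex_eqP; rewrite !ReIm /= /sqnormc; ring. Qed.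

Lemma L2_Minf f g : Linf f -> L2 g -> L2 (f \* g).
Proof.
move=> [mf [M fM]] g2; apply: (@le_L2 _ (fun t => M * sqnormc (g t))).
- exact/measTM/L2_meas.
- by apply: aeTS fM => t ftM /=; rewrite sqnormcM ler_wpM2r // sqnormc_ge0.
- exact/I1Z/L2_sq.
Qed.

Lemma L2_infM f g : L2 f -> Linf g -> L2 (f \* g).
Proof.
move=> f2 g2; rewrite (_ : f \* g = g \* f); first exact: L2_Minf.
by apply: funext => t /=; rewrite mulrC.
Qed.

Lemma Linf_cst c : Linf (cst c).
Proof. by split; [exact: measT_cst|exists (sqnormc c); exact: aeTW]. Qed.

Lemma Linf_conj f : Linf f -> Linf (conjT f).
Proof.
move=> [mf [M fM]]; split; first exact: measT_conj.
by exists M; apply: aeTS fM => t; rewrite sqnormcJ.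
Qed.

Lemma LinfM f g : Linf f -> Linf g -> Linf (f \* g).
Proof.
move=> [mf [M fM]] [mg [N gN]]; split; first exact: measTM.
exists (M * N); apply: aeTS2 fM gN => t fM gN /=; rewrite sqnormcM.
by apply: ler_pM => //; exact: sqnormc_ge0.
Qed.

Lemma LinfD f g : Linf f -> Linf g -> Linf (f \+ g).
Proof.
move=> [mf [M fM]] [mg [N gN]]; split; first exact: measTD.
exists (2 * M + 2 * N); apply: aeTS2 fM gN => t; rewrite /sqnormc !ReIm /=.
have := sqr_ge0 (Re (f t) - Re (g t)); have := sqr_ge0 (Im (f t) - Im (g t)).
by nra.
Qed.

Lemma Linf_L2 f : Linf f -> L2 f.
Proof. by move=> [mf [M fM]]; exact: le_L2 fM (I1_cst M). Qed.

Lemma L2_cst c : L2 (cst c).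
Proof. exact/Linf_L2/Linf_cst. Qed.

Lemma L2Z c f : L2 f -> L2 (cst c \* f).
Proof. exact/L2_Minf/Linf_cst. Qed.

Lemma fctBE f g : f \- g = f \+ cst (-1) \* g.
Proof. by apply: funext => t /=; rewrite mulN1r. Qed.

Lemma L2B f g : L2 f -> L2 g -> L2 (f \- g).
Proof. by move=> f2 g2; rewrite fctBE; exact/L2D/L2Z. Qed.

Lemma LinfB f g : Linf f -> Linf g -> Linf (f \- g).
Proof. by move=> f2 g2; rewrite fctBE; exact/LinfD/LinfM/g2/Linf_cst. Qed.

Lemma L2M_L1 f g : L2 f -> L2 g -> L1 (f \* g).
Proof.
move=> f2 g2.
have [mR mI] := measTM (L2_meas f2) (L2_meas g2).
have i2 := I1D (L2_sq f2) (L2_sq g2).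
by split; (apply: (le_I1 _ _ i2) => //; apply: aeTW => t;
  rewrite /sqnormc !ReIm /= real_ler_norml ?num_real //;
  have := sqr_ge0 (Re (f t) - Re (g t)); have := sqr_ge0 (Im (f t) - Im (g t));
  have := sqr_ge0 (Re (f t) + Re (g t)); have := sqr_ge0 (Im (f t) + Im (g t));
  have := sqr_ge0 (Im (f t) - Re (g t)); have := sqr_ge0 (Re (f t) - Im (g t));
  have := sqr_ge0 (Im (f t) + Re (g t)); have := sqr_ge0 (Re (f t) + Im (g t));
  move=> *; apply/andP; split; nra).
Qed.

End Integration.

Arguments measurable_arcT {R}.

(** * Almost everywhere limits and Fatou's lemma *)

Section Completeness.
Variable R : realType.
Implicit Types (f g h : Tfun R) (a b c : R[i]).

Local Notation mu := (@lebesgue_measure R).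
Local Notation Re := (@complex.Re R).
Local Notation Im := (@complex.Im R).

Hint Resolve measurable_arcT : core.

Lemma summable_cvg (x : nat -> R) :
  (\sum_(k <oo) `|x k.+1 - x k|%:E < +oo)%E -> cvgn x.
Proof.
set S := (\sum_(k <oo) _)%E => Soo.
have S0 : (0 <= S)%E by apply: nneseries_ge0.
have Sfin : S \is a fin_num by rewrite ge0_fin_numE.
have : cvgn [normed series (telescope x)].
  apply: nondecreasing_is_cvgn.
    by apply: nondecreasing_series => n _ _; exact: normr_ge0.
  exists (fine S) => _ [n _ <-]; rewrite -lee_fin fineK // /series /= -sumEFin.
  by apply: nneseries_lim_ge => k _ _; rewrite lee_fin.
move=> /normed_cvg; rewrite telescopeK => /cvg_ex [l xl].
apply/cvg_ex; exists (l + x 0%N).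
have -> : x = (fun n => (x n - x 0%N) + x 0%N).
  by apply: funext => n; rewrite subrK.
by apply: cvgD => //; rewrite subrK; exact: cvg_cst.
Qed.

(** The sum of the increments has a finite integral, by comparison with a geometric series, so it is
    finite almost everywhere; there the telescoping series converges absolutely. *)
Lemma ae_cvg_of_summable (h : nat -> R -> R) :
  (forall k, measurable_fun (@arcT R) (h k)) ->
  (forall k, (\int[mu]_(t in @arcT R) `|h k.+1 t - h k t|%:E <= (2^-1 ^+ k)%:E)%E) ->
  exists2 g : R -> R, measurable_fun (@arcT R) g &
    aeT (fun t => h ^~ t @ \oo --> g t).
Proof.
move=> mh hS.
pose d k t := `|h k.+1 t - h k t|%:E.
have md k : measurable_fun (@arcT R) (d k).
  apply/measurable_EFinP/measurableT_comp => //.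
  exact: measurable_funB.
have d0 k t : @arcT R t -> (0 <= d k t)%E by rewrite lee_fin.
pose S t := (\sum_(k <oo) d k t)%E.
have mS : measurable_fun (@arcT R) S.
  by apply: ge0_emeasurable_sum => // k t tT _; exact: d0.
have iS : mu.-integrable (@arcT R) S.
  apply/integrableP; split; first exact: mS.
  have -> : (\int[mu]_(t in @arcT R) `|S t| = \int[mu]_(t in @arcT R) S t)%E.
    by apply: eq_integral => t _; rewrite gee0_abs //; apply: nneseries_ge0 => k _ _; rewrite lee_fin.
  rewrite integral_nneseries //.
  apply: (@le_lt_trans _ _ (\sum_(k <oo) ((2 / (2 ^ (k + 1))%:R)%:E : \bar R))%E).
    apply: lee_nneseries => k; first by move=> _ _; apply: integral_ge0 => t _; rewrite lee_fin.
    move=> _; apply: le_trans (hS k) _; rewrite lee_fin addn1 natrX exprS invfM mulrA.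
    by rewrite divff ?mul1r ?exprVn.
  have := cvg_lim (@ereal_hausdorff R) (@cvg_geometric_eseries_half R 2 0).
  by rewrite /eseries expr0 divr1 => ->; rewrite ltry.
have [N [mN N0 hN]] : aeT (fun t => cvgn (h ^~ t)).
  have := integrable_ae measurable_arcT iS.
  apply: aeTS => t; rewrite /= ge0_fin_numE; last first.
    by apply: nneseries_ge0 => k _ _; rewrite lee_fin.
  exact: summable_cvg.
(* Replacing the sequence by 0 on the null set [N] makes it converge at every point of the arc, so
   that its limit is measurable. *)
pose h' k t := h k t * \1_(~` N) t.
have ch t : @arcT R t -> cvgn (h' ^~ t).
  move=> tT; rewrite /h' indicE; case: (boolP (t \in ~` N)) => [|_].
    rewrite inE => /= tN; under eq_fun do rewrite mulr1.
    by apply: contrapT => nc; apply: tN; apply: hN => /=; tauto.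
  under eq_fun do rewrite mulr0; exact: is_cvg_cst.
exists (fun t => limn (h' ^~ t)).
  apply: (@measurable_fun_cvg _ _ _ _ h').
    move=> m; apply: measurable_funM => //; apply: measurable_indic.
    exact: measurableC.
  by move=> t tT; exact: ch.
exists N; split => // t /=; apply: contra_notP => tN tT.
have hE : h' ^~ t = h ^~ t.
  by apply: funext => k; rewrite /h' indicE mem_set // mulr1.
by rewrite -hE; exact: ch.
Qed.

(** Fatou's lemma needs no dominating function, so it turns the pointwise limit of a Cauchy sequence
    into its limit in L^2. *)
Lemma fatou_sq (f_ : nat -> Tfun R) f (e : R) :
  (forall k, measT (f_ k)) -> measT f ->
  aeT (fun t => Re \o f_^~ t @ \oo --> Re (f t)) ->
  aeT (fun t => Im \o f_^~ t @ \oo --> Im (f t)) ->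
  (\forall k \near \oo, (\int[mu]_(t in @arcT R) (sqnormc (f_ k t))%:E <= e%:E)%E) ->
  (\int[mu]_(t in @arcT R) (sqnormc (f t))%:E <= e%:E)%E.
Proof.
move=> mf_ mf cR cI fe.
have ms g : measT g -> measurable_fun (@arcT R) (fun t => (sqnormc (g t))%:E).
  by move=> mg; apply/measurable_EFinP; apply: measT_sqnormc.
have s0 g t : @arcT R t -> (0 <= (sqnormc (g t))%:E)%E.
  by move=> _; rewrite lee_fin sqnormc_ge0.
have := @fatou _ _ _ mu _ measurable_arcT (fun k t => (sqnormc (f_ k t))%:E)
  (fun k => ms _ (mf_ k)) (fun k => s0 (f_ k)).
have le1 : (limn_einf (fun n => \int[mu]_(x in @arcT R) (sqnormc (f_ n x))%:E) <= e%:E)%E.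
  rewrite limn_einf_lim; apply: lime_le; first exact: is_cvg_einfs.
  apply: filterS fe => n; apply: le_trans; apply: ereal_inf_lbound.
  by exists n => //=.
move=> /le_trans /(_ le1); apply: le_trans.
apply: ae_ge0_le_integral => //.
- by move=> t tT; exact: s0.
- exact: ms.
- move=> t tT; rewrite limn_einf_lim; apply: lime_ge; first exact: is_cvg_einfs.
  by apply: nearW => n; apply: le_ereal_inf_tmp => _ [k _ <-]; rewrite lee_fin sqnormc_ge0.
- have : measurable_fun (@arcT R)
      (fun t => - limn_esup (fun k => - (sqnormc (f_ k t))%:E))%E.
    apply: measurableT_comp => //; apply: measurable_fun_limn_esup => k.
    by apply: measurableT_comp => //; exact: ms.
  by [].
- apply: aeTS2 cR cI => t cR cI.
  suff /cvg_limn_einf_sup [-> _] :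
    (sqnormc (f_ k t))%:E @[k --> \oo] --> (sqnormc (f t))%:E by [].
  apply: cvg_EFin; first exact: nearW.
  rewrite /sqnormc !expr2; under eq_fun do rewrite /= !expr2.
  by apply: cvgD; apply: cvgM.
Qed.

End Completeness.

(** * The Hilbert space L^2 *)

Section Hilbert.
Variable R : realType.
Implicit Types (f g h : Tfun R) (a b c : R[i]).

Local Notation mu := (@lebesgue_measure R).
Local Notation Re := (@complex.Re R).
Local Notation Im := (@complex.Im R).

Hint Resolve measurable_arcT : core.
Hint Resolve L2D L2Z L2B L2_cst L2_conj : core.

Definition sqnorm f : R := \int[mu]_(t in @arcT R) sqnormc (f t).

Lemma sqnorm_ge0 f : 0 <= sqnorm f.
Proof. by apply: Rintegral_ge0 => t _; exact: sqnormc_ge0. Qed.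
Hint Resolve sqnorm_ge0 : core.

Lemma integral_EFin (q : R -> R) : mu.-integrable (@arcT R) (EFin \o q) ->
  (\int[mu]_(t in @arcT R) (q t)%:E = (\int[mu]_(t in @arcT R) q t)%:E)%E.
Proof. by move=> iq; rewrite /Rintegral fineK //; exact: integrable_fin_num. Qed.

Lemma normT_sq f : normT f ^+ 2 = sqnorm f.
Proof. exact: sqr_sqrtr (sqnorm_ge0 f). Qed.

Lemma eq_dotT f g f' g' : L2 f -> L2 g -> L2 f' -> L2 g' ->
  aeT (fun t => f t * (g t)^* = f' t * (g' t)^*) -> dotT f g = dotT f' g'.
Proof.
move=> f2 g2 f'2 g'2 e; apply: eq_intT_meas => //.
  by apply: measTM; [exact: L2_meas|exact/measT_conj/L2_meas].
by apply: measTM; [exact: L2_meas|exact/measT_conj/L2_meas].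
Qed.

Lemma dotDl f g h : L2 f -> L2 g -> L2 h ->
  dotT (f \+ g) h = dotT f h + dotT g h.
Proof.
move=> f2 g2 h2; rewrite /dotT -intTD; try by apply: L2M_L1; auto.
by congr intT; apply: funext => t /=; rewrite mulrDl.
Qed.

Lemma dotZl c f g : L2 f -> L2 g -> dotT (cst c \* f) g = c * dotT f g.
Proof.
move=> f2 g2; rewrite /dotT -intTZ; try by apply: L2M_L1; auto.
by congr intT; apply: funext => t /=; rewrite mulrA.
Qed.

Lemma dotC f g : L2 f -> L2 g -> dotT g f = (dotT f g)^*.
Proof.
move=> f2 g2; rewrite /dotT -intT_conj; try by apply: L2M_L1; auto.
by congr intT; apply: funext => t /=; rewrite /conjT /= conjcM conjcKK mulrC.
Qed.

Lemma dotDr f g h : L2 f -> L2 g -> L2 h ->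
  dotT h (f \+ g) = dotT h f + dotT h g.
Proof.
move=> f2 g2 h2; rewrite (dotC (L2D f2 g2) h2) dotDl // conjcD. by rewrite -!dotC.
Qed.

Lemma dotZr c f g : L2 f -> L2 g -> dotT g (cst c \* f) = c^* * dotT g f.
Proof. by move=> f2 g2; rewrite (dotC (L2Z c f2) g2) dotZl // conjcM -dotC. Qed.

Lemma dotBl f g h : L2 f -> L2 g -> L2 h ->
  dotT (f \- g) h = dotT f h - dotT g h.
Proof. by move=> *; rewrite fctBE dotDl ?dotZl ?mulN1r //; exact: L2Z. Qed.

Lemma dotBr f g h : L2 f -> L2 g -> L2 h ->
  dotT h (f \- g) = dotT h f - dotT h g.
Proof. by move=> *; rewrite fctBE dotDr ?dotZr ?conjcE ?mulN1r //; exact: L2Z. Qed.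

Lemma dot0l f : L2 f -> dotT (cst 0) f = 0.
Proof.
move=> f2; have -> : cst 0 = cst 0 \* (cst 0 : Tfun R).
  by apply: funext => t /=; rewrite mul0r.
by rewrite dotZl ?mul0r.
Qed.

Lemma dot0r f : L2 f -> dotT f (cst 0) = 0.
Proof. by move=> f2; rewrite dotC ?dot0l ?conjc_0. Qed.

Lemma dot_self f : L2 f -> dotT f f = (sqnorm f)%:C.
Proof.
move=> f2; apply: complex_eqP => /=.
  by apply: eq_Rintegral => t _; rewrite /conjT -sqnormcE.
transitivity (\int[mu]_(t in @arcT R) (0 : R)); last first.
  by rewrite Rintegral_cst ?mul0r //; exact: measurable_arcT.
by apply: eq_Rintegral => t _; rewrite /conjT -sqnormcE.
Qed.

Lemma sqnormE f : L2 f -> sqnorm f = Re (dotT f f).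
Proof. by move=> f2; rewrite dot_self. Qed.

Lemma sqnormB f g : L2 f -> L2 g ->
  sqnorm (f \- g) = sqnorm f + sqnorm g - 2 * Re (dotT f g).
Proof.
move=> f2 g2; rewrite !sqnormE; auto.
rewrite dotBl ?dotBr; auto; rewrite (dotC f2 g2) !ReIm; ring.
Qed.

Lemma sqnormD f g : L2 f -> L2 g ->
  sqnorm (f \+ g) = sqnorm f + sqnorm g + 2 * Re (dotT f g).
Proof.
move=> f2 g2; rewrite !sqnormE; auto.
rewrite dotDl ?dotDr; auto; rewrite (dotC f2 g2) !ReIm; ring.
Qed.

Lemma sqnormZ c f : L2 f -> sqnorm (cst c \* f) = sqnormc c * sqnorm f.
Proof.
move=> f2; rewrite !sqnormE ?dotZl ?dotZr; auto.
by rewrite mulrA -sqnormcE dot_self // !ReIm /= mul0r subr0.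
Qed.

Lemma cauchy_schwarz f g : L2 f -> L2 g ->
  sqnormc (dotT f g) <= sqnorm f * sqnorm g.
Proof.
move=> f2 g2; set p := dotT f g; set P := sqnormc p.
have P0 : 0 <= P := sqnormc_ge0 p.
have key (s : R) : 0 <= sqnorm f - 2 * s * P + s ^+ 2 * P * sqnorm g.
  have := sqnorm_ge0 (f \- cst (s%:C * p) \* g).
  rewrite sqnormB ?sqnormZ ?dotZr; auto.
  rewrite -/p sqnormcM /sqnormc /P /sqnormc !ReIm /=; lra.
have := sqnorm_ge0 g; rewrite le_eqVlt => /orP [/eqP q0|q0].
  (* When [sqnorm g] is 0 the bound [key] is affine in [s], and the value chosen next makes it equal
     to -1. *)
  rewrite -q0 mulr0; rewrite leNgt; apply/negP => P1.
  have := key ((sqnorm f + 1) / (2 * P)); rewrite -q0 mulr0 addr0.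
  have -> : 2 * ((sqnorm f + 1) / (2 * P)) * P = sqnorm f + 1.
    by field; rewrite gt_eqF.
  lra.
have := key (sqnorm g)^-1.
have -> : sqnorm f - 2 * (sqnorm g)^-1 * P + (sqnorm g)^-1 ^+ 2 * P * sqnorm g
   = sqnorm f - P / sqnorm g by field; rewrite gt_eqF.
by rewrite subr_ge0 ler_pdivrMr.
Qed.

(** Comes from expanding the square norm of s f - g and dividing by [s]. It stands in for the
    triangle inequality and keeps estimates free of square roots; a small [s] leaves the factor of
    [sqnorm f] close to 1. *)
Lemma sqnormD_le (s : R) f g : 0 < s -> L2 f -> L2 g ->
  sqnorm (f \+ g) <= (1 + s) * sqnorm f + (1 + s^-1) * sqnorm g.
Proof.
move=> s0 f2 g2; have := sqnorm_ge0 (cst s%:C \* f \- g).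
rewrite sqnormB ?sqnormZ ?dotZl ?sqnormD; auto.
rewrite /sqnormc !ReIm; set x := Re (dotT f g); set y := Im (dotT f g).
rewrite /= => h; have s1 : s^-1 * s = 1 by rewrite mulVf // gt_eqF.
have si : 0 < s^-1 by rewrite invr_gt0.
have := mulr_ge0 (ltW si) h.
have -> : s^-1 * ((s ^+ 2 + 0 ^+ 2) * sqnorm f + sqnorm g - 2 * (s * x - 0 * y))
  = (s^-1 * s) * s * sqnorm f + s^-1 * sqnorm g - 2 * (s^-1 * s) * x by ring.
by rewrite s1; lra.
Qed.

Lemma sqnorm_eq0 f : L2 f -> sqnorm f = 0 -> eqT f (cst 0).
Proof.
move=> f2 f0.
have mf : measurable_fun (@arcT R) (fun t => (sqnormc (f t))%:E).
  by apply/measurable_EFinP; apply: measT_sqnormc; exact: L2_meas.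
have := ae_eq_integral_abs mu measurable_arcT mf => -[+ _].
have -> : (\int[mu]_(x in @arcT R) `|(sqnormc (f x))%:E| = \int[mu]_(x in @arcT R) (sqnormc (f x))%:E)%E.
  by apply: eq_integral => t _; rewrite gee0_abs // lee_fin sqnormc_ge0.
rewrite integral_EFin; last exact: L2_sq.
rewrite [X in X%:E]f0 => /(_ erefl); apply: aeTS => t /= [].
rewrite /sqnormc => /eqP; rewrite paddr_eq0 ?sqr_ge0 // !sqrf_eq0.
by move=> /andP [/eqP fr /eqP fi]; apply: complex_eqP.
Qed.

Lemma sqnorm_eqT f g : L2 f -> L2 g -> eqT f g -> sqnorm f = sqnorm g.
Proof.
move=> f2 g2 e; rewrite !sqnormE //; congr Re; apply: eq_dotT => //.
by apply: aeTS e => t ->.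
Qed.

Lemma sqnorm_subC f g : sqnorm (f \- g) = sqnorm (g \- f).
Proof. by apply: eq_Rintegral => t _ /=; rewrite /sqnormc !ReIm; ring. Qed.

Lemma eqT_sqnorm f g : L2 f -> L2 g -> sqnorm (f \- g) = 0 -> eqT f g.
Proof.
move=> f2 g2 /sqnorm_eq0 => /(_ (L2B f2 g2)); apply: aeTS => t /= /eqP.
by rewrite subr_eq0 => /eqP.
Qed.

End Hilbert.

(** * Completeness of L^2 and orthogonal projections *)

Section Projection.
Variable R : realType.
Implicit Types (f g h : Tfun R) (a b c : R[i]).

Local Notation mu := (@lebesgue_measure R).
Local Notation Re := (@complex.Re R).
Local Notation Im := (@complex.Im R).

Hint Resolve measurable_arcT : core.
Hint Resolve L2D L2Z L2B L2_cst L2_conj sqnorm_ge0 : core.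

(** Integrates |p| <= e / 2 + |p|^2 / (2 e) over the circle, whose measure is 1. *)
Lemma integral_norm_le (p : R -> R) f (e : R) : 0 < e -> L2 f ->
  measurable_fun (@arcT R) p ->
  (forall t, p t ^+ 2 <= sqnormc (f t)) -> sqnorm f <= e ^+ 2 ->
  (\int[mu]_(t in @arcT R) `|p t|%:E <= e%:E)%E.
Proof.
move=> e0 f2 mp pf fe.
pose q t := e / 2 + (2 * e)^-1 * sqnormc (f t).
have iq : mu.-integrable (@arcT R) (EFin \o q).
  by apply: I1D; [exact: I1_cst|exact/I1Z/L2_sq].
apply: (@le_trans _ _ (\int[mu]_(t in @arcT R) (q t)%:E)%E).
  apply: ge0_le_integral => //.
  - by apply: measurableT_comp => //; exact: measurableT_comp.
  - by have /measurable_int := iq.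
  - move=> t _; rewrite lee_fin /q.
    apply: (@le_trans _ _ (e / 2 + (2 * e)^-1 * `|p t| ^+ 2)); last first.
      rewrite lerD2l ler_wpM2l ?invr_ge0 ?mulr_ge0 ?(ltW e0) //.
      by rewrite real_normK ?num_real.
    rewrite -subr_ge0.
    have -> : e / 2 + (2 * e)^-1 * `|p t| ^+ 2 - `|p t| = (2 * e)^-1 * (e - `|p t|) ^+ 2.
      by field; rewrite gt_eqF.
    by rewrite mulr_ge0 ?sqr_ge0 // invr_ge0 mulr_ge0 // ltW.
rewrite integral_EFin // lee_fin RintegralD //; last 2 first.
- exact: I1_cst.
- exact/I1Z/L2_sq.
rewrite Rintegral_cst // RintegralZl //; last exact: L2_sq.
rewrite (_ : fine _ = 1) ?mulr1; last by rewrite [X in fine X]mu_arcT.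
have : (2 * e)^-1 * sqnorm f <= (2 * e)^-1 * e ^+ 2.
  by rewrite ler_wpM2l // invr_ge0 mulr_ge0 // ltW.
have -> : (2 * e)^-1 * e ^+ 2 = e / 2 by field; rewrite gt_eqF.
rewrite -/(sqnorm f); lra.
Qed.

(** Riesz-Fischer: a rapidly Cauchy subsequence converges almost everywhere, and [fatou_sq] bounds
    the distance from every late term of the whole sequence to that limit. *)
Lemma L2_complete (F : nat -> Tfun R) :
  (forall n, L2 (F n)) ->
  (forall e : R, 0 < e -> exists N, forall m n, (N <= m)%N -> (N <= n)%N ->
     sqnorm (F m \- F n) <= e) ->
  exists2 f, L2 f & forall e : R, 0 < e -> exists N, forall n, (N <= n)%N ->
     sqnorm (F n \- f) <= e.
Proof.
move=> F2 Fc.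
have hp k : 0 < (2^-1 ^+ k : R) by rewrite exprn_gt0 // invr_gt0.
have hp2 k : 0 < ((2^-1 ^+ k) ^+ 2 : R) by rewrite exprn_gt0.
have [N hN] : {N : nat -> nat & forall k m n, (N k <= m)%N -> (N k <= n)%N ->
     sqnorm (F m \- F n) <= (2^-1 ^+ k) ^+ 2}.
  by exists (fun k => projT1 (cid (Fc _ (hp2 k)))) => k; case: cid.
(* Partial sums make [phi] nondecreasing and at least [N k]; the successor in each summand makes it
   also at least [k]. *)
pose phi k := (\sum_(i < k.+1) (N i).+1)%N.
have phiS k : (phi k <= phi k.+1)%N by rewrite {2}/phi big_ord_recr /= leq_addr.
have phiN k : (N k <= phi k)%N.
  rewrite /phi big_ord_recr /=; apply: leq_trans (leq_addl _ _); exact: leqnSn.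
have phik k : (k <= phi k)%N.
  by elim: k => // k IH; rewrite /phi big_ord_recr /= -[X in (X <= _)%N]addn1 leq_add.
have step k : sqnorm (F (phi k.+1) \- F (phi k)) <= (2^-1 ^+ k) ^+ 2.
  by apply: hN => //; apply: leq_trans (phiS _).
have mF n : measT (F n) := L2_meas (F2 n).
have [gr mgr cgr] : exists2 g : R -> R, measurable_fun (@arcT R) g &
    aeT (fun t => Re \o (F \o phi)^~ t @ \oo --> g t).
  apply: (@ae_cvg_of_summable _ (fun k t => Re (F (phi k) t))).
    by move=> k; case: (mF (phi k)).
  move=> k; apply: integral_norm_le (step k) => //; first exact: L2B.
    by apply: measurable_funB; [case: (mF (phi k.+1))|case: (mF (phi k))].
  by move=> t; rewrite /sqnormc !ReIm lerDl sqr_ge0.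
have [gi mgi cgi] : exists2 g : R -> R, measurable_fun (@arcT R) g &
    aeT (fun t => Im \o (F \o phi)^~ t @ \oo --> g t).
  apply: (@ae_cvg_of_summable _ (fun k t => Im (F (phi k) t))).
    by move=> k; case: (mF (phi k)).
  move=> k; apply: integral_norm_le (step k) => //; first exact: L2B.
    by apply: measurable_funB; [case: (mF (phi k.+1))|case: (mF (phi k))].
  by move=> t; rewrite /sqnormc !ReIm lerDr sqr_ge0.
pose f : Tfun R := fun t => gr t +i* gi t.
have mf : measT f by split.
have key (e : R) : 0 < e -> exists M, forall n, (M <= n)%N ->
    (\int[mu]_(t in @arcT R) (sqnormc ((F n \- f) t))%:E <= e%:E)%E.
  move=> e0; have [M hM] := Fc e e0; exists M => n Mn.
  have mB g g' : measT g -> measT g' -> measT (g \- g').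
    move=> mg mg'; rewrite fctBE; apply: measTD => //.
    by apply: measTM => //; exact: measT_cst.
  apply: (@fatou_sq _ (fun k => F n \- F (phi k))).
  - by move=> k; exact: mB.
  - exact: mB.
  - apply: aeTS cgr => t ct; rewrite /comp /= !ReIm /=.
    under eq_fun do rewrite !ReIm.
    by apply: cvgB ct; exact: cvg_cst.
  - apply: aeTS cgi => t ct; rewrite /comp /= !ReIm /=.
    under eq_fun do rewrite !ReIm.
    by apply: cvgB ct; exact: cvg_cst.
  - near=> k; rewrite integral_EFin; last exact/L2_sq/L2B.
    rewrite lee_fin; apply: hM => //.
    apply: leq_trans (phik k); near: k; exact: nbhs_infty_ge.
have [M hM] := key 1 ltr01.
have f2 : L2 f.
  have : L2 (F M \- f).
    have [mR mI] : measT (F M \- f).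
      rewrite fctBE; apply: measTD => //.
      by apply: measTM => //; exact: measT_cst.
    by split => //; apply: le_lt_trans (hM M (leqnn _)) _; rewrite ltry.
  move=> h2; have -> : f = F M \- (F M \- f).
    by apply: funext => t /=; rewrite subKr.
  exact: L2B.
exists f => // e e0; have [K hK] := key e e0; exists K => n Kn.
by have := hK n Kn; rewrite integral_EFin ?lee_fin //; exact/L2_sq/L2B.
Unshelve. all: by end_near. Qed.

(** A minimizing sequence for the distance from [f] to [V] is Cauchy by the parallelogram law, and
    the first variation at its limit vanishes. *)
Lemma closed_projection (V : set (Tfun R)) f :
  (forall g, V g -> L2 g) -> V (cst 0) ->
  (forall g h, V g -> V h -> V (g \+ h)) ->
  (forall c h, V h -> V (cst c \* h)) ->
  (forall p, L2 p ->
    (forall e : R, 0 < e -> exists2 g, V g & sqnorm (g \- p) <= e) -> V p) ->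
  L2 f -> exists2 g, V g & forall h, V h -> dotT (f \- g) h = 0.
Proof.
move=> V2 V0 VD VZ Vcl f2.
have VB g h : V g -> V h -> V (g \- h) by move=> *; rewrite fctBE; exact/VD/VZ.
pose D := [set sqnorm (f \- g) | g in V].
have Dinf : has_inf D.
  split; first by exists (sqnorm (f \- cst 0)), (cst 0).
  by exists 0 => _ [g _ <-]; exact: sqnorm_ge0.
pose d := inf D.
have dle g : V g -> d <= sqnorm (f \- g).
  by move=> Vg; apply: ge_inf; [case: Dinf|exists g].
have ex n : exists g, V g /\ sqnorm (f \- g) < d + n.+1%:R^-1.
  have [|_ [g Vg <-] h] := @inf_adherent _ D n.+1%:R^-1 _ Dinf.
    by rewrite invr_gt0.
  by exists g.
have [g hg] : {g : nat -> Tfun R & forall n, V (g n) /\ sqnorm (f \- g n) < d + n.+1%:R^-1}.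
  by exists (fun n => projT1 (cid (ex n))) => n; case: cid.
have Vg n : V (g n) by case: (hg n).
have gd n : sqnorm (f \- g n) <= d + n.+1%:R^-1 by apply: ltW; case: (hg n).
have par m n : sqnorm (g m \- g n) <= 2 * m.+1%:R^-1 + 2 * n.+1%:R^-1.
  pose x := f \- g m; pose y := f \- g n.
  have x2 : L2 x by apply: L2B => //; exact: V2.
  have y2 : L2 y by apply: L2B => //; exact: V2.
  have -> : g m \- g n = y \- x by apply: funext => t; rewrite /x /y /=; ring.
  have := dle _ (VZ (2^-1)%:C _ (VD _ _ (Vg m) (Vg n))).
  have -> : f \- cst (2^-1)%:C \* (g m \+ g n) = cst (2^-1)%:C \* (y \+ x).
    apply: funext => t; rewrite /x /y /=.
    have -> : f t - g n t + (f t - g m t) = f t + f t - (g m t + g n t) by ring.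
    rewrite mulrBr; congr (_ - _); apply: complex_eqP; rewrite !ReIm /=; lra.
  rewrite (sqnormZ _ (L2D y2 x2)) (sqnormD y2 x2) (sqnormB y2 x2).
  set r := Re _; have := gd m; have := gd n; rewrite -/x -/y /sqnormc /= => h1 h2 h3.
  have e4 : 2^-1 ^+ 2 + 0 ^+ 2 = 4^-1 :> R by field.
  rewrite e4 in h3; move: (n.+1%:R^-1) (m.+1%:R^-1) h1 h2 => a b h1 h2.
  move: (sqnorm x) (sqnorm y) r h1 h2 h3 => X Y r h1 h2 h3; lra.
have inv_small (e : R) : 0 < e -> exists N, forall n, (N <= n)%N -> n.+1%:R^-1 <= e.
  move=> e0; have [N _ hN] := near_infty_natSinv_lt (PosNum e0).
  by exists N => n /hN /ltW.
have g2 n : L2 (g n) by exact: V2.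
have [//|p p2 hp] := @L2_complete g g2.
  move=> e e0; have [|N hN] := inv_small (e / 4); first by rewrite divr_gt0.
  exists N => m n Nm Nn; apply: le_trans (par m n) _.
  have := hN m Nm; have := hN n Nn.
  by move: (m.+1%:R^-1) (n.+1%:R^-1) => x y; lra.
have Vp : V p.
  by apply: Vcl => // e /hp [N hN]; exists (g N) => //; exact: hN.
exists p => //.
have pd : sqnorm (f \- p) <= d.
  have key (s : R) : 0 < s -> s <= 1 -> sqnorm (f \- p) <= (1 + s) * (d + s) + s.
    move=> s0 s1; have si : 0 < 1 + s^-1 by rewrite ltr_pwDl // invr_ge0 ltW.
    have [|N1 hN1] := hp (s / (1 + s^-1)); first by rewrite divr_gt0.
    have [N2 hN2] := inv_small _ s0.
    pose n := maxn N1 N2.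
    have -> : f \- p = (f \- g n) \+ (g n \- p) by apply: funext => t /=; ring.
    apply: le_trans (sqnormD_le s0 _ _) _; auto; apply: lerD.
      apply: ler_wpM2l; first by rewrite addr_ge0 // ltW.
      by apply: le_trans (gd n) _; rewrite lerD2l hN2 // leq_maxr.
    apply: (@le_trans _ _ ((1 + s^-1) * (s / (1 + s^-1)))).
      by apply: ler_wpM2l; [exact: ltW|exact/hN1/leq_maxl].
    by rewrite mulrCA divff ?mulr1 // gt_eqF.
  have d0 : 0 <= d by apply: lb_le_inf; [case: Dinf|move=> _ [k _ <-]; exact: sqnorm_ge0].
  apply/ler_addgt0Pl => e e0.
  (* For s <= 1 the bound (1 + s) (d + s) + s is at most d + s (3 + d). *)
  pose s := Num.min 1 (e / (3 + d)).
  have s0 : 0 < s by rewrite lt_min ltr01 divr_gt0 // ltr_pwDl.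
  have s1 : s <= 1 by rewrite ge_min lexx.
  have sd : s * (3 + d) <= e.
    by rewrite -ler_pdivlMr ?ltr_pwDl // ge_min lexx orbT.
  by have := key s s0 s1; nra.
move=> h Vh; have h2 := V2 _ Vh; set q := dotT _ _.
have fp2 : L2 (f \- p) by auto.
have key (s : R) : 0 <= - 2 * s * sqnormc q + s ^+ 2 * sqnormc q * sqnorm h.
  have := dle _ (VD _ _ Vp (VZ (s%:C * q) _ Vh)) => /(le_trans pd).
  have -> : f \- (p \+ cst (s%:C * q) \* h) = (f \- p) \- cst (s%:C * q) \* h.
    by apply: funext => t /=; ring.
  rewrite (sqnormB fp2 (L2Z _ h2)) (sqnormZ _ h2) (dotZr _ h2 fp2).
  rewrite -/q sqnormcM /sqnormc !ReIm /=; lra.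
have q0 := sqnormc_ge0 q; have h0 := sqnorm_ge0 h.
(* This choice gives s * sqnorm h = 1 - s, so [key s] becomes 0 <= - s (1 + s) |q|^2. *)
pose s := (1 + sqnorm h)^-1.
have s0 : 0 < s by rewrite invr_gt0 ltr_pwDl.
have sh : s * (1 + sqnorm h) = 1 by rewrite mulVf // gt_eqF // ltr_pwDl.
apply: sqnormc_le0; have := key s.
  have -> : - 2 * s * sqnormc q + s ^+ 2 * sqnormc q * sqnorm h
     = - s * (sqnormc q * (1 + s)) + s * sqnormc q * (s * (1 + sqnorm h) - 1) by ring.
  rewrite sh subrr mulr0 addr0 mulNr oppr_ge0 pmulr_rle0 // pmulr_lle0 //.
  by rewrite addr_gt0.
Qed.

(** H^2 and K_u are both annihilators of explicit sets [G], and an annihilator is closed by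
    Cauchy-Schwarz. *)
Lemma orthogonal_projection (G : set (Tfun R)) f :
  (forall h, G h -> L2 h) -> L2 f ->
  let V := [set g | L2 g /\ forall h, G h -> dotT g h = 0] in
  exists2 g, V g & forall h, V h -> dotT (f \- g) h = 0.
Proof.
move=> G2 f2 V; apply: closed_projection => //.
- by move=> g [].
- by split=> [|h Gh]; [exact: L2_cst|rewrite dot0l //; exact: G2].
- move=> g h [g2 gG] [h2 hG]; split; first exact: L2D.
  by move=> k Gk; rewrite dotDl ?gG ?hG ?addr0 //; exact: G2.
- move=> c h [h2 hG]; split; first exact: L2Z.
  by move=> k Gk; rewrite dotZl ?hG ?mulr0 //; exact: G2.
- move=> p p2 hp; split => // h Gh; have h2 := G2 _ Gh.
  apply: sqnormc_le0.
  apply/ler_addgt0Pl => e e0; rewrite addr0.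
  have h1 : 0 < 1 + sqnorm h by rewrite ltr_pwDl // sqnorm_ge0.
  have [|g [g2 gG] hg] := hp (e / (1 + sqnorm h)); first by rewrite divr_gt0.
  have -> : dotT p h = - dotT (g \- p) h.
    by rewrite dotBl // gG // sub0r opprK.
  have -> : sqnormc (- dotT (g \- p) h) = sqnormc (dotT (g \- p) h).
    by rewrite /sqnormc !ReIm !sqrrN.
  apply: le_trans (cauchy_schwarz _ h2) _; first exact: L2B.
  apply: (@le_trans _ _ (e / (1 + sqnorm h) * sqnorm h)).
    by rewrite ler_wpM2r ?sqnorm_ge0.
  rewrite mulrAC ler_pdivrMr // ler_wpM2l ?(ltW e0) //.
  by rewrite lerDr.
Qed.

(** Project [f] on the closure [V] of [D]. The residual is orthogonal to [D], hence to [f] by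
    hypothesis, and to the projection itself; so it is orthogonal to itself. *)
Lemma dense_of_total (D : set (Tfun R)) f :
  (forall g, D g -> L2 g) -> D (cst 0) ->
  (forall g h, D g -> D h -> D (g \+ h)) ->
  (forall c h, D h -> D (cst c \* h)) -> L2 f ->
  (forall v, L2 v -> (forall g, D g -> dotT v g = 0) -> dotT v f = 0) ->
  forall e : R, 0 < e -> exists2 g, D g & sqnorm (g \- f) <= e.
Proof.
move=> D2 D0 DD DZ f2 fD.
pose V := [set p | L2 p /\ forall e : R, 0 < e -> exists2 g, D g & sqnorm (g \- p) <= e].
have sub0 g : sqnorm (g \- g) = 0.
  have -> : g \- g = cst 0 \* cst 0 by apply: funext => t /=; rewrite subrr mul0r.
  by rewrite sqnormZ // /sqnormc /= expr0n /= addr0 mul0r.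
have DV g : D g -> V g.
  by move=> Dg; split; [exact: D2|move=> e e0; exists g => //; rewrite sub0 ltW].
have [|||||//|g Vg fg] := @closed_projection V f.
- by move=> g [].
- exact: DV.
- move=> g h [g2 gD] [h2 hD]; split; first exact: L2D.
  move=> e e0; have e4 : 0 < e / 4 by rewrite divr_gt0.
  have [g' Dg' gg'] := gD _ e4; have [h' Dh' hh'] := hD _ e4.
  exists (g' \+ h'); first exact: DD.
  have -> : (g' \+ h') \- (g \+ h) = (g' \- g) \+ (h' \- h).
    by apply: funext => t /=; ring.
  apply: le_trans (sqnormD_le ltr01 _ _) _; try by apply: L2B => //; exact: D2.
  rewrite invr1; lra.
- move=> c h [h2 hD]; split; first exact: L2Z.
  move=> e e0; have c1 : 0 < 1 + sqnormc c by rewrite ltr_pwDl // sqnormc_ge0.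
  have [|h' Dh' hh'] := hD (e / (1 + sqnormc c)); first by rewrite divr_gt0.
  exists (cst c \* h'); first exact: DZ.
  have -> : cst c \* h' \- cst c \* h = cst c \* (h' \- h).
    by apply: funext => t /=; ring.
  rewrite sqnormZ; last by apply: L2B => //; exact: D2.
  apply: (@le_trans _ _ (sqnormc c * (e / (1 + sqnormc c)))).
    by rewrite ler_wpM2l // sqnormc_ge0.
  by rewrite mulrA ler_pdivrMr // mulrC ler_wpM2l ?(ltW e0) // lerDr.
- move=> p p2 pV; split => // e e0; have e4 : 0 < e / 4 by rewrite divr_gt0.
  have [g [g2 gD] gp] := pV _ e4; have [h Dh hg] := gD _ e4; exists h => //.
  have -> : h \- p = (h \- g) \+ (g \- p) by apply: funext => t /=; ring.
  apply: le_trans (sqnormD_le ltr01 _ _) _; try by apply: L2B => //; exact: D2.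
  rewrite invr1; lra.
have [g2 gD] := Vg.
have fg2 : L2 (f \- g) by exact: L2B.
have fgf : dotT (f \- g) f = 0.
  by apply: fD => // h Dh; exact/fg/DV.
have : sqnorm (f \- g) = 0.
  by rewrite sqnormE // dotBr // fgf fg // subrr.
move=> e0 e ep; have e4 : 0 < e / 4 by rewrite divr_gt0.
have [h Dh hg] := gD _ e4; exists h => //.
have -> : h \- f = (h \- g) \+ (g \- f) by apply: funext => t /=; ring.
apply: le_trans (sqnormD_le ltr01 _ _) _; try by apply: L2B => //; exact: D2.
rewrite (sqnorm_subC g f) e0 invr1; lra.
Qed.

End Projection.

(** * Fourier series *)

Section Exponentials.
Variable R : realType.
Implicit Types (f g h : Tfun R) (a b c : R[i]).

Local Notation mu := (@lebesgue_measure R).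
Local Notation Re := (@complex.Re R).
Local Notation Im := (@complex.Im R).

Hint Resolve measurable_arcT : core.

Definition expT (n : int) : Tfun R := fun t => zT t ^ n.

Lemma zT_conj (t : R) : zT t * (zT t)^* = 1.
Proof.
by rewrite -sqnormcE /sqnormc /= cos2Dsin2.
Qed.

Lemma zT_neq0 (t : R) : zT t != 0.
Proof.
apply/eqP => z0; have := zT_conj t; rewrite z0 mul0r => /eqP.
by rewrite eq_sym oner_eq0.
Qed.

Lemma zT_conjV (t : R) : (zT t)^* = (zT t)^-1.
Proof. by rewrite -[RHS]mulr1 -(zT_conj t) mulKf ?zT_neq0. Qed.

Lemma expT0 : expT 0 = cst 1.
Proof. by apply: funext => t; rewrite /expT expr0z. Qed.

Lemma expT1 : expT 1 = @zT R.
Proof. by apply: funext => t; rewrite /expT expr1z. Qed.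

Lemma expTD m n t : expT (m + n) t = expT m t * expT n t.
Proof. by rewrite /expT expfzDr // zT_neq0. Qed.

Lemma conj_expT n t : (expT n t)^* = expT (- n) t.
Proof.
rewrite /expT; have -> : (zT t ^ n)^* = (zT t)^* ^ n.
  by case: n => k; rewrite /exprz ?conjcV rmorphXn.
by rewrite zT_conjV exprz_inv.
Qed.

Lemma conjT_expT n : conjT (expT n) = expT (- n).
Proof. by apply: funext => t; rewrite /conjT conj_expT. Qed.

Lemma expT_conj n t : expT n t * (expT n t)^* = 1.
Proof. by rewrite conj_expT -expTD subrr /expT expr0z. Qed.

Lemma expTE n t : expT n t =
  cos (2 * pi * n%:~R * t) +i* sin (2 * pi * n%:~R * t).
Proof.
have natE (k : nat) : zT t ^+ k = cos (2 * pi * k%:R * t) +i* sin (2 * pi * k%:R * t).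
  elim: k => [|k IH]; first by rewrite expr0 mulr0 mul0r cos0 sin0.
  have -> : 2 * pi * k.+1%:R * t = 2 * pi * t + 2 * pi * k%:R * t :> R.
    by rewrite -[k.+1]add1n natrD; ring.
  rewrite exprS IH cosD sinD; apply: complex_eqP; rewrite !ReIm /=; ring.
case: n => k; first by rewrite /expT -natE.
have -> : expT (Negz k) t = (zT t ^+ k.+1)^*.
  by rewrite NegzE -conj_expT.
rewrite natE NegzE.
have -> : 2 * pi * (- k.+1%:Z)%:~R * t = - (2 * pi * k.+1%:R * t) :> R.
  by rewrite mulrNz !mulrN mulNr.
by rewrite cosN sinN.
Qed.

Lemma measurable_cos_lin (w : R) : measurable_fun (@arcT R) (fun t => cos (w * t)).
Proof.
have mc : measurable_fun setT (@cos R).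
  by apply: continuous_measurable_fun; exact: continuous_cos.
by apply: (measurableT_comp mc); exact: measurable_funM.
Qed.

Lemma measurable_sin_lin (w : R) : measurable_fun (@arcT R) (fun t => sin (w * t)).
Proof.
have mc : measurable_fun setT (@sin R).
  by apply: continuous_measurable_fun; exact: continuous_sin.
by apply: (measurableT_comp mc); exact: measurable_funM.
Qed.

Lemma expT_inf n : Linf (expT n).
Proof.
split.
  split; under eq_fun do rewrite expTE /=.
    exact: measurable_cos_lin.
  exact: measurable_sin_lin.
exists 1; apply: aeTW => t; rewrite -lecR sqnormcE expT_conj; exact: lexx.
Qed.

Lemma expT_L2 n : L2 (expT n).
Proof. exact/Linf_L2/expT_inf. Qed.

Lemma is_derive_mull (w x : R) : is_derive x (1:R) (fun t : R => w * t) w.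
Proof. by apply: is_derive_eq; rewrite /GRing.scale /= mulr1. Qed.

Lemma is_derive_sin_lin (w x : R) :
  is_derive x (1:R) (fun t => sin (w * t)) (w * cos (w * x)).
Proof.
have h1 := is_derive_mull w x.
have := @is_derive1_comp _ (@sin R) (fun t : R => w * t) x _ _ (is_derive_sin (w * x)) h1.
by rewrite mulrC.
Qed.

Lemma is_derive_cos_lin (w x : R) :
  is_derive x (1:R) (fun t => cos (w * t)) (- w * sin (w * x)).
Proof.
have h1 := is_derive_mull w x.
have := @is_derive1_comp _ (@cos R) (fun t : R => w * t) x _ _ (is_derive_cos (w * x)) h1.
set d1 := (X in is_derive _ _ _ X -> _); set d2 := (X in _ -> is_derive _ _ _ X).
by have -> : d1 = d2 by rewrite /d1 /d2; ring.
Qed.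

Lemma Rintegral_derive (F f : R -> R) :
  (forall x : R, is_derive x (1:R) F (f x)) -> continuous f ->
  \int[mu]_(t in @arcT R) f t = F 1 - F 0.
Proof.
move=> Ff cf.
have cF : continuous F.
  by move=> x; apply: differentiable_continuous; apply/derivable1_diffP; exact: ex_derive.
rewrite /Rintegral (@continuous_FTC2 _ f F) //.
- exact: continuous_subspaceT.
- split; first by move=> x _; exact: ex_derive.
    by apply: cvg_at_right_filter; exact: cF.
  by apply: cvg_at_left_filter; exact: cF.
- by move=> x _; rewrite derive1E; exact: derive_val.
Qed.

Lemma expT_at1 n : expT n 1 = 1 :> R[i].
Proof.
rewrite /expT /zT mulr1.
have -> : 2 * pi = pi *+ 2 :> R by rewrite mulr_natl.
by rewrite cos2pi sin2pi exp1rz.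
Qed.

Lemma intT_expT n : n != 0 -> intT (expT n) = 0.
Proof.
move=> n0; pose w : R := 2 * pi * n%:~R.
have w0 : w != 0 by rewrite !mulf_neq0 ?intr_eq0 // gt_eqF // pi_gt0.
have cw (x : R) : {for x, continuous (fun t : R => w * t)}.
  by move=> y; apply: cvgM; [exact: cvg_cst|exact: cvg_id].
have := expT_at1 n; rewrite expTE -/w mulr1 => -[cw1 sw1].
have ic (p : R -> R) : continuous p -> mu.-integrable (@arcT R) (EFin \o p).
  move=> cp; apply: continuous_compact_integrable; first exact: segment_compact.
  exact: continuous_subspaceT.
have cc : continuous (fun t => cos (w * t)).
  by move=> x; apply: (@continuous_comp _ _ _ (fun t => w * t)); [exact: cw|exact: continuous_cos].
have cs : continuous (fun t => sin (w * t)).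
  by move=> x; apply: (@continuous_comp _ _ _ (fun t => w * t)); [exact: cw|exact: continuous_sin].
have scal (p : R -> R) k : k != 0 -> continuous p ->
    \int[mu]_(t in @arcT R) (k * p t) = 0 -> \int[mu]_(t in @arcT R) p t = 0.
  move=> k0 cp /eqP; rewrite RintegralZl //; last exact: ic.
  by rewrite mulf_eq0 (negbTE k0) => /eqP.
have cM (p : R -> R) k : continuous p -> continuous (fun t => k * p t).
  by move=> cp x; apply: cvgM; [exact: cvg_cst|exact: cp].
apply: complex_eqP => /=.
  under eq_Rintegral do rewrite expTE /= -/w.
  apply: (scal _ w) => //.
  rewrite (Rintegral_derive (is_derive_sin_lin w) (cM _ w cc)).
  by rewrite mulr1 mulr0 sw1 sin0 subr0.
under eq_Rintegral do rewrite expTE /= -/w.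
apply: (scal _ (- w)) => //; first by rewrite oppr_eq0.
rewrite (Rintegral_derive (is_derive_cos_lin w) (cM _ (- w) cs)).
by rewrite mulr1 mulr0 cw1 cos0 subrr.
Qed.

Lemma Rintegral_arcT_cst (r : R) : \int[mu]_(t in @arcT R) r = r.
Proof.
rewrite Rintegral_cst // (_ : fine _ = 1) ?mulr1 //.
by rewrite [X in fine X]mu_arcT.
Qed.

Lemma intT_cst c : intT (cst c) = c.
Proof. by apply: complex_eqP; exact: Rintegral_arcT_cst. Qed.

Lemma dot_expT m n : dotT (expT m) (expT n) = (m == n)%:R.
Proof.
rewrite /dotT (_ : _ \* _ = expT (m - n)).
  case: eqVneq => [->|mn]; first by rewrite subrr expT0 intT_cst.
  by rewrite intT_expT ?subr_eq0.
by apply: funext => t /=; rewrite conjT_expT -expTD.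
Qed.

End Exponentials.

(** * A function is determined by its Fourier coefficients *)

Section FourierUniqueness.
Variable R : realType.
Implicit Types (f g h : Tfun R) (a b c : R[i]).

Local Notation mu := (@lebesgue_measure R).
Local Notation Re := (@complex.Re R).
Local Notation Im := (@complex.Im R).

Hint Resolve measurable_arcT : core.

Lemma ae_neq (x : R) : aeT (fun t => t != x).
Proof.
exists [set x]; split; [exact: measurable_set1|exact: lebesgue_measure_set1|].
by move=> t /= h; apply: contrapT => /eqP tx; apply: h.
Qed.

(** Lebesgue differentiation: at almost every point [p] is the derivative of its indefinite
    integral, which vanishes identically near each interior point. *)
Lemma ae_eq0_of_integrals (p : R -> R) :
  mu.-integrable (@arcT R) (EFin \o p) ->
  (forall x, 0 < x < 1 -> \int[mu]_(t in `[0, x]) p t = 0) ->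
  aeT (fun t => p t = 0).
Proof.
move=> ip p0; pose q := p \_ (@arcT R).
have iq y : mu.-integrable [set` Interval (BLeft 0) (BRight y)] (EFin \o q).
  have : mu.-integrable setT (EFin \o q).
    by rewrite /q -restrict_EFin; apply/(integrable_mkcond _ measurable_arcT).
  by apply: integrableS => //; exact: measurable_itv.
have := FTC1 iq (integrable_locally_restrict measurable_arcT ip).
move=> FTC.
have : aeT (fun t => t != 0 -> t != 1 -> p t = 0).
  apply: filterS FTC => x hx xT x0 x1.
  have x01 : 0 < x < 1.
    move: xT; rewrite /arcT /= in_itv /= => /andP[].
    by rewrite !le_eqVlt eq_sym (negbTE x0) (negbTE x1) /= => -> ->.
  have [|_] := hx; first by move/andP: x01 => [].
  have -> : q x = p x by rewrite /q patchE mem_set.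
  move=> <-; rewrite /derive1; apply: lim_near_cst => //.
  have F0 y : 0 < y < 1 -> \int[mu]_(t in `[0, y]) q t = 0.
    move=> y01; apply: (etrans _ (p0 y y01)); apply: eq_Rintegral => t; rewrite inE /= in_itv /=.
    move=> /andP [t0 ty]; rewrite /q patchE mem_set // /arcT /= in_itv /= t0 /=.
    by case/andP: y01 => _ /ltW; exact: le_trans.
  near=> h; rewrite !F0 // ?subrr ?scaler0 //.
  have hx' : `|h| < Num.min x (1 - x).
    near: h; apply: dnbhs0_lt; rewrite lt_min subr_gt0; exact: x01.
  move: hx'; rewrite lt_min ltr_norml => /andP [/andP [h1 _]].
  rewrite ltr_norml => /andP [_ h2]; apply/andP; split; lra.
move=> h.
have h1 : aeT (fun t => t != 0 -> p t = 0).
  by apply: aeTS2 (ae_neq 1) h => t t1 ht t0; exact: ht.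
by apply: aeTS2 (ae_neq 0) h1 => t t0 ht; exact: ht.
Unshelve. all: by end_near. Qed.

Lemma bernoulli_ge (a : R) n : 0 <= 1 + a -> 1 + n%:R * a <= (1 + a) ^+ n.
Proof.
move=> a1; elim: n => [|n IH]; first by rewrite expr0 mul0r addr0.
rewrite exprS; apply: le_trans (ler_wpM2l a1 IH).
have := mulr_ge0 (ler0n R n) (sqr_ge0 a); rewrite -natr1; nra.
Qed.

(* Bernoulli's inequality bounds this by [1 - (k y)^n] from below and by
   [1 / (1 + (k y)^n)] from above. *)
Lemma cvg_threshold (y : R) (k : nat) : 0 <= y <= 1 -> k%:R * y != 1 ->
  (fun n : nat => (1 - y ^+ n) ^+ (k ^ n)%N : R) @ \oo --> ((k%:R * y < 1)%R%:R : R).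
Proof.
move=> /andP [y0 y1] ky.
have yn n : 0 <= y ^+ n <= 1 by rewrite exprn_ge0 //= exprn_ile1.
have ky0 : 0 <= k%:R * y by rewrite mulr_ge0.
case: ltgtP ky => // [lt1|gt1] _ /=.
  apply: (@squeeze_cvgr _ _ _ _ (fun n => 1 - (k%:R * y) ^+ n) (fun=> 1)).
  - apply: nearW => n; have /andP [yn0 yn1] := yn n.
    have := @bernoulli_ge (- y ^+ n) (k ^ n)%N; rewrite subr_ge0 => /(_ yn1).
    rewrite mulrN natrX -exprMn => -> /=.
    by apply: exprn_ile1; [rewrite subr_ge0|rewrite lerBlDr lerDl].
  - rewrite -[X in _ --> X]subr0; apply: cvgB; first exact: cvg_cst.
    by apply: cvg_expr; rewrite ger0_norm.
  - exact: cvg_cst.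
apply: (@squeeze_cvgr _ _ _ _ (fun=> 0) (fun n => ((k%:R * y)^-1) ^+ n)).
- apply: nearW => n; have /andP [yn0 yn1] := yn n.
  rewrite exprn_ge0 ?subr_ge0 //=.
  have := @bernoulli_ge (y ^+ n) (k ^ n)%N; rewrite addr_ge0 // => /(_ isT).
  rewrite natrX -exprMn => h.
  have kyn : 0 < (k%:R * y) ^+ n by rewrite exprn_gt0 // (lt_trans ltr01).
  rewrite exprVn -[leRHS]mul1r ler_pdivlMr //.
  apply: (@le_trans _ _ ((1 - y ^+ n) ^+ (k ^ n)%N * (1 + y ^+ n) ^+ (k ^ n)%N)).
    rewrite ler_wpM2l ?exprn_ge0 ?subr_ge0 //.
    by apply: le_trans h; rewrite lerDr.
  rewrite -exprMn; apply: exprn_ile1; nra.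
- exact: cvg_cst.
- by apply: cvg_expr; rewrite ger0_norm ?invr_ge0 // invf_lt1 // (lt_trans ltr01).
Qed.

(** The functions (1 - y^n)^(k^n) are those of the Brosowski-Deutsch proof of the Stone-Weierstrass
    theorem. They stay in [0, 1], so |p| dominates, and vanishing against polynomials in [y] passes
    to a sublevel set of [y]. *)
Lemma threshold_integral (p y : R -> R) (k : nat) :
  mu.-integrable (@arcT R) (EFin \o p) -> measurable_fun (@arcT R) y ->
  (forall t, 0 <= y t <= 1) -> aeT (fun t => k%:R * y t != 1) ->
  (forall n, \int[mu]_(t in @arcT R) (p t * (1 - y t ^+ n) ^+ (k ^ n)%N) = 0) ->
  \int[mu]_(t in @arcT R) (p t * (k%:R * y t < 1)%R%:R) = 0.
Proof.
move=> ip my y01 yk h.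
have mp : measurable_fun (@arcT R) p by have /measurable_int/measurable_EFinP := ip.
pose F n t := (p t * (1 - y t ^+ n) ^+ (k ^ n)%N)%:E.
have mF n : measurable_fun (@arcT R) (F n).
  apply/measurable_EFinP; apply: measurable_funM => //; apply: measurable_funX.
  by apply: measurable_funB => //; exact: measurable_funX.
have mG : measurable_fun (@arcT R) (fun t => (p t * (k%:R * y t < 1)%R%:R)%:E).
  apply/measurable_EFinP; apply: measurable_funM => //.
  have mb : measurable_fun (@arcT R) (fun t => k%:R * y t < 1).
    by apply: measurable_fun_ltr => //; exact: measurable_funM.
  rewrite (_ : (fun t => (k%:R * y t < 1)%R%:R) =
               (fun t => if k%:R * y t < 1 then 1 else 0 : R)); last first.
    by apply: funext => t; case: ifP.
  by apply: measurable_fun_if => //; exact: measurable_arcT.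
have yn t n : 0 <= y t ^+ n <= 1.
  by case/andP: (y01 t) => ? ?; rewrite exprn_ge0 //= exprn_ile1.
have [//|//|||| _ _] := @dominated_convergence _ _ _ mu (@arcT R) measurable_arcT F
  (fun t => (p t * (k%:R * y t < 1)%R%:R)%:E) (fun t => `|p t|%:E).
- apply: aeTS yk => t ck0; apply: cvg_EFin; first exact: nearW.
  by apply: cvgM; [exact: cvg_cst|exact: cvg_threshold].
- exact: integrable_norm.
- apply: aeW => t n _; rewrite lee_fin normrM ler_piMr //.
  have /andP [h0 h1] := yn t n.
  rewrite ger0_norm ?exprn_ge0 ?subr_ge0 // exprn_ile1 ?subr_ge0 //.
  by rewrite lerBlDr lerDl.
have -> : [sequence (\int[mu]_(t in @arcT R) F n t)%E]_n = cst 0%E.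
  apply: funext => n /=; rewrite /F integral_EFin ?h //.
  apply: (le_I1 _ _ (integrable_norm ip)).
    by apply/measurable_EFinP; exact: mF.
  apply: aeTW => t /=; rewrite normrM ler_piMr //.
  have /andP [h0 h1] := yn t n.
  rewrite ger0_norm ?exprn_ge0 ?subr_ge0 // exprn_ile1 ?subr_ge0 //.
  by rewrite lerBlDr lerDl.
move=> /(cvg_lim (@ereal_hausdorff R)); rewrite lim_cst //.
by rewrite /Rintegral => <-.
Qed.

Lemma eq_Rintegral_ae (p q : R -> R) : measurable_fun (@arcT R) p ->
  measurable_fun (@arcT R) q -> aeT (fun t => p t = q t) ->
  \int[mu]_(t in @arcT R) p t = \int[mu]_(t in @arcT R) q t.
Proof.
move=> mp mq pq; rewrite /Rintegral; congr fine; apply: ae_eq_integral => //.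
- exact/measurable_EFinP.
- exact/measurable_EFinP.
- by apply: aeTS pq => t /= ->.
Qed.

(** The difference of the two cosines is -2 sin(pi t) sin(pi (t - x)), whose sign on ]0, 1[ is that
    of x - t. The cosine on the left peaks at the midpoint of the arc from 0 to [x] and takes the
    same value at both ends. *)
Lemma cos_arc (x t : R) : 0 < x < 1 -> 0 < t < 1 ->
  (cos (2 * pi * t - pi * x) < cos (pi * x)) = (x < t) /\
  (t != x -> cos (2 * pi * t - pi * x) != cos (pi * x)).
Proof.
move=> /andP [x0 x1] /andP [t0 t1]; have pi0 := pi_gt0 R.
have spos (d : R) : 0 < d < 1 -> 0 < sin (pi * d).
  by move=> /andP [d0 d1]; apply: sin_gt0_pi; rewrite mulr_gt0 //= -[ltRHS]mulr1 ltr_pM2l.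
have st : 0 < sin (pi * t) by rewrite spos ?t0.
have e : cos (2 * pi * t - pi * x) = cos (pi * x) - 2 * sin (pi * t) * sin (pi * (t - x)).
  have -> : 2 * pi * t - pi * x = pi * t + pi * (t - x) by ring.
  have -> : cos (pi * x) = cos (pi * t - pi * (t - x)) by congr cos; ring.
  by rewrite cosB cosD; ring.
rewrite e; case: (ltgtP x t) => [xt|tx|->].
- have sd := spos (t - x); rewrite subr_gt0 xt /= in sd.
  have {}sd := sd _; have h : 0 < sin (pi * (t - x)) by apply: sd; lra.
  have hh : 0 < 2 * sin (pi * t) * sin (pi * (t - x)) by rewrite !mulr_gt0.
  by split=> [|_]; [apply/idP|]; rewrite ?lt_eqF //; lra.
- have sd := spos (x - t); rewrite subr_gt0 tx /= in sd.
  have h : 0 < sin (pi * (x - t)) by apply: sd; lra.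
  have -> : pi * (t - x) = - (pi * (x - t)) by ring.
  have hh : 0 < 2 * sin (pi * t) * sin (pi * (x - t)) by rewrite !mulr_gt0.
  rewrite sinN mulrN opprK; split=> [|_]; last by rewrite gt_eqF //; lra.
  by apply/negbTE; rewrite -leNgt; lra.
- by rewrite subrr mulr0 sin0 mulr0 subr0 ltxx eqxx.
Qed.

(** The bounded multipliers [g] for which f g has no Fourier coefficient form a module over the
    trigonometric polynomials. Closure properties of this set spare any explicit expansion of the
    powers of a cosine. *)
Definition annihilator f g :=
  Linf g /\ forall m, intT (f \* g \* expT m) = 0.

Section Annihilator.
Variable f : Tfun R.
Hypothesis f2 : L2 f.
Hypothesis f0 : forall n, fourier f n = 0.

Let ann := annihilator f.

Lemma L1_ann g m : Linf g -> L1 (f \* g \* expT m).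
Proof. by move=> gi; apply: L2M_L1; [exact: L2_infM|exact: expT_L2]. Qed.

Lemma ann1 : ann (cst 1).
Proof.
split; first exact: Linf_cst.
move=> m; rewrite -[RHS](f0 (- m)) /fourier /dotT; congr intT.
by apply: funext => t /=; rewrite mulr1 -[RHS]/(f t * (expT (- m) t)^*) conj_expT opprK.
Qed.

Lemma annD g h : ann g -> ann h -> ann (g \+ h).
Proof.
move=> [gi g0] [hi h0]; split; first exact: LinfD.
move=> m; have -> : f \* (g \+ h) \* expT m = f \* g \* expT m \+ f \* h \* expT m.
  by apply: funext => t /=; ring.
by rewrite intTD ?g0 ?h0 ?addr0 //; exact: L1_ann.
Qed.

Lemma annM k g : ann g -> ann (expT k \* g).
Proof.
move=> [gi g0]; split; first by apply: LinfM => //; exact: expT_inf.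
move=> m; rewrite -[RHS](g0 (k + m)); congr intT.
by apply: funext => t /=; rewrite expTD; ring.
Qed.

Lemma annZ c g : ann g -> ann (cst c \* g).
Proof.
move=> [gi g0]; split; first by apply: LinfM => //; exact: Linf_cst.
move=> m; have -> : f \* (cst c \* g) \* expT m = cst c \* (f \* g \* expT m).
  by apply: funext => t /=; ring.
by rewrite intTZ ?g0 ?mulr0 //; exact: L1_ann.
Qed.

Section Powers.
Variables theta kappa : R.

Let y t := kappa * ((1 + cos (2 * pi * t - theta)) / 2).

Lemma ann_cos g : ann g -> ann ((fun t => (y t)%:C) \* g).
Proof.
(* Here w = kappa e^(i theta) / 4, and y = kappa / 2 + conj(w) z + w conj(z). *)
move=> ag; pose w := (cos theta / 4 * kappa) +i* (sin theta / 4 * kappa).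
have -> : (fun t => (y t)%:C) \* g =
    cst (kappa / 2)%:C \* g \+ (cst w^* \* (expT 1 \* g) \+ cst w \* (expT (- 1) \* g)).
  apply: funext => t /=; rewrite !mulrA -!mulrDl; congr (_ * g t).
  by rewrite -conj_expT expT1 /zT /y cosB; apply: complex_eqP; rewrite !ReIm /=; field.
apply: annD; first exact: annZ.
by apply: annD; apply: annZ; apply: annM.
Qed.

Lemma ann_pow n g : ann g -> ann ((fun t => (y t ^+ n)%:C) \* g).
Proof.
elim: n g => [|n IH] g ag.
  have -> : (fun t => (y t ^+ 0)%:C) \* g = g by apply: funext => t /=; rewrite mul1r.
  by [].
have -> : (fun t => (y t ^+ n.+1)%:C) \* g = (fun t => (y t ^+ n)%:C) \* ((fun t => (y t)%:C) \* g).
  by apply: funext => t /=; rewrite exprSr rmorphM mulrA.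
exact/IH/ann_cos.
Qed.

Lemma ann_1Bpow n m : ann (fun t => ((1 - y t ^+ n) ^+ m)%:C).
Proof.
elim: m => [|m IH].
  have -> : (fun t => ((1 - y t ^+ n) ^+ 0)%:C) = cst 1 by apply: funext.
  exact: ann1.
pose g := (fun t => ((1 - y t ^+ n) ^+ m)%:C).
have -> : (fun t => ((1 - y t ^+ n) ^+ m.+1)%:C) = g \+ cst (-1) \* ((fun t => (y t ^+ n)%:C) \* g).
  by apply: funext => t /=; rewrite exprS rmorphM rmorphB /= rmorph1 /g; ring.
exact/annD/annZ/ann_pow.
Qed.

End Powers.

(** Real multipliers let the real and imaginary parts of [f] be treated separately. *)
Lemma ann_re (q : R -> R) : ann (fun t => (q t)%:C) ->
  \int[mu]_(t in @arcT R) (Re (f t) * q t) = 0 /\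
  \int[mu]_(t in @arcT R) (Im (f t) * q t) = 0.
Proof.
move=> [_ /(_ 0)]; rewrite expT0 => -[hr hi]; split.
  by rewrite -[RHS]hr; apply: eq_Rintegral => t _ /=; rewrite !ReIm /=; ring.
by rewrite -[RHS]hi; apply: eq_Rintegral => t _ /=; rewrite !ReIm /=; ring.
Qed.

Lemma annihilated_eq0 (p : R -> R) :
  mu.-integrable (@arcT R) (EFin \o p) ->
  (forall q : R -> R, ann (fun t => (q t)%:C) -> \int[mu]_(t in @arcT R) (p t * q t) = 0) ->
  aeT (fun t => p t = 0).
Proof.
move=> ip hp; apply: ae_eq0_of_integrals => // x x01; have /andP [x0 x1] := x01.
have pi0 := pi_gt0 R.
(* The value [s] is the level of the raised cosine at the ends of the arc. The threshold of
   [threshold_integral] is 1 / k with [k] an integer, so the cosine is rescaled by [kappa] = 1 / (k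
   s) to take the value 1 / k there; [k] exceeds 1 / s so that [kappa] is at most 1 and [y] stays in
   [0, 1]. *)
pose s := (1 + cos (pi * x)) / 2.
have s0 : 0 < s.
  rewrite divr_gt0 //; have : cos pi < cos (pi * x).
    rewrite ltr_cos ?in_itv /= ?lexx ?pi_ge0 ?mulr_ge0 ?pi_ge0 ?ltW //=; first by rewrite gtr_pMr.
    by rewrite gtr_pMr.
  by rewrite cospi; lra.
pose k := Num.bound s^-1.
have ks : 1 < k%:R * s.
  by rewrite -ltr_pdivrMr // mul1r; apply: archi_boundP; rewrite invr_ge0 ltW.
have k0 : 0 < k%:R :> R by rewrite -(pmulr_lgt0 _ s0) (lt_trans ltr01).
pose kappa := (k%:R * s)^-1.
have ka0 : 0 < kappa by rewrite invr_gt0 (lt_trans ltr01).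
have ka1 : kappa <= 1 by rewrite invf_le1 ?(lt_trans ltr01) // ltW.
pose y t := kappa * ((1 + cos (2 * pi * t - pi * x)) / 2).
have y01 t : 0 <= y t <= 1.
  have c1 := cos_le1 (2 * pi * t - pi * x); have c2 := cos_geN1 (2 * pi * t - pi * x).
  rewrite /y mulr_ge0 ?(ltW ka0) //=; [|by rewrite divr_ge0 ?ler0n //; lra..].
  apply: (@le_trans _ _ (1 * 1)); last by rewrite mulr1.
  by apply: ler_pM; rewrite ?(ltW ka0) //; lra.
have kyE t : k%:R * y t = (1 + cos (2 * pi * t - pi * x)) / (1 + cos (pi * x)).
  have c0 : 1 + cos (pi * x) != 0 by rewrite gt_eqF //; move: s0; rewrite /s; lra.
  by rewrite /y /kappa /s; field; rewrite c0 gt_eqF.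
have cp : 0 < 1 + cos (pi * x) by move: s0; rewrite /s; lra.
have ylt t : (k%:R * y t < 1) = (cos (2 * pi * t - pi * x) < cos (pi * x)).
  by rewrite kyE ltr_pdivrMr // mul1r ltrD2l.
have yne t : (k%:R * y t != 1) = (cos (2 * pi * t - pi * x) != cos (pi * x)).
  rewrite kyE -subr_eq0.
  have -> : (1 + cos (2 * pi * t - pi * x)) / (1 + cos (pi * x)) - 1
     = (cos (2 * pi * t - pi * x) - cos (pi * x)) / (1 + cos (pi * x)).
    by field; rewrite gt_eqF.
  by rewrite mulf_eq0 invr_eq0 subr_eq0 (gt_eqF cp) orbF.
have ae01 : aeT (fun t => t != x /\ 0 < t < 1).
  have h : aeT (fun t : R => t != 0 /\ t != 1).
    by apply: aeTS2 (ae_neq 0) (ae_neq 1) => t.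
  have h2 : aeT (fun t : R => 0 <= t <= 1).
    by apply: aeW => t; rewrite /arcT /= in_itv.
  have h3 : aeT (fun t : R => 0 < t < 1).
    apply: aeTS2 h h2 => t [t0 t1]; rewrite !le_eqVlt eq_sym (negbTE t0) (negbTE t1) /=.
    by [].
  by apply: aeTS2 (ae_neq x) h3 => t.
have my : measurable_fun (@arcT R) y.
  apply: measurable_funM => //; apply: measurable_funM => //.
  apply: measurable_funD => //.
  have mc : measurable_fun setT (@cos R).
    by apply: continuous_measurable_fun; exact: continuous_cos.
  by apply: (measurableT_comp mc); apply: measurable_funB => //.
have := @threshold_integral p y k ip my y01 _ _.
set q := fun t => p t * _ => hq.
have {}hq : \int[mu]_(t in @arcT R) q t = 0.
  apply: hq.
    by apply: aeTS ae01 => t [tx t01]; rewrite yne; exact: (cos_arc x01 t01).2.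
  move=> n; exact/hp/ann_1Bpow.
have hp1 : \int[mu]_(t in @arcT R) p t = 0.
  rewrite -(hp (fun=> 1)); last exact: ann1.
  by apply: eq_Rintegral => t _; rewrite mulr1.
have mp : measurable_fun (@arcT R) p by have /measurable_int/measurable_EFinP := ip.
have mb : measurable_fun (@arcT R) (fun t => k%:R * y t < 1).
  by apply: measurable_fun_ltr => //; exact: measurable_funM.
have mq : measurable_fun (@arcT R) q.
  apply: measurable_funM => //.
  rewrite (_ : (fun t => _) =
               (fun t => if k%:R * y t < 1 then 1 else 0 : R)); last first.
    by apply: funext => t; case: ifP.
  by apply: measurable_fun_if => //; exact: measurable_arcT.
have iq : mu.-integrable (@arcT R) (EFin \o q).
  apply: (le_I1 mq _ (integrable_norm ip)); apply: aeTW => t /=.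
  by rewrite /q normrM ler_piMr //; case: (_ < _); rewrite ?normr1 ?normr0.
have -> : `[0, x]%classic = @arcT R `&` `[0, x].
  apply/seteqP; split => t /=; rewrite /arcT /= !in_itv /=; last by case.
  by move=> /andP [t0 tx]; rewrite t0 tx /= (le_trans tx (ltW x1)).
rewrite Rintegral_mkcondr.
(* Up to a null set [q] is [p] on x < t and 0 elsewhere, and both [p] and [q] have integral 0 on the
   circle. *)
transitivity (\int[mu]_(t in @arcT R) (p t - q t)); last by rewrite RintegralB // hp1 hq subrr.
apply: eq_Rintegral_ae.
- apply/(measurable_restrict _ (measurable_itv _) measurable_arcT).
  by apply: (measurable_funS measurable_arcT _ mp); exact: subIsetl.
- exact: measurable_funB.
- apply: aeTS ae01 => t [tx t01]; rewrite patchE mem_setE /= in_itv /= /q ylt.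
  rewrite (cos_arc x01 t01).1; case/andP: t01 => /ltW -> _ /=.
  by case: ltgtP tx => //= _ _; rewrite ?mulr1 ?mulr0 ?subrr ?subr0.
Qed.

Lemma fourier_eq0 : eqT f (cst 0).
Proof.
have [iR iI] : L1 f.
  have := L1_ann 0 (Linf_cst (1 : R[i])); rewrite expT0.
  have -> : f \* cst 1 \* cst 1 = f by apply: funext => t /=; rewrite !mulr1.
  by [].
have hR := annihilated_eq0 iR (fun q aq => (ann_re aq).1).
have hI := annihilated_eq0 iI (fun q aq => (ann_re aq).2).
by apply: aeTS2 hR hI => t r i; apply: complex_eqP.
Qed.

End Annihilator.

End FourierUniqueness.

(** * Hardy space *)

Section Hardy.
Variable R : realType.
Implicit Types (f g h q : Tfun R) (a c : R[i]).

Lemma zT_inf : Linf (@zT R).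
Proof. by rewrite -expT1; exact: expT_inf. Qed.

Lemma H2_L2 f : H2 f -> L2 f. Proof. by case. Qed.

Lemma fourierE f n : fourier f n = dotT f (expT n). Proof. by []. Qed.

Lemma fourier0E f : fourier f 0 = intT f.
Proof.
rewrite fourierE expT0 /dotT; congr intT; apply: funext => t /=.
by rewrite /conjT /= conjc_1 mulr1.
Qed.

Lemma dot1r f : dotT f (cst 1) = intT f.
Proof. by rewrite -expT0 -fourierE fourier0E. Qed.

Lemma dotM_l f g h : dotT (f \* g) h = dotT g (conjT f \* h).
Proof.
by congr intT; apply: funext => t /=; rewrite /conjT /= conjcM conjcKK; ring.
Qed.

Lemma dotM_r f g h : dotT f (g \* h) = dotT (conjT g \* f) h.
Proof. by congr intT; apply: funext => t /=; rewrite /conjT /= conjcM; ring. Qed.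

Lemma fourier_expTM f m n : fourier (expT m \* f) n = fourier f (n - m).
Proof.
rewrite !fourierE dotM_l; congr dotT; apply: funext => t /=.
by rewrite conjT_expT -expTD addrC.
Qed.

Lemma fourier_conj f n : L2 f -> fourier (conjT f) n = (fourier f (- n))^*.
Proof.
move=> f2; rewrite !fourierE -dotC //; last exact: expT_L2.
by congr intT; apply: funext => t /=; rewrite conjT_expT mulrC.
Qed.

Lemma fourierB f g n : L2 f -> L2 g -> fourier (f \- g) n = fourier f n - fourier g n.
Proof. by move=> *; rewrite !fourierE dotBl //; exact: expT_L2. Qed.

Lemma fourierD f g n : L2 f -> L2 g -> fourier (f \+ g) n = fourier f n + fourier g n.
Proof. by move=> *; rewrite !fourierE dotDl //; exact: expT_L2. Qed.

Lemma fourierZ c f n : L2 f -> fourier (cst c \* f) n = c * fourier f n.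
Proof. by move=> *; rewrite !fourierE dotZl //; exact: expT_L2. Qed.

Lemma fourier_expT m n : fourier (expT m) n = (m == n)%:R :> R[i].
Proof. exact: dot_expT. Qed.

Lemma cst_scale c : cst c = cst c \* (expT 0) :> Tfun R.
Proof. by rewrite expT0; apply: funext => t /=; rewrite mulr1. Qed.

Lemma fourier_cst c n : fourier (cst c) n = c * (n == 0)%:R :> R[i].
Proof. by rewrite cst_scale fourierZ ?fourier_expT 1?eq_sym //; exact: expT_L2. Qed.

Lemma H2D f g : H2 f -> H2 g -> H2 (f \+ g).
Proof.
move=> [f2 fn] [g2 gn]; split; first exact: L2D.
by move=> n n0; rewrite fourierD ?fn ?gn ?addr0.
Qed.

Lemma H2Z c f : H2 f -> H2 (cst c \* f).
Proof.
move=> [f2 fn]; split; first exact: L2Z.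
by move=> n n0; rewrite fourierZ ?fn ?mulr0.
Qed.

Lemma H2B f g : H2 f -> H2 g -> H2 (f \- g).
Proof. by move=> ? ?; rewrite fctBE; exact/H2D/H2Z. Qed.

Lemma H2_expT (n : nat) : H2 (expT n : Tfun R).
Proof.
split; first exact: expT_L2.
by move=> m m0; rewrite fourier_expT; case: eqP => // e; move: m0; rewrite -e.
Qed.

Lemma H2_cst c : H2 (cst c : Tfun R).
Proof. by rewrite cst_scale; exact/H2Z/(H2_expT 0). Qed.

(** Replaces Parseval's identity. Let [p] be the projection of [h] on the space [V] orthogonal to
    all z^n with n >= 0. Negative powers of z lie in [V] and are orthogonal to [h], hence to [p]; so
    [p] has no Fourier coefficient at all, and [h] is orthogonal to [V], which contains [g]. *)
Lemma H2_orth h g : H2 h -> L2 g -> (forall n : nat, fourier g n = 0) ->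
  dotT g h = 0.
Proof.
move=> [h2 hn] g2 gn.
pose G := [set f : Tfun R | exists n : nat, f = expT n].
have [|p [p2 pG] hp] := @orthogonal_projection _ G h _ h2.
  by move=> _ [n ->]; exact: expT_L2.
have p0 : eqT p (cst 0).
  apply: fourier_eq0 => // -[n|n]; first by apply: pG; exists n.
  have := hp (expT (Negz n)) => h0.
  have {}h0 : dotT (h \- p) (expT (Negz n)) = 0.
    apply: h0; split; first exact: expT_L2.
    by move=> _ [m ->]; rewrite dot_expT.
  move: h0; rewrite dotBl //; last exact: expT_L2.
  by rewrite -fourierE hn // sub0r => /eqP; rewrite oppr_eq0 => /eqP.
have hg : dotT h g = 0.
  rewrite -(hp g); last by split=> // _ [m ->]; exact: gn.
  apply: eq_dotT => //; first exact: L2B.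
  by apply: aeTS p0 => t pt /=; rewrite pt subr0.
by rewrite dotC // hg conjc_0.
Qed.

(** For n < 0 the function conj(b) z^n has only negative frequencies, so [H2_orth] makes it
    orthogonal to [h]. *)
Lemma H2_Minf (b : Tfun R) h : Linf b -> H2 b -> H2 h -> H2 (b \* h).
Proof.
move=> bi [b2 bn] hh; have h2 := H2_L2 hh; split; first exact: L2_Minf.
move=> n n0; rewrite fourierE dotM_l dotC ?(@H2_orth h) ?conjc_0 //.
- by apply: L2_Minf; [exact: Linf_conj|exact: expT_L2].
- move=> k; have -> : conjT b \* expT n = expT n \* conjT b.
    by apply: funext => t /=; rewrite mulrC.
  rewrite fourier_expTM fourier_conj // bn ?conjc_0 //.
  by rewrite opprB subr_lt0; apply: lt_le_trans n0 _.
- by apply: L2_Minf; [exact: Linf_conj|exact: expT_L2].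
Qed.

Lemma H2_zT h : H2 h -> H2 (@zT R \* h).
Proof. by move=> hh; apply: H2_Minf => //; [exact: zT_inf|rewrite -expT1; exact: H2_expT]. Qed.

(** On H^2 the mean is evaluation at the origin. Without analytic extension: conj(g) minus its mean
    has only negative frequencies, hence is orthogonal to [f]. *)
Lemma intT_H2M f g : H2 f -> H2 g -> intT (f \* g) = intT f * intT g.
Proof.
move=> hf hg; have f2 := H2_L2 hf; have g2 := H2_L2 hg.
have -> : intT (f \* g) = dotT f (conjT g).
  by congr intT; apply: funext => t /=; rewrite /conjT /= conjcKK.
pose k : Tfun R := conjT g \- cst (intT g)^*.
have gc2 := L2_conj g2.
have c2 := L2_cst (intT g)^*.
have k2 : L2 k by exact: L2B.
have kf : dotT k f = 0.
  apply: H2_orth => // n; rewrite fourierB // fourier_conj // fourier_cst.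
  case: n => [|n]; first by rewrite oppr0 fourier0E mulr1 subrr.
  by rewrite mulr0 subr0 (proj2 hg) // conjc_0.
have -> : conjT g = k \+ cst (intT g)^* \* cst 1.
  by apply: funext => t; rewrite /k /=; ring.
have c1 : L2 (cst 1 : Tfun R) := L2_cst 1.
rewrite (dotDr k2 (L2Z _ c1) f2) (dotZr _ c1 f2) conjcKK (dotC k2 f2) kf.
by rewrite conjc_0 add0r dot1r mulrC.
Qed.

Lemma intT_zT f : H2 f -> intT (@zT R \* f) = 0.
Proof.
move=> hf; rewrite intT_H2M // -?expT1; last exact: H2_expT.
by rewrite intT_expT // mul0r.
Qed.

(** The witness is a polynomial in z, and so bounded; the full analytic part of [g] need not be. *)
Lemma taylor g N : L2 g -> exists q, [/\ H2 q, Linf q,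
  forall k : nat, (k < N)%N -> fourier (g \- q) k = 0 &
  forall k : nat, (N <= k)%N -> fourier q k = 0].
Proof.
move=> g2; elim: N => [|N [q [qH qi q1 q2]]].
  exists (cst 0); split; [exact: H2_cst|exact: Linf_cst|by []|].
  by move=> k _; rewrite fourier_cst mul0r.
have ql := H2_L2 qH.
have el n : L2 (expT n : Tfun R) by exact: expT_L2.
pose r : Tfun R := cst (fourier g N) \* expT N.
have rl : L2 r by exact: L2Z.
have rk (k : nat) : fourier r k = fourier g N * (N == k)%:R.
  by rewrite fourierZ // fourier_expT.
exists (q \+ r); split.
- by apply: H2D => //; exact/H2Z/H2_expT.
- by apply: LinfD => //; apply: LinfM; [exact: Linf_cst|exact: expT_inf].
- move=> k kN; rewrite fourierB //; last exact: L2D.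
  rewrite fourierD // rk; have := q1 k; rewrite fourierB // => qk.
  move: kN; rewrite ltnS leq_eqVlt => /orP [/eqP ->|kN].
    by rewrite eqxx mulr1 q2 // add0r subrr.
  by rewrite (gtn_eqF kN) mulr0 addr0 qk.
- move=> k Nk; rewrite fourierD // rk q2 ?(ltnW Nk) //.
  by rewrite (ltn_eqF Nk) mulr0 addr0.
Qed.

End Hardy.

(** * Model space *)

#[local] Hint Resolve eqT_refl : core.

Ltac hyp :=
  first [ match goal with H : ?P |- ?Q => constr_eq P Q; exact H end | assumption ].

Definition Kb (R : realType) (u f : Tfun R) := Ku u f /\ Linf f.

(* A failing [done] would split these predicates down to measurability goals,
   which is slow; their proofs are either assumptions or explicit. *)
Ltac done ::=
  lazymatch goal with
  | |- Ku _ _ => hyp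
  | |- Kb _ _ => first [hyp | split; hyp]
  | |- H2 _ => hyp
  | |- L2 _ => hyp
  | |- Linf _ => hyp
  | _ => trivial; hnf; intros; solve
      [ do ![solve [trivial | apply: sym_equal; trivial]
            | discriminate | contradiction | split]
      | match goal with H : ~ _ |- _ => solve [case H; trivial] end ]
  end.

Ltac linf := lazymatch goal with
  | |- Linf (_ \- _) => apply: LinfB; linf
  | |- Linf (_ \+ _) => apply: LinfD; linf
  | |- Linf (_ \* _) => apply: LinfM; linf
  | |- Linf (conjT _) => apply: Linf_conj; linf
  | |- Linf (cst _) => exact: Linf_cst
  | |- Linf (expT _) => exact: expT_inf
  | |- Linf (zT (R:=_)) => exact: zT_inf
  | |- Linf _ => hyp
  end.

Ltac l2 := lazymatch goal with
  | |- L2 (_ \- _) => apply: L2B; l2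
  | |- L2 (_ \+ _) => apply: L2D; l2
  | |- L2 (_ \* _) =>
      first [ solve [apply: L2_Minf; [linf|l2]] | solve [apply: L2_infM; [l2|linf]] ]
  | |- L2 (conjT _) => apply: L2_conj; l2
  | |- L2 _ => first [ hyp | apply: H2_L2; hyp | apply: Linf_L2; linf ]
  end.

Ltac pointwise := apply: funext; let t := fresh "t" in move=> t /=;
  rewrite /conjT /= ?conjcE; ring.

Section ModelSpace.
Variable R : realType.
Implicit Types (f g h q : Tfun R) (a c : R[i]).

Lemma eq_dotT_eqT f f' g g' : L2 f -> L2 g -> L2 f' -> L2 g' ->
  eqT f f' -> eqT g g' -> dotT f g = dotT f' g'.
Proof.
by move=> f2 g2 f'2 g'2 e e'; apply: eq_dotT => //; apply: aeTS2 e e' => t -> ->.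
Qed.

Lemma H2_bshift f : H2 f -> H2 (conjT (@zT R) \* (f \- cst (intT f))).
Proof.
move=> hf; have f2 := H2_L2 hf; have c2 := L2_cst (intT f).
have zi := zT_inf R.
split=> [|n n0]; first by l2.
rewrite -expT1 conjT_expT fourier_expTM opprK fourierB // fourier_cst.
have : n + 1 <= 0 by move: n0; case: n => // -[].
rewrite le_eqVlt => /orP [/eqP ->|n1]; first by rewrite fourier0E mulr1 subrr.
by rewrite (proj2 hf) // lt_eqF // mulr0 subr0.
Qed.

Section Inner.
Variable u : Tfun R.
Hypothesis Hu : inner u.

Local Notation Kb := (Kb u).

Let zi := zT_inf R.

Lemma uH2 : H2 u. Proof. by case: Hu. Qed.

Lemma u_conj : aeT (fun t => u t * (u t)^* = 1).
Proof. by case: Hu => _; apply: aeTS => t ut; rewrite -normCK ut expr1n. Qed.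

Lemma u_inf : Linf u.
Proof.
split; first exact/L2_meas/H2_L2/uH2.
by exists 1; apply: aeTS u_conj => t ut; rewrite -lecR sqnormcE ut.
Qed.

Let ui := u_inf.

Lemma Ku_H2 f : Ku u f -> H2 f. Proof. by case. Qed.
Lemma Ku_L2 f : Ku u f -> L2 f. Proof. by move=> /Ku_H2 /H2_L2. Qed.

Lemma dot_u f g : L2 f -> L2 g -> dotT (u \* f) (u \* g) = dotT f g.
Proof.
move=> f2 g2; apply: eq_dotT; try l2.
apply: aeTS u_conj => t ut /=; rewrite conjcM.
by transitivity ((u t * (u t)^*) * (f t * (g t)^*)); [ring|rewrite ut mul1r].
Qed.

Lemma Ku_uH f h : Ku u f -> H2 h -> dotT f (u \* h) = 0.
Proof. by move=> [_ fu]; exact: fu. Qed.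

Lemma u_cst1 : u = u \* cst 1.
Proof. by apply: funext => t /=; rewrite mulr1. Qed.

Lemma Ku_u f : Ku u f -> dotT f u = 0.
Proof. by move=> Kf; rewrite u_cst1 Ku_uH //; exact: H2_cst. Qed.

Lemma u_Ku f : Ku u f -> dotT u f = 0.
Proof. by move=> Kf; rewrite dotC ?Ku_u ?conjc_0 //; [exact: Ku_L2|l2]. Qed.

Lemma uH_Ku f h : Ku u f -> H2 h -> dotT (u \* h) f = 0.
Proof.
move=> Kf hh; have h2 := H2_L2 hh; have f2 := Ku_L2 Kf.
by rewrite dotC ?Ku_uH ?conjc_0 //; l2.
Qed.

Lemma KuD f g : Ku u f -> Ku u g -> Ku u (f \+ g).
Proof.
move=> [fH fu] [gH gu]; split; first exact: H2D.
move=> h hH; have h2 := H2_L2 hH; rewrite dotDl ?fu ?gu ?addr0 //; l2.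
Qed.

Lemma KuZ c f : Ku u f -> Ku u (cst c \* f).
Proof.
move=> [fH fu]; split; first exact: H2Z.
move=> h hH; have h2 := H2_L2 hH; rewrite dotZl ?fu ?mulr0 //; l2.
Qed.

Lemma KuB f g : Ku u f -> Ku u g -> Ku u (f \- g).
Proof. by move=> ? ?; rewrite fctBE; exact/KuD/KuZ. Qed.

Lemma Ku0 : Ku u (cst 0).
Proof.
split=> [|h hH]; first exact: H2_cst.
have h2 := H2_L2 hH; rewrite dot0l //; l2.
Qed.

(** K_u is the annihilator of the negative powers of z together with u H^2. Existence here means
    that the default value in [Pu] is never taken on L^2. *)
Lemma Pu_ex f : L2 f -> exists g, Ku u g /\ forall h, Ku u h -> dotT (f \- g) h = 0.
Proof.
move=> f2.
pose G := [set g : Tfun R | (exists2 n : int, n < 0 & g = expT n) \/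
  (exists2 h, H2 h & g = u \* h)].
have VK g : Ku u g <-> L2 g /\ forall h, G h -> dotT g h = 0.
  split=> [Kg|[g2 gG]].
    split; first exact: Ku_L2.
    by move=> h [[n n0 ->]|[k hk ->]]; [exact: (proj2 (Ku_H2 Kg))|exact: Ku_uH].
  split; first by split=> // n n0; apply: gG; left; exists n.
  by move=> h hH; apply: gG; right; exists h.
have [|g /VK Kg fg] := @orthogonal_projection _ G f _ f2.
  move=> h [[n _ ->]|[k hk ->]]; first exact: expT_L2.
  by have k2 := H2_L2 hk; l2.
by exists g; split=> // h /VK; exact: fg.
Qed.

Lemma Pu_spec f : L2 f -> Ku u (Pu u f) /\
  forall h, Ku u h -> dotT (f \- Pu u f) h = 0.
Proof.
move=> f2; rewrite /Pu; case: xgetP => [g -> //|h].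
by have [g gP] := Pu_ex f2; have := h g; case.
Qed.

Lemma Ku_Pu f : L2 f -> Ku u (Pu u f). Proof. by case/Pu_spec. Qed.

Lemma dot_Pu f h : L2 f -> Ku u h -> dotT (Pu u f) h = dotT f h.
Proof.
move=> f2 Kh; have [KP hP] := Pu_spec f2; have := hP h Kh.
rewrite dotBl //; [|exact: Ku_L2..].
by move=> /eqP; rewrite subr_eq0 => /eqP.
Qed.

Lemma dot_Pu_r f h : L2 f -> Ku u h -> dotT h (Pu u f) = dotT h f.
Proof.
move=> f2 Kh; have KP := Ku_Pu f2.
by rewrite dotC ?dot_Pu -?dotC //; exact: Ku_L2.
Qed.

Lemma Ku_eq_weak f g : Ku u f -> Ku u g ->
  (forall h, Ku u h -> dotT f h = dotT g h) -> eqT f g.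
Proof.
move=> Kf Kg fg; have f2 := Ku_L2 Kf; have g2 := Ku_L2 Kg.
apply: eqT_sqnorm => //; rewrite sqnormE; last exact: L2B.
have K := KuB Kf Kg; rewrite dotBl ?fg ?subrr //; exact: L2B.
Qed.

Lemma Pu_eq f g : L2 f -> Ku u g ->
  (forall h, Ku u h -> dotT f h = dotT g h) -> eqT (Pu u f) g.
Proof.
move=> f2 Kg fg; apply: Ku_eq_weak => //; first exact: Ku_Pu.
by move=> h Kh; rewrite dot_Pu // fg.
Qed.

(** Explicit representatives: the reproducing kernel at the origin, its image under [Cu], the
    adjoint of the compressed shift and the compressed shift. Unlike formulas through [Pu], these
    visibly preserve boundedness. *)
Definition k0 : Tfun R := cst 1 \- cst (intT u)^* \* u.
Definition ck0 : Tfun R := conjT (@zT R) \* (u \- cst (intT u)).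
Definition bshift f : Tfun R := conjT (@zT R) \* (f \- cst (intT f)).
Definition ushift f : Tfun R := @zT R \* f \- cst (dotT f ck0) \* u.

Lemma k0_inf : Linf k0. Proof. by rewrite /k0; linf. Qed.
Lemma ck0_inf : Linf ck0. Proof. by rewrite /ck0; linf. Qed.
Let k0i := k0_inf.
Let kti := ck0_inf.

Lemma intT_conj_dot f : L2 f -> dotT (cst 1) f = (intT f)^*.
Proof. by move=> f2; rewrite dotC ?dot1r //; exact: L2_cst. Qed.

Lemma dot_u_uM h : L2 h -> dotT u (u \* h) = (intT h)^*.
Proof.
move=> h2; rewrite -intT_conj_dot // -(dot_u (L2_cst 1) h2).
by rewrite -u_cst1.
Qed.

Lemma k0H : H2 k0.
Proof. by apply: H2B; [exact: H2_cst|apply: H2Z; exact: uH2]. Qed.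

Lemma Ku_k0 : Ku u k0.
Proof.
split=> [|h hH]; first exact: k0H.
have h2 := H2_L2 hH.
rewrite /k0 dotBl ?dotZl; try l2.
rewrite dot_u_uM //; rewrite intT_conj_dot ?intT_H2M ?conjcM ?subrr //; [exact: uH2|l2].
Qed.

Lemma dot_k0 f : Ku u f -> dotT f k0 = intT f.
Proof.
move=> Kf; have f2 := Ku_L2 Kf.
by rewrite /k0 dotBr ?dotZr ?Ku_u ?mulr0 ?subr0 ?dot1r //; l2.
Qed.

Lemma Ku_ck0 : Ku u ck0.
Proof.
split=> [|h hH]; first exact/H2_bshift/uH2.
have h2 := H2_L2 hH.
have -> : dotT ck0 (u \* h) = dotT (cst 1) (@zT R \* (k0 \* h)).
  apply: eq_dotT; try l2.
  apply: aeTS u_conj => t ut; rewrite /ck0 /k0 /conjT /= !conjcE.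
  transitivity ((zT t)^* * ((u t * (u t)^*) - intT u * (u t)^*) * (h t)^*); first by ring.
  by rewrite ut; ring.
rewrite intT_conj_dot; last by l2.
rewrite intT_zT ?conjc_0 //; apply: H2_Minf => //; exact: k0H.
Qed.

Lemma CuD f g : Cu u (f \+ g) = Cu u f \+ Cu u g.
Proof. by apply: funext => t; rewrite /Cu /conjT /= !conjcE; ring. Qed.

Lemma CuZ c f : Cu u (cst c \* f) = cst c^* \* Cu u f.
Proof. by apply: funext => t; rewrite /Cu /conjT /= !conjcE; ring. Qed.

Lemma Cu_L2 f : L2 f -> L2 (Cu u f).
Proof. by move=> f2; rewrite /Cu; l2. Qed.

Lemma Cu_inf f : Linf f -> Linf (Cu u f).
Proof. by move=> fi; rewrite /Cu; linf. Qed.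

(** [Cu] exchanges the two conditions that define K_u: the coefficient of C f at -(n + 1) is <u z^n,
    f>, and <C f, u h> is the conjugate of int z f h. *)
Lemma Ku_Cu f : Ku u f -> Ku u (Cu u f).
Proof.
move=> Kf; have f2 := Ku_L2 Kf; have fH := Ku_H2 Kf; have C2 := Cu_L2 f2.
split; first split=> //.
  case=> // n _; rewrite fourierE.
  have -> : dotT (Cu u f) (expT (Negz n)) = dotT (u \* expT n) f.
    congr intT; apply: funext => t; rewrite /Cu /= /conjT /= conjcM conj_expT NegzE opprK.
    rewrite -expT1 conj_expT; have -> : n.+1%:Z = n%:Z + 1 by rewrite -addn1 PoszD.
    rewrite expTD.
    transitivity (u t * expT n t * (f t)^* * (expT (-1) t * expT 1 t)); first by ring.
    by rewrite -expTD addNr /expT expr0z mulr1.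
  by rewrite uH_Ku //; exact: H2_expT.
move=> h hH; have h2 := H2_L2 hH.
have -> : dotT (Cu u f) (u \* h) = (intT ((@zT R \* f) \* h))^*.
  rewrite /Cu dot_u; try l2; rewrite -intT_conj; last by apply: L2M_L1; l2.
  by congr intT; apply: funext => t; rewrite /conjT /= !conjcE; ring.
by rewrite intT_H2M ?intT_zT ?mul0r ?conjc_0 //; exact: H2_zT.
Qed.

Lemma dot_Cu f g : L2 f -> L2 g -> dotT (Cu u f) (Cu u g) = dotT g f.
Proof.
move=> f2 g2; rewrite /Cu dot_u; try l2.
congr intT; apply: funext => t; rewrite /conjT /= conjcKK conjcM.
transitivity (g t * (f t)^* * (zT t * (zT t)^*)); first by ring.
by rewrite zT_conj mulr1.
Qed.

Lemma CuK f : eqT (Cu u (Cu u f)) f.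
Proof.
apply: aeTS u_conj => t ut; rewrite /Cu /conjT /= !conjcE.
transitivity ((u t * (u t)^*) * (zT t * (zT t)^*) * f t); first by ring.
by rewrite ut zT_conj !mul1r.
Qed.

Lemma Cu_k0 : eqT (Cu u k0) ck0.
Proof.
apply: aeTS u_conj => t ut; rewrite /Cu /k0 /ck0 /conjT /= !conjcE.
transitivity ((zT t)^* * (u t - intT u * (u t * (u t)^*))); first by ring.
by rewrite ut; ring.
Qed.

Lemma eqT_Cu f g : eqT f g -> eqT (Cu u f) (Cu u g).
Proof. by apply: aeTS => t e; rewrite /Cu /conjT /= e. Qed.

Lemma dot_Cu_l f g : L2 f -> L2 g -> dotT (Cu u f) g = dotT (Cu u g) f.
Proof.
move=> f2 g2; rewrite -[RHS](dot_Cu f2 (Cu_L2 g2)).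
apply: eq_dotT_eqT => //; try by do !apply: Cu_L2.
by apply: eqT_sym; exact: CuK.
Qed.

Lemma dot_ck0 f : Ku u f -> dotT f ck0 = (intT (Cu u f))^*.
Proof.
move=> Kf; have f2 := Ku_L2 Kf; have KC := Ku_Cu Kf.
rewrite -(dot_k0 KC) -dotC; [|exact: Ku_L2|l2].
have C2 := Cu_L2 f2; have k2 : L2 k0 by l2.
rewrite (@eq_dotT_eqT f f ck0 (Cu u k0)) //; try l2.
- rewrite (dotC (Cu_L2 k2) f2) dot_Cu_l // -dotC //; l2.
- exact: Cu_L2.
- by apply: eqT_sym; exact: Cu_k0.
Qed.

(** By multiplicativity of the mean, <z f, u h> is the conjugate of the product of the means of C f
    and h. Since <f, ck0> is the conjugate of the mean of C f, subtracting that multiple of [u] is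
    exactly the right correction. *)
Lemma Ku_shift f : Ku u f -> Ku u (ushift f).
Proof.
move=> Kf; have f2 := Ku_L2 Kf; have fH := Ku_H2 Kf.
split=> [|h hH]; first by apply: H2B; [exact: H2_zT|apply: H2Z; exact: uH2].
have h2 := H2_L2 hH; have KC := Ku_Cu Kf; have C2 := Ku_L2 KC.
rewrite /ushift dotBl ?dotZl; try l2.
rewrite dot_u_uM //.
have -> : dotT (@zT R \* f) (u \* h) = (intT (Cu u f \* h))^*.
  rewrite -intT_conj; last exact: L2M_L1.
  by congr intT; apply: funext => t; rewrite /Cu /conjT /= !conjcE; ring.
by rewrite intT_H2M ?dot_ck0 ?conjcM ?subrr //; exact: Ku_H2.
Qed.

Lemma Ku_bshift f : Ku u f -> Ku u (bshift f).
Proof.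
move=> Kf; have f2 := Ku_L2 Kf; have fH := Ku_H2 Kf.
split=> [|h hH]; first exact: H2_bshift.
have h2 := H2_L2 hH.
have -> : dotT (bshift f) (u \* h) =
    dotT f (u \* (@zT R \* h)) - intT f * dotT (cst 1) (u \* (@zT R \* h)).
  rewrite -dotZl -?dotBl; try l2.
  by congr intT; apply: funext => t; rewrite /bshift /conjT /= !conjcE; ring.
rewrite Ku_uH //; last exact: H2_zT.
rewrite intT_conj_dot; last by l2.
by rewrite intT_H2M ?intT_zT ?mulr0 ?conjc_0 ?mulr0 ?subr0 //; [exact: uH2|exact: H2_zT].
Qed.

Lemma dot_shift f g : Ku u f -> Ku u g -> dotT (ushift f) g = dotT f (bshift g).
Proof.
move=> Kf Kg; have f2 := Ku_L2 Kf; have g2 := Ku_L2 Kg; have fH := Ku_H2 Kf.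
rewrite /ushift dotBl ?dotZl ?u_Ku ?mulr0 ?subr0 //; try l2.
have -> : dotT f (bshift g) = dotT (@zT R \* f) (g \- cst (intT g) \* cst 1).
  by congr intT; apply: funext => t; rewrite /bshift /conjT /= !conjcE; ring.
by rewrite dotBr ?dotZr ?dot1r ?intT_zT ?mulr0 ?subr0 //; l2.
Qed.

Lemma Su_eq f : Ku u f -> eqT (Su u f) (ushift f).
Proof.
move=> Kf; have f2 := Ku_L2 Kf; apply: Pu_eq; first by l2.
  exact: Ku_shift.
move=> h Kh; have h2 := Ku_L2 Kh.
by rewrite /ushift dotBl ?dotZl ?u_Ku ?mulr0 ?subr0 //; l2.
Qed.

Lemma KuooP f : Kuoo u f <-> Kb f.
Proof.
split=> [[Kf [M fM]]|[Kf [mf [M fM]]]].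
  split=> //; split; first exact/L2_meas/Ku_L2.
  exists (M ^+ 2); apply: aeTS fM => t fM; rewrite -lecR sqnormcE -normCK rmorphXn /=.
  by rewrite !expr2 ler_pM.
split=> //; exists (1 + M); apply: aeTS fM => t fM.
have M0 : 0 <= M by apply: le_trans fM; exact: sqnormc_ge0.
rewrite -(@ler_pXn2r _ 2) ?nnegrE ?normr_ge0 ?ler0c ?addr_ge0 //.
rewrite normCK -sqnormcE -rmorphXn lecR; apply: le_trans fM _; nra.
Qed.

Lemma Kb_k0 : Kb k0. Proof. by split; [exact: Ku_k0|]. Qed.
Lemma Kb_ck0 : Kb ck0. Proof. by split; [exact: Ku_ck0|]. Qed.
Lemma Kb_Cu f : Kb f -> Kb (Cu u f).
Proof. by move=> [Kf fi]; split; [exact: Ku_Cu|exact: Cu_inf]. Qed.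
Lemma Kb_shift f : Kb f -> Kb (ushift f).
Proof. by move=> [Kf fi]; split; [exact: Ku_shift|rewrite /ushift; linf]. Qed.
Lemma Kb_bshift f : Kb f -> Kb (bshift f).
Proof. by move=> [Kf fi]; split; [exact: Ku_bshift|rewrite /bshift; linf]. Qed.
Lemma KbD f g : Kb f -> Kb g -> Kb (f \+ g).
Proof. by move=> [Kf fi] [Kg gi]; split; [exact: KuD|linf]. Qed.
Lemma KbZ c f : Kb f -> Kb (cst c \* f).
Proof. by move=> [Kf fi]; split; [exact: KuZ|linf]. Qed.

(** P_u z^n = z^n - u q, where q is the analytic part of conj(u) z^n. That function has no frequency
    above n, so q is a polynomial of degree at most n, which is why [taylor] is called with n + 1
    coefficients. *)
Lemma pz_ex (n : nat) : exists p, exists q, [/\ Kb p, H2 q, Linf q &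
  p = expT n \- u \* q].
Proof.
have g2 : L2 (conjT u \* expT n) by l2.
have [q [qH qi q1 q2]] := taylor n.+1 g2.
have q2' := H2_L2 qH.
exists (expT n \- u \* q), q; split=> //; split; last by linf.
split=> [|h hH].
  by apply: H2B; [exact: H2_expT|apply: H2_Minf => //; exact: uH2].
have h2 := H2_L2 hH.
have -> : dotT (expT n \- u \* q) (u \* h) = dotT (conjT u \* expT n \- q) h.
  apply: eq_dotT; try l2; apply: aeTS u_conj => t ut; rewrite /conjT /= conjcM.
  transitivity ((u t)^* * expT n t * (h t)^* - q t * (h t)^* * (u t * (u t)^*)); first by ring.
  by rewrite ut; ring.
apply: H2_orth => //; first by l2.
move=> k; case: (ltnP k n.+1) => kn; first exact: q1.
rewrite fourierB // q2 // subr0.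
have -> : conjT u \* expT n = expT n \* conjT u by apply: funext => t /=; rewrite mulrC.
rewrite fourier_expTM fourier_conj ?(proj2 uH2) ?conjc_0 //; last by l2.
by rewrite opprB subr_lt0 ltz_nat.
Qed.

(* A bounded representative of the projection of [z^n] on the model space. *)
Definition pz n := projT1 (cid (pz_ex n)).

Lemma pzP n : exists q, [/\ Kb (pz n), H2 q, Linf q & pz n = expT n \- u \* q].
Proof. by rewrite /pz; case: cid. Qed.

Lemma Kb_pz n : Kb (pz n).
Proof. by have [q []] := pzP n. Qed.

Lemma dot_pz f n : Ku u f -> dotT f (pz n) = fourier f n.
Proof.
move=> Kf; have [q [_ qH qi ->]] := pzP n; have f2 := Ku_L2 Kf.
by rewrite dotBr ?Ku_uH ?subr0 //; l2.
Qed.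

Lemma Ku_total f : Ku u f -> (forall n, dotT f (pz n) = 0) -> eqT f (cst 0).
Proof.
move=> Kf fp; apply: fourier_eq0; first exact: Ku_L2.
by case=> n; [rewrite -dot_pz|apply: (proj2 (Ku_H2 Kf))].
Qed.

Lemma Ku_eq_weak_b f g : Ku u f -> Ku u g ->
  (forall h, Kb h -> dotT f h = dotT g h) -> eqT f g.
Proof.
move=> Kf Kg fg; have f2 := Ku_L2 Kf; have g2 := Ku_L2 Kg.
have : eqT (f \- g) (cst 0).
  apply: Ku_total; first exact: KuB.
  move=> n; have [Kp pi] := Kb_pz n; rewrite dotBl ?fg ?subrr //; l2.
by apply: aeTS => t /= /eqP; rewrite subr_eq0 => /eqP.
Qed.

Lemma pz0 : eqT (pz 0) k0.
Proof.
apply: Ku_eq_weak; [by case: (Kb_pz 0)|exact: Ku_k0|move=> h Kh].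
have [Kp pi] := Kb_pz 0; have h2 := Ku_L2 Kh.
have p2 := Ku_L2 Kp; have k2 : L2 k0 by l2.
by rewrite (dotC h2 p2) (dotC h2 k2) dot_pz // fourier0E dot_k0.
Qed.

(** The n-th coefficient of the backward shift of [h] is the coefficient of [h] at n + 1. With [pz0]
    this identifies P_u z^n with the n-th iterate of the compressed shift on [k0]. *)
Lemma pzS n : eqT (pz n.+1) (ushift (pz n)).
Proof.
have [Kp pi] := Kb_pz n; have [Kp' pi'] := Kb_pz n.+1.
apply: Ku_eq_weak => //; [exact: Ku_shift|move=> h Kh].
have h2 := Ku_L2 Kh; have p2 := Ku_L2 Kp; have p2' := Ku_L2 Kp'.
have Kb' := Ku_bshift Kh; have b2 := Ku_L2 Kb'.
rewrite dot_shift // (dotC h2 p2') (dotC b2 p2) !dot_pz //.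
congr (_^*); rewrite /bshift -expT1 conjT_expT fourier_expTM opprK -addn1 PoszD.
rewrite fourierB //; last exact: L2_cst.
by rewrite fourier_cst -PoszD addn1 mulr0 subr0.
Qed.

Lemma Kb_dense f : Ku u f -> forall e : R, 0 < e -> exists2 g, Kb g & sqnorm (g \- f) <= e.
Proof.
move=> Kf; have f2 := Ku_L2 Kf.
apply: (@dense_of_total _ Kb f _ _ KbD KbZ f2).
- by move=> g [Kg _]; exact: Ku_L2.
- by split; [exact: Ku0|linf].
move=> v v2 vD; have [KP hP] := Pu_spec v2; have P2 := Ku_L2 KP.
have -> : dotT v f = dotT (Pu u v) f by rewrite dot_Pu.
have P0 : eqT (Pu u v) (cst 0).
  by apply: Ku_total => // n; rewrite dot_Pu ?vD //; case: (Kb_pz n).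
rewrite (@eq_dotT_eqT _ (cst 0) _ f) ?dot0l //; l2.
Qed.

End Inner.
End ModelSpace.

(** * Bounded operators and their symbols *)

Section Operators.
Variable R : realType.
Implicit Types (f g h q Phi : Tfun R) (a c : R[i]).
Implicit Types (A B : Tfun R -> Tfun R).

Variable u : Tfun R.
Hypothesis Hu : inner u.

Let zi := zT_inf R.
Let ui := u_inf Hu.
Local Notation k0 := (k0 u).
Local Notation ck0 := (ck0 u).
Local Notation bshift := (@bshift R).
Local Notation ushift := (ushift u).
Local Notation Kb := (Kb u).
Local Notation C := (Cu u).
Let k0i : Linf k0 := k0_inf Hu.
Let kti : Linf ck0 := ck0_inf Hu.

Section BoundedOperator.
Variable A : Tfun R -> Tfun R.
Hypothesis HA : bounded_op u A.

Lemma op_Ku f : Ku u f -> Ku u (A f). Proof. by case: HA => + _ _; apply. Qed.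

Lemma op_L2 f : Ku u f -> L2 (A f). Proof. by move=> /op_Ku /Ku_L2. Qed.

Lemma op_lin c f g : Ku u f -> Ku u g ->
  eqT (A (cst c \* f \+ g)) (cst c \* A f \+ A g).
Proof. by case: HA => _ + _; apply. Qed.

Lemma op_bound : exists2 K : R, 0 <= K & forall f, Ku u f -> sqnorm (A f) <= K * sqnorm f.
Proof.
case: HA => _ _ [M hM]; exists (M ^+ 2); first exact: sqr_ge0.
move=> f Kf; rewrite -!normT_sq -exprMn ler_sqr ?nnegrE ?sqrtr_ge0 ?hM //.
by apply: le_trans (hM f Kf); exact: sqrtr_ge0.
Qed.

Lemma op_sub f g : Ku u f -> Ku u g -> eqT (A (f \- g)) (A f \- A g).
Proof.
move=> Kf Kg; have -> : f \- g = cst (-1) \* g \+ f.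
  by apply: funext => t /=; ring.
apply: eqT_trans (op_lin _ Kg Kf) _; apply: aeTW => t /=; ring.
Qed.

Lemma op_eq f g : Ku u f -> Ku u g -> eqT f g -> eqT (A f) (A g).
Proof.
move=> Kf Kg fg; have f2 := Ku_L2 Kf; have g2 := Ku_L2 Kg.
have [K K0 hK] := op_bound.
have KB := KuB Hu Kf Kg.
have s0 : sqnorm (A (f \- g)) = 0.
  apply/eqP; rewrite eq_le sqnorm_ge0 andbT; apply: le_trans (hK _ KB) _.
  have -> : sqnorm (f \- g) = sqnorm (cst 0 \* f).
    apply: sqnorm_eqT; [l2|l2|]; apply: aeTS fg => t /= ->.
    by rewrite subrr mul0r.
  by rewrite sqnormZ // /sqnormc /= expr0n /= addr0 mul0r mulr0.
have := sqnorm_eq0 (op_L2 KB) s0.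
move=> e; have := eqT_trans (eqT_sym (op_sub Kf Kg)) e.
by apply: aeTS => t /= /eqP; rewrite subr_eq0 => /eqP.
Qed.

Lemma op_linE c f g h : Ku u f -> Ku u g -> L2 h ->
  dotT (A (cst c \* f \+ g)) h = c * dotT (A f) h + dotT (A g) h.
Proof.
move=> Kf Kg h2; have A1 := op_L2 Kf; have A2 := op_L2 Kg.
have K1 := KuD Hu (KuZ Hu c Kf) Kg.
rewrite -dotZl // -dotDl //; last exact: L2Z.
by apply: eq_dotT_eqT => //; [exact: op_L2|l2|exact: op_lin].
Qed.

Lemma op_subE f g h : Ku u f -> Ku u g -> L2 h ->
  dotT (A (f \- g)) h = dotT (A f) h - dotT (A g) h.
Proof.
move=> Kf Kg h2; have A1 := op_L2 Kf; have A2 := op_L2 Kg.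
have K1 := KuB Hu Kf Kg.
rewrite -dotBl //; apply: eq_dotT_eqT => //; [exact: op_L2|l2|exact: op_sub].
Qed.

End BoundedOperator.

Lemma bounded_op_comp A B : bounded_op u A -> bounded_op u B ->
  bounded_op u (fun f => A (B f)).
Proof.
move=> HA HB; split.
- by move=> f Kf; exact: (op_Ku HA (op_Ku HB Kf)).
- move=> c f g Kf Kg; apply: eqT_trans (op_lin HA c (op_Ku HB Kf) (op_Ku HB Kg)).
  have K1 := KuD Hu (KuZ Hu c Kf) Kg.
  apply: (op_eq HA); [exact: (op_Ku HB)| |exact: op_lin].
  by apply: KuD => //; [apply: KuZ => //|]; exact: (op_Ku HB).
- case: (HA) => _ _ [M hM]; case: (HB) => _ _ [N hN]; exists (`|M| * `|N|) => f Kf.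
  apply: le_trans (hM _ (op_Ku HB Kf)) _.
  apply: (@le_trans _ _ (`|M| * normT (B f))).
    by rewrite ler_wpM2r ?sqrtr_ge0 // ler_norm.
  rewrite -mulrA ler_wpM2l //; apply: le_trans (hN _ Kf) _.
  by rewrite ler_wpM2r ?sqrtr_ge0 // ler_norm.
Qed.

Definition conj_op A f := C (A (C f)).

Lemma sqnorm_Cu f : L2 f -> sqnorm (C f) = sqnorm f.
Proof. by move=> f2; rewrite !sqnormE ?(dot_Cu Hu) //; exact: Cu_L2. Qed.

Lemma bounded_op_conj A : bounded_op u A -> bounded_op u (conj_op A).
Proof.
move=> HA; split.
- by move=> f Kf; apply: Ku_Cu => //; apply: (op_Ku HA); exact: Ku_Cu.
- move=> c f g Kf Kg; rewrite /conj_op CuD CuZ.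
  have KCf := Ku_Cu Hu Kf; have KCg := Ku_Cu Hu Kg.
  apply: eqT_trans (eqT_Cu u (op_lin HA _ KCf KCg)) _.
  by rewrite CuD CuZ conjcKK.
- case: (HA) => _ _ [M hM]; exists M => f Kf; have KCf := Ku_Cu Hu Kf.
  have nE g : L2 g -> normT (C g) = normT g.
    by move=> g2; congr Num.sqrt; exact: sqnorm_Cu.
  rewrite /conj_op nE; last exact: (op_L2 HA).
  by rewrite -(nE f (Ku_L2 Kf)); exact: hM.
Qed.

Lemma Kb_total x f : L2 x -> (forall g, Kb g -> dotT x g = 0) -> Ku u f -> dotT x f = 0.
Proof.
move=> x2 xg Kf; rewrite -(dot_Pu Hu x2 Kf).
have KP := Ku_Pu Hu x2; have P2 := Ku_L2 KP; have f2 := Ku_L2 Kf.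
have P0 : eqT (Pu u x) (cst 0).
  apply: (@Ku_total _ _ Hu) => // n; have Kp := Kb_pz Hu n.
  by rewrite (dot_Pu Hu) ?xg //; case: Kp.
by rewrite (@eq_dotT_eqT _ _ (cst 0) _ f) ?dot0l //; l2.
Qed.

Lemma Kb_total_eq x y f : L2 x -> L2 y ->
  (forall g, Kb g -> dotT x g = dotT y g) -> Ku u f -> dotT x f = dotT y f.
Proof.
move=> x2 y2 xy Kf; have f2 := Ku_L2 Kf.
apply/eqP; rewrite -subr_eq0 -dotBl //.
apply/eqP; apply: Kb_total => //; first exact: L2B.
move=> g Kg; have [Kg' _] := Kg; have g2 := Ku_L2 Kg'.
by rewrite dotBl ?xy ?subrr.
Qed.

Lemma Kb_total_eqr x y f : L2 x -> L2 y ->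
  (forall g, Kb g -> dotT g x = dotT g y) -> Ku u f -> dotT f x = dotT f y.
Proof.
move=> x2 y2 xy Kf; have f2 := Ku_L2 Kf.
rewrite (dotC x2 f2) (dotC y2 f2); congr (_^*); apply: Kb_total_eq => // g Kg'; have [Kg gi] := Kg'.
have g2 := Ku_L2 Kg; by rewrite (dotC g2 x2) (dotC g2 y2) xy.
Qed.

(** Testing against bounded elements of K_u eliminates [Pu]; [symbolP] shows that the notion is the
    same for bounded operators. *)
Definition wsym Phi A := forall f g, Kb f -> Kb g -> dotT (A f) g = dotT (Phi \* f) g.

Lemma symbolP Phi A : bounded_op u A -> symbol u Phi A <-> L2 Phi /\ wsym Phi A.
Proof.
move=> HA; split=> [[P2 hP]|[P2 hP]]; split=> //.
  move=> f g Kf Kg; have [Kf' fi] := Kf; have [Kg' gi] := Kg.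
  have e := hP f (proj2 (KuooP u f) Kf).
  have Pf2 : L2 (Phi \* f) by l2.
  rewrite -(dot_Pu Hu Pf2 Kg'); apply: eq_dotT_eqT => //.
  - exact: (op_L2 HA).
  - by l2.
  - by apply: Ku_L2; exact: Ku_Pu.
  - by l2.
move=> f /KuooP Kf; have [Kf' fi] := Kf.
have Pf2 : L2 (Phi \* f) by l2.
apply: (Ku_eq_weak_b Hu); [exact: (op_Ku HA)|exact: Ku_Pu|move=> h Kh].
by rewrite hP // (dot_Pu Hu) //; case: Kh.
Qed.

Lemma dot_swap Phi f g : L2 Phi -> Linf f -> L2 g ->
  dotT (Phi \* f) g = dotT f (conjT Phi \* g).
Proof. by move=> *; rewrite dotM_l; rewrite dotM_r; congr intT; pointwise. Qed.

Lemma Cu_mul_dot Phi f g : L2 Phi -> Linf f -> Linf g ->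
  dotT (Phi \* C f) (C g) = dotT (Phi \* g) f.
Proof.
move=> P2 fi gi; have Cf := Cu_inf Hu fi; have Cg := Cu_inf Hu gi.
apply: eq_dotT; try l2.
apply: aeTS (u_conj Hu) => t ut; rewrite /Cu /conjT /= !conjcE.
transitivity (Phi t * g t * (f t)^* * (u t * (u t)^*) * (zT t * (zT t)^*)); first by ring.
by rewrite ut zT_conj !mulr1.
Qed.

(** By [Cu_mul_dot], applying [Cu] to both arguments of the form swaps them; taking conjugates then
    conjugates the symbol. *)
Lemma conj_op_wsym Phi A : bounded_op u A -> L2 Phi -> wsym Phi A ->
  wsym (conjT Phi) (conj_op A).
Proof.
move=> HA P2 wA f g [Kf fi] [Kg gi].
have Kbf : Kb (C f) by exact: Kb_Cu.
have Kbg : Kb (C g) by exact: Kb_Cu.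
have f2 := Ku_L2 Kf; have g2 := Ku_L2 Kg.
have AC2 : L2 (A (C f)) by apply: (op_L2 HA); case: Kbf.
rewrite /conj_op (dot_Cu_l Hu) // dotC //; last exact: Cu_L2.
rewrite wA // Cu_mul_dot // -dotC //; last by l2.
by congr intT; pointwise.
Qed.

Lemma functional_density (l : Tfun R -> R[i]) (K : R) :
  (forall f g, Ku u f -> Ku u g -> l (f \- g) = l f - l g) ->
  (forall f, Ku u f -> sqnormc (l f) <= K * sqnorm f) ->
  (forall f, Kb f -> l f = 0) -> forall f, Ku u f -> l f = 0.
Proof.
move=> lB lK l0 f Kf; apply: sqnormc_le0; apply/ler_addgt0Pl => e e0; rewrite addr0.
have K1 : 0 < 1 + `|K| by rewrite ltr_pwDl.
have [|g Kg hg] := Kb_dense Hu Kf (e := e / (1 + `|K|)); first by rewrite divr_gt0.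
have [Kg' gi] := Kg.
have -> : l f = l (f \- g) by rewrite lB // (l0 g Kg) subr0.
apply: le_trans (lK _ (KuB Hu Kf Kg')) _.
apply: (@le_trans _ _ ((1 + `|K|) * sqnorm (g \- f))).
  rewrite sqnorm_subC ler_wpM2r ?sqnorm_ge0 //.
  by apply: le_trans (ler_norm K) _; rewrite lerDr.
by rewrite mulrC -ler_pdivlMr.
Qed.

Lemma adjoint_density A k y : bounded_op u A -> L2 k -> L2 y ->
  (forall h, Kb h -> dotT (A h) k = dotT h y) ->
  forall h, Ku u h -> dotT (A h) k = dotT h y.
Proof.
move=> HA k2 y2 key h Kh.
apply/eqP; rewrite -subr_eq0; apply/eqP.
have [K K0 hK] := op_bound HA.
pose l h := dotT (A h) k - dotT h y.
apply: (@functional_density l (2 * (K * sqnorm k + sqnorm y))) => //.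
- move=> f g Kf Kg; have f2 := Ku_L2 Kf; have g2 := Ku_L2 Kg.
  by rewrite /l (op_subE HA) // dotBl //; ring.
- move=> f Kf; have f2 := Ku_L2 Kf; rewrite /l.
  apply: (@le_trans _ _ (2 * (sqnormc (dotT (A f) k) + sqnormc (dotT f y)))).
    move: (dotT _ _) (dotT _ _) => a c; rewrite /sqnormc !ReIm.
    have := sqr_ge0 (complex.Re a + complex.Re c).
    have := sqr_ge0 (complex.Im a + complex.Im c).
    by lra.
  have c1 := cauchy_schwarz (op_L2 HA Kf) k2; have c2 := cauchy_schwarz f2 y2.
  have c3 := ler_wpM2r (sqnorm_ge0 k) (hK _ Kf).
  have {c1 c3} := le_trans c1 c3; move: c2.
  move: (sqnormc _) (sqnormc _) (sqnorm f) (sqnorm y) (sqnorm k) => a b c d e.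
  by lra.
- by move=> f Kf; rewrite /l key // subrr.
Qed.

Section Symbol.
Variables (Phi : Tfun R) (A : Tfun R -> Tfun R).
Hypothesis HA : bounded_op u A.
Hypothesis P2 : L2 Phi.
Hypothesis wA : wsym Phi A.

Let HAc := bounded_op_conj HA.
Let wAc := conj_op_wsym HA P2 wA.

(** Truncated Toeplitz operators are complex symmetric. For bounded arguments both sides are the
    integral form. [adjoint_density] frees only the argument of the operator, so it is used twice:
    on C A C in [key2], then on [A]. *)
Lemma adjoint f g : Ku u f -> Ku u g -> dotT (A f) g = dotT f (conj_op A g).
Proof.
have key h k : Kb h -> Kb k -> dotT (A h) k = dotT h (conj_op A k).
  move=> Kh Kk; have [Kh' hi] := Kh; have [Kk' ki] := Kk.
  have h2 := Ku_L2 Kh'; have k2 := Ku_L2 Kk'.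
  rewrite wA // (dotC (op_L2 HAc Kk') h2) wAc // -dotC //; last by l2.
  by congr intT; pointwise.
have key2 h k : Kb h -> Ku u k -> dotT (conj_op A k) h = dotT k (A h).
  move=> Kh; have [Kh' hi] := Kh; have h2 := Ku_L2 Kh'; have A2 := op_L2 HA Kh'.
  move: k; apply: adjoint_density => // k Kk; have [Kk' ki] := Kk.
  have k2 := Ku_L2 Kk'; have Ac2 := op_L2 HAc Kk'.
  by rewrite (dotC h2 Ac2) (dotC A2 k2) key.
move=> Kf Kg; have g2 := Ku_L2 Kg; have Ac2 := op_L2 HAc Kg.
move: f Kf; apply: adjoint_density => // h Kh; have [Kh' hi] := Kh.
have h2 := Ku_L2 Kh'; have A2 := op_L2 HA Kh'.
by rewrite (dotC g2 A2) (dotC Ac2 h2) key2.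
Qed.

Lemma wsym_r f g : Kb f -> Ku u g -> dotT (A f) g = dotT (Phi \* f) g.
Proof.
move=> Kf Kg; have [Kf' fi] := Kf; apply: Kb_total_eq => //.
- exact: (op_L2 HA).
- by l2.
- by move=> h Kh; exact: wA.
Qed.

(** With [f] unbounded, Phi f may leave L^2, so the symbol must sit on the bounded side. *)
Lemma wsym_l f g : Ku u f -> Kb g -> dotT (A f) g = dotT f (conjT Phi \* g).
Proof.
move=> Kf Kg; have [Kg' gi] := Kg; have Ac2 := op_L2 HAc Kg'.
rewrite adjoint //; apply: Kb_total_eqr => //; first by l2.
move=> h Kh; have [Kh' hi] := Kh; have h2 := Ku_L2 Kh'; have g2 := Ku_L2 Kg'.
by rewrite -adjoint // wA // dot_swap.
Qed.

End Symbol.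

Lemma conj_opK A f : bounded_op u A -> Ku u f -> eqT (conj_op (conj_op A) f) (A f).
Proof.
move=> HA Kf; rewrite /conj_op.
apply: eqT_trans (CuK Hu _) _; apply: op_eq => //; last exact: CuK.
by do !apply: Ku_Cu.
Qed.

Lemma conj_op_comp A B f : bounded_op u A -> bounded_op u B -> Ku u f ->
  eqT (conj_op A (conj_op B f)) (conj_op (fun h => A (B h)) f).
Proof.
move=> HA HB Kf; apply: eqT_Cu; have KC := Ku_Cu Hu Kf.
apply: (op_eq HA); last exact: CuK.
- by do !apply: Ku_Cu => //; exact: (op_Ku HB).
- exact: (op_Ku HB).
Qed.

End Operators.

Definition Lf (R : realType) (Phi f : Tfun R) := dotT (@zT R \* f) (conjT Phi).

Definition Jf (R : realType) (u Phi f : Tfun R) :=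
  dotT (@zT R \* f) (conjT Phi \* u).

(* [ring] with the scalar products abstracted first, so that it does not try
   to compare them up to conversion. *)
Ltac dring :=
  repeat match goal with
  | |- context [dotT ?f ?g] => generalize (dotT f g)
  | |- context [Lf ?f ?g] => generalize (Lf f g)
  | |- context [Jf ?u ?f ?g] => generalize (Jf u f g)
  | |- context [intT ?f] => generalize (intT f)
  end; intros; ring.

(** * Commutators with the compressed shift *)

Section Types.
Variable R : realType.
Implicit Types (f g h q Phi : Tfun R) (a c : R[i]).
Implicit Types (A B : Tfun R -> Tfun R).

Variable u : Tfun R.
Hypothesis Hu : inner u.

Let zi := zT_inf R.
Let ui := u_inf Hu.
Local Notation Jf := (Jf u).
Local Notation k0 := (k0 u).
Local Notation ck0 := (ck0 u).
Local Notation bshift := (@bshift R).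
Local Notation ushift := (ushift u).
Local Notation Kb := (Kb u).
Local Notation C := (Cu u).
Local Notation Pu := (Pu u).
Local Notation u0 := (intT u).
Local Notation wsym := (wsym u).
Local Notation conj_op := (conj_op u).
Let k0i : Linf k0 := k0_inf Hu.
Let kti : Linf ck0 := ck0_inf Hu.

Section Forms.
Variable Phi : Tfun R.
Hypothesis P2 : L2 Phi.

Lemma Lf_dot f : Lf Phi f = dotT f (conjT (@zT R) \* conjT Phi).
Proof. by congr intT; pointwise. Qed.

Lemma Jf_dot f : Jf Phi f = dotT f (conjT (@zT R) \* (conjT Phi \* u)).
Proof. by congr intT; pointwise. Qed.

Lemma eqT_Lf f g : L2 f -> L2 g -> eqT f g -> Lf Phi f = Lf Phi g.
Proof. by move=> *; rewrite !Lf_dot; apply: eq_dotT_eqT => //; l2. Qed.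

Lemma eqT_Jf f g : L2 f -> L2 g -> eqT f g -> Jf Phi f = Jf Phi g.
Proof. by move=> *; rewrite !Jf_dot; apply: eq_dotT_eqT => //; l2. Qed.

(** The two main terms int Phi z f conj(g) cancel. The rest comes from the multiple of [u] in S f
    and the mean removed in S^* g; the former produces L(C g) because u conj(g) = z C g. *)
Lemma commutator_form f g : Kb f -> Kb g ->
  dotT (Phi \* ushift f) g - dotT (Phi \* f) (bshift g) =
  dotT k0 g * Lf Phi f - dotT f ck0 * Lf Phi (C g).
Proof.
move=> [Kf fi] [Kg gi]; have f2 := Ku_L2 Kf; have g2 := Ku_L2 Kg.
have -> : dotT k0 g = (intT g)^*.
  by rewrite dotC ?(dot_k0 Hu) //; l2.
have Cg2 := Cu_L2 Hu g2.
have -> : dotT (Phi \* ushift f) g =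
    dotT (@zT R \* f \* Phi) g - dotT f ck0 * dotT (Phi \* u) g.
  rewrite -dotZl -?dotBl; try l2.
  by congr intT; rewrite /ushift; pointwise.
have -> : dotT (Phi \* u) g = Lf Phi (C g).
  rewrite /Lf; congr intT; apply: funext => t; rewrite /Cu /conjT /= !conjcE.
  transitivity (Phi t * u t * (g t)^* * (zT t * (zT t)^*)); last by ring.
  by rewrite zT_conj mulr1.
have -> : dotT (Phi \* f) (bshift g) =
    dotT (@zT R \* f \* Phi) g - (intT g)^* * Lf Phi f.
  have -> : Lf Phi f = dotT (@zT R \* f \* Phi) (cst 1).
    by rewrite /Lf; congr intT; pointwise.
  rewrite -dotZr -?dotBr; try l2.
  by congr intT; rewrite /bshift; pointwise.
by ring.
Qed.

Lemma ck0_form f : L2 f -> dotT f (conjT Phi \* ck0) = Jf Phi f - u0^* * Lf Phi f.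
Proof.
move=> f2; rewrite Jf_dot Lf_dot -dotZr -?dotBr; try l2.
by congr intT; rewrite /ck0; pointwise.
Qed.

(** This is [ck0_form] at C g, since k0 conj(g) = (C g) conj(ck0) almost everywhere. *)
Lemma k0_form g : Ku u g ->
  dotT (Phi \* k0) g = Jf Phi (C g) - u0^* * Lf Phi (C g).
Proof.
move=> Kg; have g2 := Ku_L2 Kg; have Cg2 := Cu_L2 Hu g2.
rewrite -ck0_form //; apply: eq_dotT; try l2.
apply: aeTS (u_conj Hu) => t ut; rewrite /k0 /ck0 /Cu /conjT /= !conjcE.
transitivity (Phi t * (g t)^* * ((u t * (u t)^*) - u0^* * u t) * (zT t * (zT t)^*)); last by ring.
by rewrite ut zT_conj mulr1; ring.
Qed.

End Forms.

Section Product.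
Variables (Phi Psi Theta : Tfun R) (A B : Tfun R -> Tfun R).
Hypotheses (HA : bounded_op u A) (HB : bounded_op u B).
Hypotheses (P2 : L2 Phi) (Q2 : L2 Psi) (T2 : L2 Theta).
Hypotheses (wA : wsym Phi A) (wB : wsym Psi B).

(** Needed on all of K_u because [commutator_product] applies it to B f and C A C g, which may be
    unbounded. *)
Lemma commutator f g : Ku u f -> Ku u g ->
  dotT (A (ushift f)) g - dotT (A f) (bshift g) =
  dotT k0 g * Lf Phi f - dotT f ck0 * Lf Phi (C g).
Proof.
move: f g; have HAc := bounded_op_conj Hu HA.
have Z2 : L2 (conjT (@zT R) \* conjT Phi) by l2.
have t2 : L2 ck0 := Linf_L2 kti.
have LC g : L2 g -> Lf Phi (C g) = dotT (C (conjT (@zT R) \* conjT Phi)) g.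
  by move=> g2; rewrite Lf_dot (dot_Cu_l Hu).
have key f g : Kb f -> Kb g ->
  dotT (A (ushift f)) g - dotT (A f) (bshift g) =
  dotT k0 g * Lf Phi f - dotT f ck0 * Lf Phi (C g).
  move=> Kf Kg; rewrite -commutator_form //.
  by rewrite !wA //; [exact: Kb_bshift|exact: Kb_shift].
have key2 f g : Ku u f -> Kb g ->
  dotT (A (ushift f)) g - dotT (A f) (bshift g) =
  dotT k0 g * Lf Phi f - dotT f ck0 * Lf Phi (C g).
  move=> Kf Kg; have [Kg' gi] := Kg; have f2 := Ku_L2 Kf; have g2 := Ku_L2 Kg'.
  have Kbg := Ku_bshift Hu Kg'.
  have Acg := op_Ku HAc Kg'; have Acb := op_Ku HAc Kbg.
  have l1 := Ku_L2 (Ku_bshift Hu Acg); have l3 := Ku_L2 Acb.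
  (* For a fixed bounded [g], [y] represents the difference of the two sides as a functional of [f];
     vanishing on bounded functions, it vanishes on K_u. Below, [x] does the same in the variable
     [g]. *)
  pose y := bshift (conj_op A g) \- conj_op A (bshift g) \-
    (cst (dotT k0 g)^* \* (conjT (@zT R) \* conjT Phi) \- cst (Lf Phi (C g))^* \* ck0).
  have yE h : Ku u h -> dotT (A (ushift h)) g - dotT (A h) (bshift g) -
     (dotT k0 g * Lf Phi h - dotT h ck0 * Lf Phi (C g)) = dotT h y.
    move=> Kh; have h2 := Ku_L2 Kh; have w1 := L2Z (dotT k0 g)^* Z2.
    have w2 := L2Z (Lf Phi (C g))^* t2.
    rewrite /y (dotBr (L2B l1 l3) (L2B w1 w2) h2) (dotBr l1 l3 h2).
    rewrite (dotBr w1 w2 h2) (dotZr _ Z2 h2) (dotZr _ t2 h2).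
    rewrite !conjcKK -Lf_dot -(dot_shift Hu Kh Acg).
    rewrite -(adjoint Hu HA P2 wA (Ku_shift Hu Kh) Kg') -(adjoint Hu HA P2 wA Kh Kbg).
    by dring.
  apply/eqP; rewrite -subr_eq0 yE //; apply/eqP.
  have y2 : L2 y := L2B (L2B l1 l3) (L2B (L2Z _ Z2) (L2Z _ t2)).
  have -> : dotT f y = dotT f (cst 0).
    apply: (Kb_total_eqr Hu) => //; first exact: L2_cst.
    move=> h Kh; have [Kh' hi] := Kh; have h2 := Ku_L2 Kh'.
    by rewrite -yE // key // subrr dot0r.
  by rewrite dot0r.
move=> f g Kf Kg; have f2 := Ku_L2 Kf; have g2 := Ku_L2 Kg.
have Af := op_Ku HA Kf; have Af2 := Ku_L2 Af.
have As2 := op_L2 HA (Ku_shift Hu Kf).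
have sA2 := Ku_L2 (Ku_shift Hu Af).
have CZ2 := Cu_L2 Hu Z2.
pose x := A (ushift f) \- ushift (A f) \-
  (cst (Lf Phi f) \* k0 \- cst (dotT f ck0) \* C (conjT (@zT R) \* conjT Phi)).
have k2 : L2 k0 := Linf_L2 k0i.
have x2 : L2 x := L2B (L2B As2 sA2) (L2B (L2Z _ k2) (L2Z _ CZ2)).
have xE h : Ku u h -> dotT (A (ushift f)) h - dotT (A f) (bshift h) -
     (dotT k0 h * Lf Phi f - dotT f ck0 * Lf Phi (C h)) = dotT x h.
  move=> Kh; have h2 := Ku_L2 Kh.
  rewrite /x (dotBl (L2B As2 sA2) (L2B (L2Z _ k2) (L2Z _ CZ2)) h2).
  rewrite (dotBl As2 sA2 h2) (dotBl (L2Z _ k2) (L2Z _ CZ2) h2) !dotZl //.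
  by rewrite -LC // (dot_shift Hu Af Kh); dring.
apply/eqP; rewrite -subr_eq0 xE //; apply/eqP.
apply: (Kb_total Hu) => // h Kh; have [Kh' hi] := Kh.
by rewrite -xE // key2 // subrr.
Qed.

End Product.

(** With g = C h, write A B S - S A B = A (B S - S B) + (A S - S A) B and pair it with f and g.
    Since [f] and [h] are orthogonal to [ck0], the left side gives 0 and each term on the right
    keeps one product, <k0, A^* g> L_B(f) and -<B f, ck0> L_A(h). The contributions of u(0) to these
    products are equal and cancel. *)
Lemma commutator_product Phi Psi Theta A B :
  bounded_op u A -> bounded_op u B -> L2 Phi -> L2 Psi -> L2 Theta ->
  wsym Phi A -> wsym Psi B -> wsym Theta (fun f => A (B f)) ->
  forall f h, Ku u f -> Ku u h -> dotT f ck0 = 0 -> dotT h ck0 = 0 ->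
  Jf Phi h * Lf Psi f = Jf Psi f * Lf Phi h.
Proof.
move=> HA HB P2 Q2 T2 wA wB wE f h Kf Kh fk hk.
have HE := bounded_op_comp Hu HA HB.
have HAc := bounded_op_conj Hu HA; have HBc := bounded_op_conj Hu HB.
have Kg := Ku_Cu Hu Kh; set g := C h in Kg.
have f2 := Ku_L2 Kf; have h2 := Ku_L2 Kh; have g2 := Ku_L2 Kg.
have k2 : L2 k0 by l2.
have g0 : intT g = 0.
  by rewrite -[LHS]conjcKK -(dot_ck0 Hu Kh) hk conjc_0.
have kg : dotT k0 g = 0 by rewrite (dotC g2 k2) (dot_k0 Hu) // g0 conjc_0.
have Lg Xi : L2 Xi -> Lf Xi (C g) = Lf Xi h.
  by move=> X2; apply: eqT_Lf => //; [do !apply: Cu_L2|exact: CuK].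
have Jg Xi : L2 Xi -> Jf Xi (C g) = Jf Xi h.
  by move=> X2; apply: eqT_Jf => //; [do !apply: Cu_L2|exact: CuK].
have KBf := op_Ku HB Kf; have KAg := op_Ku HAc Kg.
have := commutator HE T2 wE Kf Kg; rewrite kg fk !mul0r subrr.
have := commutator HA P2 wA KBf Kg; rewrite kg mul0r sub0r Lg //.
have := commutator HB Q2 wB Kf KAg; rewrite fk mul0r subr0.
have KBs := op_Ku HB (Ku_shift Hu Kf); have KsB := Ku_shift Hu KBf.
rewrite -(dot_shift Hu KBf KAg).
rewrite -(adjoint Hu HA P2 wA KBs Kg) -(adjoint Hu HA P2 wA KsB Kg).
rewrite -(dot_k0 Hu Kg) in g0.
have -> : dotT k0 (conj_op A g) = Jf Phi h - u0^* * Lf Phi h.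
  rewrite -(adjoint Hu HA P2 wA) //; last exact: Ku_k0.
  by rewrite (wsym_r Hu HA P2 wA) ?k0_form // ?Lg ?Jg //; exact: Kb_k0.
have -> : dotT (B f) ck0 = Jf Psi f - u0^* * Lf Psi f.
  by rewrite (wsym_l Hu HB Q2 wB) ?ck0_form //; exact: Kb_ck0.
move: (dotT (A (B (ushift f))) g) (dotT (A (ushift (B f))) g) (dotT (A (B f)) (bshift g)).
move=> x y z e1 e2 e3.
have e4 : (Jf Phi h - u0^* * Lf Phi h) * Lf Psi f - (Jf Psi f - u0^* * Lf Psi f) * Lf Phi h = 0.
  by rewrite -[X in _ - X]opprK -e2 -e1 -[RHS]e3; ring.
apply/eqP; rewrite -subr_eq0; apply/eqP; rewrite -e4; ring.
Qed.

End Types.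

(** * Symbols modulo those of the zero operator *)

Section Decomposition.
Variable R : realType.
Implicit Types (f g h q Phi : Tfun R) (a c : R[i]).
Implicit Types (A B : Tfun R -> Tfun R).

Variable u : Tfun R.
Hypothesis Hu : inner u.

Let zi := zT_inf R.
Let ui := u_inf Hu.
Local Notation k0 := (k0 u).
Local Notation ck0 := (ck0 u).
Local Notation bshift := (@bshift R).
Local Notation Kb := (Kb u).
Local Notation C := (Cu u).
Local Notation Pu := (Pu u).
Local Notation u0 := (intT u).
Local Notation wsym := (wsym u).
Local Notation conj_op := (conj_op u).
Let k0i : Linf k0 := k0_inf Hu.
Let kti : Linf ck0 := ck0_inf Hu.

(** 1 - |u(0)|^2 is the square norm of u - u(0). *)
Lemma u0_inv : ~ constantT u -> exists b : R[i], b * (1 - u0^* * u0) = 1.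
Proof.
move=> unc; exists (1 - u0^* * u0)^-1; apply: mulVf.
apply/eqP => e; apply: unc; exists u0.
have u2 : L2 u by l2.
have c2 := L2_cst u0; have c1 : L2 (cst 1 : Tfun R) := L2_cst 1.
apply: eqT_sqnorm => //.
have cE : cst u0 = cst u0 \* cst 1 :> Tfun R by apply: funext => t /=; rewrite mulr1.
have uu : dotT u u = 1.
  by rewrite [X in dotT X _](u_cst1 u) [X in dotT _ X](u_cst1 u) (dot_u Hu) // dot1r intT_cst.
rewrite sqnormE; last exact: L2B.
rewrite dotBl //; last exact: L2B.
rewrite !dotBr // uu cE !dotZr ?dotZl; try l2.
rewrite !dot1r intT_conj_dot // intT_cst.
have -> : 1 - u0^* * u0 - (u0 * u0^* - u0^* * (u0 * 1)) = 1 - u0^* * u0 by ring.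
by rewrite e.
Qed.

Hypothesis u0n : exists b : R[i], b * (1 - u0^* * u0) = 1.

(* [h f conj(g)] integrates the same way as [P_u h f conj(g)]: the analytic
   projection of [conj(f) g] belongs to [K_u]. *)
Lemma analytic_symbol h f g : H2 h -> Kb f -> Kb g ->
  dotT (h \* f) g = dotT (Pu h \* f) g.
Proof.
move=> hH [Kf fi] [Kg gi]; have h2 := H2_L2 hH.
have f2 := Ku_L2 Kf; have g2 := Ku_L2 Kg.
have KP := Ku_Pu Hu h2; have P2 := Ku_L2 KP.
pose x := conjT f \* g.
have x2 : L2 x by rewrite /x; l2.
pose G := [set q : Tfun R | exists2 n : int, n < 0 & q = expT n].
have [|p [p2 pG] hp] := @orthogonal_projection _ G x _ x2.
  by move=> _ [n _ ->]; exact: expT_L2.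
have pH : H2 p by split=> // n n0; apply: pG; exists n.
have hp' k : H2 k -> dotT (x \- p) k = 0.
  by move=> [k2 kn]; apply: hp; split=> // _ [n n0 ->]; exact: kn.
have Kp : Ku u p.
  split=> // k kH; have k2 := H2_L2 kH.
  have ukH : H2 (u \* k) by apply: H2_Minf => //; exact: uH2.
  have uk2 := H2_L2 ukH.
  have -> : dotT p (u \* k) = dotT x (u \* k).
    by have := hp' _ ukH; rewrite dotBl // => /eqP; rewrite subr_eq0 => /eqP ->.
  have -> : dotT x (u \* k) = dotT g (u \* (f \* k)).
    by rewrite /x; congr intT; pointwise.
  by rewrite Ku_uH //; apply: H2_Minf => //; exact: Ku_H2 Kf.
have e k : L2 k -> dotT (k \* f) g = dotT k x.
  by move=> k2; rewrite /x; congr intT; pointwise.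
rewrite !e //.
have xp k : H2 k -> dotT k x = dotT k p.
  move=> kH; have k2 := H2_L2 kH; have := hp' _ kH.
  rewrite dotBl // => /eqP; rewrite subr_eq0 => /eqP xp.
  by rewrite (dotC x2 k2) (dotC p2 k2) xp.
by rewrite !xp //; [rewrite (dot_Pu Hu)|exact: Ku_H2 KP].
Qed.

Lemma dot_conj_symbol h f g : L2 h -> Linf f -> Linf g ->
  dotT (conjT h \* f) g = (dotT (h \* g) f)^*.
Proof.
move=> h2 fi gi; rewrite -dotC; [|l2|l2].
by congr intT; pointwise.
Qed.

Lemma eq_symbol_l Phi Phi' f g : L2 Phi -> L2 Phi' -> eqT Phi Phi' ->
  Linf f -> Linf g -> dotT (Phi \* f) g = dotT (Phi' \* f) g.
Proof.
move=> P2 P2' e fi gi; apply: eq_dotT; try l2.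
by apply: aeTS e => t /= ->.
Qed.

Lemma u_symbol f g : Kb f -> Kb g -> dotT (u \* f) g = 0.
Proof. by move=> [Kf fi] [Kg gi]; rewrite uH_Ku //; exact: Ku_H2 Kf. Qed.

(** [u] is a symbol of the zero operator, so [k0] and 1 are symbols of the same operator. This is
    how multiples of [k0] become constants. *)
Lemma k0_symbol f g : Kb f -> Kb g -> dotT (k0 \* f) g = dotT f g.
Proof.
move=> Kf Kg; have [Kf' fi] := Kf; have [Kg' gi] := Kg.
have -> : k0 \* f = f \- cst u0^* \* (u \* f) by rewrite /k0; pointwise.
rewrite dotBl ?dotZl ?u_symbol ?mulr0 ?subr0 //; l2.
Qed.

(** Split Phi = h + conj(q) with [h] its analytic part and [q] in H^2 of mean zero, and apply
    [analytic_symbol] to [h] and to [q]. *)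
Lemma symbol_decomposition Phi : L2 Phi -> exists c, forall f g, Kb f -> Kb g ->
  dotT (Phi \* f) g =
  dotT (Pu Phi \* f) g + (dotT (Pu (conjT Phi) \* g) f)^* + c * dotT f g.
Proof.
move=> P2; have Pc2 := L2_conj P2.
pose G := [set q : Tfun R | exists2 n : int, n < 0 & q = expT n].
have [|h [h2 hG] hp] := @orthogonal_projection _ G Phi _ P2.
  by move=> _ [n _ ->]; exact: expT_L2.
have hH : H2 h by split=> // n n0; apply: hG; exists n.
have hp' k : H2 k -> dotT (Phi \- h) k = 0.
  by move=> [k2 kn]; apply: hp; split=> // _ [n n0 ->]; exact: kn.
pose q := conjT (Phi \- h).
have r2 : L2 (Phi \- h) by l2.
have q2 : L2 q by exact: L2_conj.
have qH : H2 q.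
  split=> // n n0; rewrite fourier_conj //.
  case: n n0 => // n _; rewrite fourierE NegzE opprK hp' ?conjc_0 //; exact: H2_expT.
have PhiE : Phi = h \+ conjT q.
  by rewrite /q; apply: funext => t; rewrite /conjT /= conjcKK; ring.
pose a := intT h.
have Ph : eqT (Pu h) (Pu Phi).
  apply: (Ku_eq_weak Hu); [exact: Ku_Pu|exact: Ku_Pu|move=> k Kk].
  rewrite !(dot_Pu Hu) //; have k2 := Ku_L2 Kk.
  have := hp' _ (Ku_H2 Kk); rewrite dotBl // => /eqP; rewrite subr_eq0 => /eqP ->.
  by [].
have hc2 := L2_conj h2; have ac2 := L2_cst a^*.
have Pq : eqT (Pu q) (Pu (conjT Phi) \- cst a^* \* k0).
  have KP := Ku_Pu Hu Pc2; have P2' := Ku_L2 KP.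
  apply: (Ku_eq_weak Hu).
  - exact: Ku_Pu.
  - by apply: (KuB Hu) => //; apply: (KuZ Hu); exact: Ku_k0.
  move=> k Kk; have k2 := Ku_L2 Kk; have kH := Ku_H2 Kk.
  rewrite dotBl ?dotZl ?(dot_Pu Hu) //; try l2.
  have -> : dotT k0 k = dotT (cst 1) k.
    have k02 : L2 k0 by l2.
    by rewrite (dotC k2 k02) (dot_k0 Hu) // intT_conj_dot.
  have -> : q = conjT Phi \- conjT h by rewrite /q; pointwise.
  rewrite dotBl //; congr (_ - _).
  rewrite -dotZl //; last exact: L2_cst.
  have -> : cst a^* \* cst 1 = cst a^* :> Tfun R by apply: funext => t /=; rewrite mulr1.
  apply/eqP; rewrite -subr_eq0 -dotBl //; apply/eqP.
  apply: H2_orth => //; first by l2.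
  move=> n; rewrite fourierB // fourier_conj // fourier_cst.
  case: n => [|n]; first by rewrite oppr0 fourier0E mulr1 subrr.
  by rewrite mulr0 subr0 (proj2 hH) // conjc_0.
(* The mean [a] of Phi is counted in P_u Phi and again in P_u conj(Phi), which is P_u q + conj(a)
   k0; the constant removes the second copy. *)
exists (- a) => f g Kf Kg; have [Kf' fi] := Kf; have [Kg' gi] := Kg.
have f2 := Ku_L2 Kf'; have g2 := Ku_L2 Kg'.
have KPh := Ku_L2 (Ku_Pu Hu h2); have KPp := Ku_L2 (Ku_Pu Hu P2).
have KPq := Ku_L2 (Ku_Pu Hu q2); have KPc := Ku_L2 (Ku_Pu Hu Pc2).
have -> : dotT (Phi \* f) g = dotT (h \* f) g + dotT (conjT q \* f) g.
  have -> : Phi \* f = h \* f \+ conjT q \* f by rewrite {1}PhiE; pointwise.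
  by rewrite dotDl //; l2.
rewrite analytic_symbol // (eq_symbol_l KPh KPp Ph fi gi) -addrA; congr (_ + _).
rewrite dot_conj_symbol // analytic_symbol //.
rewrite (eq_symbol_l KPq _ Pq gi fi); last by l2.
have -> : (Pu (conjT Phi) \- cst a^* \* k0) \* g =
    Pu (conjT Phi) \* g \- cst a^* \* (k0 \* g) by pointwise.
rewrite dotBl ?dotZl ?k0_symbol //; try l2.
by rewrite conjcB conjcM conjcKK -(dotC g2 f2); ring.
Qed.

(** The functions of mean zero in K_u are those orthogonal to [k0], which [u0n] makes nonzero. *)
Lemma multiple_of_k0 v : Ku u v ->
  (forall g, Ku u g -> intT g = 0 -> dotT g v = 0) ->
  exists c, eqT v (cst c \* k0).
Proof.
move=> Kv hv; have Kk := Ku_k0 Hu; have v2 := Ku_L2 Kv; have k2 := Ku_L2 Kk.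
have kk : intT k0 = 1 - u0^* * u0.
  rewrite /k0 -dot1r dotBl ?dotZl ?dot1r ?intT_cst //; l2.
have [b] := u0n; rewrite -kk => bk.
exists (b * dotT k0 v)^*; apply: (Ku_eq_weak Hu) => //; first exact: KuZ.
move=> g Kg; have g2 := Ku_L2 Kg.
have Kg' : Ku u (cst (intT k0) \* g \- cst (intT g) \* k0).
  by apply: KuB => //; apply: KuZ.
have g'2 := Ku_L2 Kg'.
have := hv _ Kg'; rewrite -(dot_k0 Hu Kg') dotBl ?dotZl; try l2.
rewrite !(dot_k0 Hu) // [X in X - _]mulrC subrr => /(_ erefl).
rewrite dotBl ?dotZl //; try l2.
move=> /eqP; rewrite subr_eq0 => /eqP e.
have gE : dotT g v = b * dotT k0 v * intT g.
  rewrite -[LHS]mul1r -bk -mulrA [intT k0 * _]e; ring.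
by rewrite (dotC g2 v2) gE (dotC g2 k2) (dot_k0 Hu Kg) conjcM.
Qed.

(** Multiplication by z maps the complement of [ck0] in K_u onto the complement of [k0]; here is the
    inverse, and [zT_Ku] the direct map. *)
Lemma Ku_zbar g : Ku u g -> intT g = 0 ->
  [/\ Ku u (bshift g), dotT (bshift g) ck0 = 0 & @zT R \* bshift g = g].
Proof.
move=> Kg g0; have Kb := Ku_bshift Hu Kg; have g2 := Ku_L2 Kg.
have zE : @zT R \* bshift g = g.
  apply: funext => t; rewrite /bshift g0 /conjT /= subr0.
  by rewrite mulrA zT_conj mul1r.
split=> //; rewrite (dot_ck0 Hu) //.
have -> : C (bshift g) = u \* conjT g by rewrite /Cu zE.
have -> : intT (u \* conjT g) = dotT u g by [].
by rewrite u_Ku // conjc_0.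
Qed.

Lemma zT_Ku f : Ku u f -> dotT f ck0 = 0 -> Ku u (@zT R \* f).
Proof.
move=> Kf f0; have := Ku_shift Hu Kf; rewrite /ushift f0.
have -> // : @zT R \* f \- cst 0 \* u = @zT R \* f by pointwise.
Qed.

(** A test of the type on an arbitrary symbol, whereas [of_type] asks for a symbol of a special
    shape. *)
Definition typed alpha Phi := forall f, Ku u f -> dotT f ck0 = 0 ->
  if alpha is Some a then Lf Phi f = a * Jf u Phi f else Jf u Phi f = 0.

Lemma Lf_Pu Phi f : L2 Phi -> Ku u f -> dotT f ck0 = 0 ->
  Lf Phi f = dotT (@zT R \* f) (Pu (conjT Phi)).
Proof.
move=> P2 Kf f0; rewrite (dot_Pu_r Hu) //; [l2|exact: zT_Ku].
Qed.

Lemma Jf_Pu Phi f : L2 Phi -> Ku u f ->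
  Jf u Phi f = dotT (Pu Phi) (C f).
Proof.
move=> P2 Kf; rewrite (dot_Pu Hu) //; last exact: Ku_Cu.
by congr intT; rewrite /Cu; pointwise.
Qed.

(** J(f) = <P_u Phi, C f>, and [Cu] carries the complement of [ck0] onto that of [k0]. *)
Lemma typed_inf_Pu Phi : L2 Phi -> typed None Phi -> exists c, eqT (Pu Phi) (cst c \* k0).
Proof.
move=> P2 tP; have KP := Ku_Pu Hu P2; have KP2 := Ku_L2 KP.
apply: multiple_of_k0 => // g Kg g0; have g2 := Ku_L2 Kg.
have KC := Ku_Cu Hu Kg; have C2 := Ku_L2 KC.
have k0' : dotT (C g) ck0 = 0.
  rewrite (dot_ck0 Hu) // -(dot_k0 Hu); last by do !apply: Ku_Cu.
  rewrite (@eq_dotT_eqT _ _ g _ k0) ?(dot_k0 Hu) ?g0 ?conjc_0 //; try by l2.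
    by do !apply: Cu_L2.
  exact: CuK.
have := tP _ KC k0'; rewrite Jf_Pu // => e.
rewrite (dotC KP2 g2) -[in RHS]conjc_0 -e; congr (_^*).
by apply: eq_dotT_eqT => //; [do !apply: Cu_L2|apply: eqT_sym; exact: CuK].
Qed.

(** Any g of mean zero is z f with [f] orthogonal to [ck0]. Then L(f) = <g, P_u conj(Phi)>, while
    J(f) = <f, C P_u Phi> = <g, S C P_u Phi>; so L = a J fixes P_u conj(Phi) up to a multiple of
    [k0]. *)
Lemma typed_Pu a Phi : L2 Phi -> typed (Some a) Phi ->
  exists c, eqT (Pu (conjT Phi)) (cst a^* \* Su u (C (Pu Phi)) \+ cst c \* k0).
Proof.
move=> P2 tP; have KP := Ku_Pu Hu P2; have KP2 := Ku_L2 KP.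
have Pc2 := L2_conj P2; have Kc := Ku_Pu Hu Pc2; have Kc2 := Ku_L2 Kc.
have KCP := Ku_Cu Hu KP; have CP2 := Ku_L2 KCP.
have zC2 : L2 (@zT R \* C (Pu Phi)) by l2.
have KS : Ku u (Su u (C (Pu Phi))) by apply: Ku_Pu.
have S2 := Ku_L2 KS.
pose v := Pu (conjT Phi) \- cst a^* \* Su u (C (Pu Phi)).
have Kv : Ku u v by apply: (KuB Hu) => //; apply: KuZ.
have [|c vE] := multiple_of_k0 Kv.
  move=> g Kg g0; have [Kb bk zE] := Ku_zbar Kg g0; have g2 := Ku_L2 Kg.
  have b2 := Ku_L2 Kb.
  rewrite /v dotBr ?dotZr //; last by l2.
  rewrite conjcKK (dot_Pu_r Hu zC2 Kg).
  have := tP _ Kb bk; rewrite Lf_Pu // zE => ->.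
  rewrite Jf_Pu // -{2}zE.
  have -> : dotT (@zT R \* bshift g) (@zT R \* C (Pu Phi)) = dotT (bshift g) (C (Pu Phi)).
    congr intT; apply: funext => t /=; rewrite /conjT /= conjcM.
    transitivity (bshift g t * (C (Pu Phi) t)^* * (zT t * (zT t)^*)); first by ring.
    by rewrite zT_conj mulr1.
  have Cb2 := Cu_L2 Hu b2.
  by rewrite (dotC Cb2 KP2) (dotC CP2 b2) (dot_Cu_l Hu b2 KP2) subrr.
exists c; apply: aeTS vE => t; rewrite /v /= => /eqP; rewrite subr_eq => /eqP ->.
by rewrite addrC.
Qed.

End Decomposition.

(** * Types and products *)

Section Main.
Variable R : realType.
Implicit Types (f g h q Phi : Tfun R) (a c : R[i]).
Implicit Types (A B : Tfun R -> Tfun R).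

Variable u : Tfun R.
Hypothesis Hu : inner u.
Hypothesis u0n : exists b : R[i], b * (1 - (intT u)^* * intT u) = 1.

Let zi := zT_inf R.
Let ui := u_inf Hu.
Local Notation k0 := (k0 u).
Local Notation ck0 := (ck0 u).
Local Notation bshift := (@bshift R).
Local Notation ushift := (ushift u).
Local Notation Kb := (Kb u).
Local Notation C := (Cu u).
Local Notation Pu := (Pu u).
Local Notation Su := (Su u).
Local Notation u0 := (intT u).
Local Notation wsym := (wsym u).
Local Notation conj_op := (conj_op u).
Local Notation typed := (typed u).
Let k0i : Linf k0 := k0_inf Hu.
Let kti : Linf ck0 := ck0_inf Hu.

(** In the decomposition of the symbol, [typed_Pu] rewrites the antianalytic component in terms of
    the analytic one, or [typed_inf_Pu] reduces the analytic one to a multiple of [k0]; multiples of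
    [k0] are absorbed in the constant. *)
Lemma type_of_typed alpha Phi A : bounded_op u A -> L2 Phi -> wsym Phi A ->
  typed alpha Phi -> of_type u alpha A.
Proof.
move=> HA P2 wA tP; split.
  by split=> //; exists Phi; apply/(symbolP Hu).
have Pc2 := L2_conj P2.
have Kphi := Ku_Pu Hu P2; have phi2 := Ku_L2 Kphi.
have Kpsi := Ku_Pu Hu Pc2; have psi2 := Ku_L2 Kpsi.
have [c' dec] := symbol_decomposition Hu P2.
have k2 : L2 k0 by l2.
case: alpha tP => [a|] tP.
  have [c psiE] := typed_Pu Hu u0n P2 tP.
  have KC := Ku_Cu Hu Kphi; have C2 := Ku_L2 KC.
  have z2 : L2 (@zT R \* C (Pu Phi)) by l2.
  have KS : Ku u (Su (C (Pu Phi))) by exact: Ku_Pu.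
  have S2 := Ku_L2 KS.
  have cc2 := L2_cst (c^* + c').
  exists (Pu Phi), (c^* + c'); split=> //; apply/(symbolP Hu) => //; split; first by l2.
  move=> f g Kf Kg; have [Kf' fi] := Kf; have [Kg' gi] := Kg.
  have f2 := Ku_L2 Kf'; have g2 := Ku_L2 Kg'.
  rewrite wA // dec // (eq_symbol_l psi2 _ psiE gi fi); last by l2.
  set v := Su _.
  have -> : (cst a^* \* v \+ cst c \* k0) \* g = cst a^* \* (v \* g) \+ cst c \* (k0 \* g).
    by pointwise.
  have v2 : L2 v by [].
  rewrite dotDl ?dotZl ?(k0_symbol Hu) //; try l2.
  have -> : (Pu Phi \+ cst a \* conjT v \+ cst (c^* + c')) \* f =
     Pu Phi \* f \+ cst a \* (conjT v \* f) \+ cst (c^* + c') \* f by pointwise.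
  rewrite dotDl ?(dotDl (f := Pu Phi \* f)) ?dotZl ?dot_conj_symbol //; try l2.
  by rewrite conjcD !conjcM conjcKK -(dotC g2 f2); ring.
have [c phiE] := typed_inf_Pu Hu u0n P2 tP.
exists (Pu (conjT Phi) \+ cst (c + c')^*); split.
  by apply: H2D; [exact: Ku_H2 Kpsi|exact: H2_cst].
have cc2 := L2_cst (c + c')^*.
apply/(symbolP Hu) => //; split; first by l2.
move=> f g Kf Kg; have [Kf' fi] := Kf; have [Kg' gi] := Kg.
have f2 := Ku_L2 Kf'; have g2 := Ku_L2 Kg'.
rewrite wA // dec // (eq_symbol_l phi2 _ phiE fi gi); last by l2.
have -> : (cst c \* k0) \* f = cst c \* (k0 \* f) by pointwise.
rewrite dotZl ?(k0_symbol Hu) //; try l2.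
have -> : conjT (Pu (conjT Phi) \+ cst (c + c')^*) \* f =
   conjT (Pu (conjT Phi)) \* f \+ cst (c + c') \* f by pointwise.
rewrite dotDl ?dotZl ?dot_conj_symbol //; try l2.
by ring.
Qed.

Lemma dot_Cu_ck0 g : Ku u g -> dotT (C g) ck0 = dotT k0 g.
Proof.
move=> Kg; have g2 := Ku_L2 Kg; have k2 : L2 k0 by l2.
have C2 := Cu_L2 Hu g2; have C2k := Cu_L2 Hu k2; have t2 : L2 ck0 by l2.
rewrite -(dot_Cu Hu g2 k2); apply: eq_dotT_eqT => //.
by apply: eqT_sym; exact: Cu_k0.
Qed.

(** z C phi = u conj(phi), and <C phi, ck0> = <k0, phi> is the conjugate of the mean of phi. *)
Lemma Su_Cu phi : Ku u phi ->
  eqT (Su (C phi)) (u \* conjT phi \- cst (intT phi)^* \* u).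
Proof.
move=> Kp; have KC := Ku_Cu Hu Kp; have p2 := Ku_L2 Kp; have k2 : L2 k0 by l2.
apply: eqT_trans (Su_eq Hu KC) _; rewrite /ushift dot_Cu_ck0 //.
rewrite (dotC p2 k2) (dot_k0 Hu) //; apply: aeTW => t; rewrite /Cu /conjT /= conjcM.
transitivity (u t * (phi t)^* * (zT t * (zT t)^*) - (intT phi)^* * u t); first by ring.
by rewrite zT_conj; ring.
Qed.

Lemma dot_zT_u f : Ku u f -> dotT (@zT R \* f) u = dotT f ck0.
Proof.
move=> Kf; have f2 := Ku_L2 Kf; have fH := Ku_H2 Kf.
have -> : dotT f ck0 = dotT (@zT R \* f) (u \- cst u0 \* cst 1).
  by rewrite /ck0; congr intT; pointwise.
rewrite dotBr ?dotZr ?dot1r ?intT_zT ?mulr0 ?subr0 //; l2.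
Qed.

Definition type_symbol a phi c := phi \+ cst a \* conjT (Su (C phi)) \+ cst c.

Lemma type_symbol_L2 a phi c : Ku u phi -> L2 (type_symbol a phi c).
Proof.
move=> Kp; have p2 := Ku_L2 Kp; have C2 := Cu_L2 Hu p2.
have z2 : L2 (@zT R \* C phi) by l2.
have S2 : L2 (Su (C phi)) := Ku_L2 (Ku_Pu Hu z2).
by have c2 := L2_cst c; rewrite /type_symbol; l2.
Qed.

(** phi contributes nothing to L, and a conj(S C phi) contributes to L what a J receives from phi,
    up to a multiple of <f, ck0>. The other terms are such multiples as well. The defect off the
    complement of [ck0] is recorded because commutation with [pshift] is needed on all of K_u. *)
Lemma type_symbol_form a phi c : Ku u phi -> exists kappa, forall f, Ku u f ->
  Lf (type_symbol a phi c) f - a * Jf u (type_symbol a phi c) f = kappa * dotT f ck0.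
Proof.
move=> Kp; have p2 := Ku_L2 Kp; have C2 := Cu_L2 Hu p2.
have z2 : L2 (@zT R \* C phi) by l2.
have KS : Ku u (Su (C phi)) := Ku_Pu Hu z2; have S2 := Ku_L2 KS.
have vE := Su_Cu Kp; set v := Su (C phi) in KS S2 vE *.
have pH := Ku_H2 Kp; have vH := Ku_H2 KS; have c1 := L2_cst (1 : R[i]).
exists (- a * intT phi - a ^+ 2 * (intT v)^* - a * c) => f Kf.
have f2 := Ku_L2 Kf; have fH := Ku_H2 Kf; have zf2 : L2 (@zT R \* f) by l2.
have pc2 := L2_conj p2.
have LE : Lf (type_symbol a phi c) f =
    dotT (@zT R \* f) (conjT phi) + a * dotT (@zT R \* f) v + c * dotT (@zT R \* f) (cst 1).
  rewrite /Lf; have -> : conjT (type_symbol a phi c) =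
      conjT phi \+ cst a^* \* v \+ cst c^* \* cst 1 by rewrite /type_symbol -/v; pointwise.
  rewrite dotDr ?(dotDr (f := conjT phi)) ?dotZr ?conjcKK //; l2.
have JE : Jf u (type_symbol a phi c) f =
    dotT (@zT R \* f) (conjT phi \* u) + a * dotT (@zT R \* f) (v \* u) + c * dotT (@zT R \* f) u.
  rewrite /Jf; have -> : conjT (type_symbol a phi c) \* u =
      conjT phi \* u \+ cst a^* \* (v \* u) \+ cst c^* \* u by rewrite /type_symbol -/v; pointwise.
  rewrite dotDr ?(dotDr (f := conjT phi \* u)) ?dotZr ?conjcKK //; l2.
have e1 : dotT (@zT R \* f) (conjT phi) = 0.
  have -> : dotT (@zT R \* f) (conjT phi) = intT ((@zT R \* f) \* phi).
    by congr intT; pointwise.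
  by rewrite intT_H2M ?intT_zT ?mul0r //; exact: H2_zT.
have e2 : dotT (@zT R \* f) v =
    dotT (@zT R \* f) (conjT phi \* u) - intT phi * dotT (@zT R \* f) u.
  have -> : dotT (@zT R \* f) v = dotT (@zT R \* f) (conjT phi \* u \- cst (intT phi)^* \* u).
    apply: eq_dotT_eqT => //; first by l2.
    by apply: aeTS vE => t /= ->; ring.
  by rewrite dotBr ?dotZr ?conjcKK //; l2.
have e3 : dotT (@zT R \* f) (v \* u) = (intT v)^* * dotT f ck0.
  have Cf2 := Cu_L2 Hu f2.
  rewrite (dot_ck0 Hu) // -conjcM -intT_H2M //; last exact/Ku_H2/Ku_Cu.
  rewrite -intT_conj; last exact: L2M_L1.
  by congr intT; rewrite /Cu; pointwise.
rewrite LE JE e1 e2 e3 dot_zT_u // dot1r intT_zT //; ring.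
Qed.

Lemma typed_of_type alpha A : of_type u alpha A ->
  exists Phi, [/\ bounded_op u A, L2 Phi, wsym Phi A & typed alpha Phi].
Proof.
move=> [[HA _]]; case: alpha => [a [phi [c [Kp sA]]]|[psi [pH sA]]].
  have [P2 wA] := (symbolP Hu _ HA).1 sA; exists (type_symbol a phi c); split=> //.
  have [kappa form] := type_symbol_form a c Kp.
  move=> f Kf f0; have := form f Kf; rewrite f0 mulr0 => /eqP.
  by rewrite subr_eq0 => /eqP.
have [P2 wA] := (symbolP Hu _ HA).1 sA; exists (conjT psi); split=> //.
move=> f Kf f0; rewrite /Jf.
have -> : conjT (conjT psi) \* u = u \* psi by pointwise.
by rewrite Ku_uH //; exact: zT_Ku.
Qed.

(** The map f -> C (z f) preserves the complement of [ck0] and exchanges L and J while conjugating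
    the symbol; this is the effect of A |-> C A C on types. *)
Lemma conj_Lf_Jf Phi f : L2 Phi -> Ku u f -> dotT f ck0 = 0 ->
  [/\ Ku u (C (@zT R \* f)), dotT (C (@zT R \* f)) ck0 = 0,
   Lf Phi (C (@zT R \* f)) = (Jf u (conjT Phi) f)^* &
   Jf u Phi (C (@zT R \* f)) = (Lf (conjT Phi) f)^*].
Proof.
move=> P2 Kf f0; have Kz := zT_Ku Hu Kf f0; have f2 := Ku_L2 Kf; have z2 := Ku_L2 Kz.
have fH := Ku_H2 Kf; have C2 := Cu_L2 Hu z2.
have Pc2 := L2_conj P2; have Pcc2 := L2_conj Pc2; have k2 : L2 k0 by l2.
split.
- exact: Ku_Cu.
- by rewrite dot_Cu_ck0 // (dotC z2 k2) (dot_k0 Hu) // intT_zT // conjc_0.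
- rewrite /Lf /Jf -dotC //; last by l2.
  congr intT; apply: funext => t; rewrite /Cu /conjT /= !conjcE.
  transitivity (u t * (zT t)^* * (f t)^* * Phi t * (zT t * (zT t)^*)); first by ring.
  by rewrite zT_conj; ring.
- rewrite /Lf /Jf -dotC //; apply: eq_dotT; try l2.
  apply: aeTS (u_conj Hu) => t ut; rewrite /Cu /conjT /= !conjcE.
  transitivity ((zT t)^* * (f t)^* * Phi t * (u t * (u t)^*) * (zT t * (zT t)^*)); first by ring.
  by rewrite ut zT_conj; ring.
Qed.

Lemma wsym_eq Phi A B : bounded_op u A -> bounded_op u B ->
  (forall f, Ku u f -> eqT (A f) (B f)) -> wsym Phi A -> wsym Phi B.
Proof.
move=> HA HB AB wA f g Kf Kg; rewrite -wA //; have [Kf' fi] := Kf; have [Kg' gi] := Kg.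
apply: eq_dotT_eqT => //; [exact: (op_L2 HB)|exact: (Ku_L2 Kg')|exact: (op_L2 HA)|exact: (Ku_L2 Kg')|].
by apply: eqT_sym; exact: AB.
Qed.

(** The inversion of the Riemann sphere in the unit circle. *)
Definition conj_type (alpha : option R[i]) : option R[i] :=
  if alpha is Some a then if a == 0 then None else Some (a^*)^-1 else Some 0.

Lemma conj_typeK alpha : conj_type (conj_type alpha) = alpha.
Proof.
case: alpha => [a|] /=; last by rewrite eqxx.
have [->//|a0] := eqVneq a 0; rewrite /= invr_eq0.
have -> : (a^* == 0) = false.
  by apply/negbTE; apply: contra a0 => /eqP e; rewrite -[a]conjcKK e conjc_0.
by rewrite conjcV conjcKK invrK.
Qed.

Lemma typed_conj alpha Phi : L2 Phi -> typed alpha Phi -> typed (conj_type alpha) (conjT Phi).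
Proof.
move=> P2 tP f Kf f0; have [K' k' LE JE] := conj_Lf_Jf P2 Kf f0.
have := tP _ K' k'; case: alpha {tP} => [a|] /=.
  rewrite LE JE => /(congr1 Num.conj); rewrite conjcM !conjcKK => e.
  have [a0|a0] := eqVneq a 0; first by rewrite /= e a0 conjc_0 mul0r.
  rewrite /= e mulKf //; apply: contra a0 => /eqP e0.
  by rewrite -[a]conjcKK e0 conjc_0.
by rewrite JE mul0r => e; rewrite -[LHS]conjcKK e conjc_0.
Qed.

Lemma type_conj alpha A : of_type u alpha A -> of_type u (conj_type alpha) (conj_op A).
Proof.
move=> /typed_of_type [Phi [HA P2 wA tP]].
apply: (@type_of_typed _ (conjT Phi)); [exact: bounded_op_conj|exact: L2_conj|exact: conj_op_wsym|].
exact: typed_conj.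
Qed.

Lemma op_scaleE A c f h : bounded_op u A -> Ku u f -> L2 h ->
  dotT (A (cst c \* f)) h = c * dotT (A f) h.
Proof.
move=> HA Kf h2; have -> : cst c \* f = cst (c - 1) \* f \+ f.
  by apply: funext => t /=; ring.
by rewrite (op_linE Hu HA) //; ring.
Qed.

(** * Products of operators of a finite type for which [beta] is invertible *)

Section FiniteType.
Variable a : R[i].
Hypothesis a1 : exists b : R[i], b * (1 - u0^* * a) = 1.

Local Notation beta := (1 - u0^* * a).

(* Bounded truncated Toeplitz operators of type [a] are those commuting with
   this perturbation of a multiple of the compressed shift. *)
Definition pshift f := cst beta \* ushift f \+ cst (a * dotT f ck0) \* k0.
Definition pshift_adj f := cst beta^* \* bshift f \+ cst (a^* * dotT f k0) \* ck0.

Lemma Ku_pshift f : Ku u f -> Ku u (pshift f).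
Proof.
by move=> Kf; apply: KuD => //; apply: KuZ => //; [exact: Ku_shift|exact: Ku_k0].
Qed.

Lemma Kb_pshift f : Kb f -> Kb (pshift f).
Proof.
by move=> Kf; apply: KbD => //; apply: KbZ => //; [exact: Kb_shift|exact: Kb_k0].
Qed.

Lemma Kb_pshift_adj f : Kb f -> Kb (pshift_adj f).
Proof.
by move=> Kf; apply: KbD => //; apply: KbZ => //; [exact: Kb_bshift|exact: Kb_ck0].
Qed.

Let k2 : L2 k0 := Linf_L2 k0i.
Let t2 : L2 ck0 := Linf_L2 kti.

Lemma dot_pshift_adj x g : L2 x -> Ku u g ->
  dotT x (pshift_adj g) = beta * dotT x (bshift g) + a * dotT k0 g * dotT x ck0.
Proof.
move=> x2 Kg; have b2 := Ku_L2 (Ku_bshift Hu Kg); have g2 := Ku_L2 Kg.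
rewrite /pshift_adj dotDr ?dotZr ?conjcKK //; try l2.
by rewrite conjcM conjcKK -(dotC g2 k2).
Qed.

Lemma pshift_adjoint f g : Ku u f -> Ku u g -> dotT (pshift f) g = dotT f (pshift_adj g).
Proof.
move=> Kf Kg; have s2 := Ku_L2 (Ku_shift Hu Kf); have f2 := Ku_L2 Kf; have g2 := Ku_L2 Kg.
rewrite dot_pshift_adj // /pshift dotDl ?dotZl ?(dot_shift Hu) //; try l2.
by dring.
Qed.

Definition form_condition Phi := exists kappa, forall f, Ku u f ->
  Lf Phi f - a * Jf u Phi f = kappa * dotT f ck0.

(** The algebra behind commutation with [pshift]: the two occurrences of [kappa] cancel because <C
    g, ck0> = <k0, g>. *)
Lemma form_cancel Phi : form_condition Phi -> forall f g, Ku u f -> Ku u g ->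
  beta * (dotT k0 g * Lf Phi f - dotT f ck0 * Lf Phi (C g)) +
   a * dotT f ck0 * (Jf u Phi (C g) - u0^* * Lf Phi (C g)) =
  a * dotT k0 g * (Jf u Phi f - u0^* * Lf Phi f).
Proof.
move=> [kappa form] f g Kf Kg; have KC := Ku_Cu Hu Kg.
have e1 := form f Kf; have e2 := form _ KC; rewrite dot_Cu_ck0 // in e2.
apply/eqP; rewrite -subr_eq0; apply/eqP.
transitivity (dotT k0 g * (Lf Phi f - a * Jf u Phi f) -
   dotT f ck0 * (Lf Phi (C g) - a * Jf u Phi (C g))); first by dring.
by rewrite e1 e2; ring.
Qed.

(** The counterpart of [op_pshift] for a symbol whose operator is not known to be bounded, hence on
    bounded functions only. *)
Lemma symbol_pshift Phi : L2 Phi -> form_condition Phi -> forall f g, Kb f -> Kb g ->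
  dotT (Phi \* pshift f) g = dotT (Phi \* f) (pshift_adj g).
Proof.
move=> P2 form f g Kf Kg; have [Kf' fi] := Kf; have [Kg' gi] := Kg.
have f2 := Ku_L2 Kf'; have g2 := Ku_L2 Kg'.
have [_ si] := Kb_shift Hu Kf.
rewrite dot_pshift_adj //; last by l2.
have -> : Phi \* pshift f = cst beta \* (Phi \* ushift f) \+ cst (a * dotT f ck0) \* (Phi \* k0).
  by apply: funext => t; rewrite /pshift /=; ring.
rewrite dotDl ?dotZl //; try l2.
have -> : dotT (Phi \* f) ck0 = Jf u Phi f - u0^* * Lf Phi f by rewrite dot_swap // (ck0_form Hu).
rewrite (k0_form Hu) // -(form_cancel form Kf' Kg') -(commutator_form Hu) //.
by dring.
Qed.

Lemma op_pshift Phi A : bounded_op u A -> L2 Phi -> wsym Phi A -> form_condition Phi ->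
  forall f g, Ku u f -> Ku u g -> dotT (A (pshift f)) g = dotT (A f) (pshift_adj g).
Proof.
move=> HA P2 wA form f g Kf Kg; have f2 := Ku_L2 Kf; have g2 := Ku_L2 Kg.
rewrite dot_pshift_adj //; last exact: (op_L2 HA).
have Ks := Ku_shift Hu Kf; have Kk := Ku_k0 Hu.
rewrite /pshift (op_linE Hu HA) //; last exact: KuZ.
rewrite op_scaleE //.
have -> : dotT (A f) ck0 = Jf u Phi f - u0^* * Lf Phi f.
  by rewrite (wsym_l Hu HA P2 wA) ?(ck0_form Hu) //; exact: Kb_ck0.
have -> : dotT (A k0) g = Jf u Phi (C g) - u0^* * Lf Phi (C g).
  by rewrite (wsym_r Hu HA P2 wA) ?(k0_form Hu) //; exact: Kb_k0.
rewrite -(form_cancel form Kf Kg) -(commutator Hu HA P2 wA) //.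
by dring.
Qed.

Lemma product_pshift Phi Psi A B : bounded_op u A -> bounded_op u B ->
  L2 Phi -> L2 Psi -> wsym Phi A -> wsym Psi B ->
  form_condition Phi -> form_condition Psi ->
  forall f g, Ku u f -> Ku u g ->
  dotT (A (B (pshift f))) g = dotT (A (B f)) (pshift_adj g).
Proof.
move=> HA HB P2 Q2 wA wB fA fB f g Kf Kg.
have HAc := bounded_op_conj Hu HA; have KAg := op_Ku HAc Kg; have KBf := op_Ku HB Kf.
rewrite (adjoint Hu HA P2 wA (op_Ku HB (Ku_pshift Kf)) Kg).
rewrite (op_pshift HB Q2 wB fB Kf KAg) -(pshift_adjoint KBf KAg).
by rewrite -(adjoint Hu HA P2 wA (Ku_pshift KBf) Kg) (op_pshift HA P2 wA fA KBf Kg).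
Qed.

(** Modulo u H^2 and antianalytic terms of mean zero, the symbol times [k0] is beta phi plus a
    multiple of [k0]. So phi = w / beta, and [c] cancels that multiple. *)
Lemma type_symbol_k0 w : Ku u w -> exists phi c, Ku u phi /\
  forall g, Kb g -> dotT (type_symbol a phi c \* k0) g = dotT w g.
Proof.
move=> Kw; have [b bE] := a1; pose phi := cst b \* w; have Kp : Ku u phi by exact: KuZ.
have w2 := Ku_L2 Kw; have p2 := Ku_L2 Kp; have C2 := Cu_L2 Hu p2.
have z2 : L2 (@zT R \* C phi) by l2.
have KS : Ku u (Su (C phi)) := Ku_Pu Hu z2; have S2 := Ku_L2 KS.
have vE := Su_Cu Kp; set v := Su (C phi) in KS S2 vE.
have c1 := L2_cst (1 : R[i]).
exists phi, (- (a * (intT v)^* + a * u0^* * intT phi)); split=> // g [Kg gi].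
set c := - _; have g2 := Ku_L2 Kg; have gH := Ku_H2 Kg.
have kg : dotT k0 g = (intT g)^* by rewrite (dotC g2 k2) (dot_k0 Hu).
have -> : type_symbol a phi c \* k0 = (phi \- cst u0^* \* (u \* phi)) \+
   cst a \* (conjT v \- cst u0^* \* (conjT v \* u)) \+ cst c \* k0.
  by apply: funext => t; rewrite /type_symbol -/v /k0 /conjT /=; ring.
rewrite dotDl ?(dotDl (f := phi \- _)) ?dotZl ?(dotBl (f := phi)) ?(dotBl (f := conjT v)) ?dotZl; try l2.
rewrite (uH_Ku Hu Kg (Ku_H2 Kp)).
have -> : dotT (conjT v) g = (intT v)^* * dotT k0 g.
  rewrite kg -conjcM -intT_H2M //; last exact: Ku_H2 KS.
  rewrite -intT_conj; last exact: L2M_L1.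
  by congr intT; pointwise.
have -> : dotT (conjT v \* u) g = dotT phi g - intT phi * dotT k0 g.
  have -> : dotT (conjT v \* u) g = dotT (phi \- cst (intT phi) \* cst 1) g.
    apply: eq_dotT; try l2; apply: aeTS2 vE (u_conj Hu) => t ve ut; rewrite /conjT /= ve /= /conjT !conjcE.
    transitivity ((phi t - intT phi) * (u t * (u t)^*) * (g t)^*); first by ring.
    by rewrite ut; ring.
  by rewrite dotBl ?dotZl ?intT_conj_dot ?kg //; l2.
rewrite /phi dotZl // -/phi /c.
transitivity (b * beta * dotT w g); first by ring.
by rewrite bE mul1r.
Qed.

Lemma type_product_finite A B : of_type u (Some a) A -> of_type u (Some a) B ->
  of_type u (Some a) (fun f => A (B f)).
Proof.
move=> [[HA _] [phiA [cA [KA sA]]]] [[HB _] [phiB [cB [KB sB]]]].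
have [P2 wA] := (symbolP Hu _ HA).1 sA; have [Q2 wB] := (symbolP Hu _ HB).1 sB.
have fA := type_symbol_form a cA KA; have fB := type_symbol_form a cB KB.
have EX := product_pshift HA HB P2 Q2 wA wB fA fB.
have HE := bounded_op_comp Hu HA HB.
have HAc := bounded_op_conj Hu HA; have HBc := bounded_op_conj Hu HB.
set E := (fun f => A (B f)) in HE *.
have adjE f g : Ku u f -> Ku u g -> dotT (E f) g = dotT f (conj_op B (conj_op A g)).
  move=> Kf Kg; rewrite /E (adjoint Hu HA P2 wA (op_Ku HB Kf) Kg).
  by rewrite (adjoint Hu HB Q2 wB Kf (op_Ku HAc Kg)).
have [phi [c [Kp Phik]]] := type_symbol_k0 (op_Ku HE (Ku_k0 Hu)).
have T2 := type_symbol_L2 a c Kp; have form := type_symbol_form a c Kp.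
pose Phi := type_symbol a phi c; rewrite -/Phi in Phik T2 form.
(* [T] collects the bounded functions on which the product and the candidate symbol agree: it
   contains [k0] and is stable under the shift, hence contains every P_u z^n. *)
pose T f := Kb f /\ forall g, Kb g -> dotT (E f) g = dotT (Phi \* f) g.
have Tk0 : T k0 by split=> [|g Kg]; [exact: Kb_k0|rewrite Phik].
have Tlin x y f h : T f -> T h -> T (cst x \* f \+ cst y \* h).
  move=> [Kf Tf] [Kh Th]; have [Kf' fi] := Kf; have [Kh' hi] := Kh.
  split; first by apply: KbD => //; apply: KbZ.
  move=> g Kg; have [Kg' gi] := Kg; have g2 := Ku_L2 Kg'.
  rewrite (op_linE Hu HE) ?op_scaleE //; last exact: KuZ.
  have -> : Phi \* (cst x \* f \+ cst y \* h) = cst x \* (Phi \* f) \+ cst y \* (Phi \* h).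
    by apply: funext => t /=; ring.
  by rewrite dotDl ?dotZl ?Tf ?Th //; l2.
have Teq f h : Kb h -> eqT f h -> T f -> T h.
  move=> Kh fh [Kf Tf]; have [Kf' fi] := Kf; have [Kh' hi] := Kh; split=> // g Kg.
  have [Kg' gi] := Kg; have g2 := Ku_L2 Kg'.
  transitivity (dotT (E f) g).
    apply: eq_dotT_eqT => //; [exact: (op_L2 HE)|exact: (op_L2 HE)|].
    by apply: (op_eq Hu HE) => //; exact: eqT_sym.
  rewrite Tf //; apply: eq_dotT; try l2.
  by apply: aeTS fh => t /= ->.
have Tshift f : T f -> T (ushift f).
  move=> Tf; have [Kf Tf'] := Tf; have [Kf' fi] := Kf.
  have Tp : T (pshift f).
    split=> [|g Kg]; first exact: Kb_pshift.
    rewrite symbol_pshift // EX ?Tf' //; first exact: Kb_pshift_adj.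
    by case: Kg.
  have [b bE] := a1.
  (* Invertibility of [beta] recovers the compressed shift from [pshift] and [k0]. *)
  have -> : ushift f = cst b \* pshift f \+ cst (- (b * (a * dotT f ck0))) \* k0.
    apply: funext => t; rewrite /pshift /=.
    transitivity (b * beta * ushift f t); first by rewrite bE mul1r.
    by ring.
  exact: Tlin.
have Tpz n : T (pz Hu n).
  elim: n => [|n IH].
    by apply: (Teq k0) => //; [exact: Kb_pz|apply: eqT_sym; exact: pz0].
  apply: (Teq (ushift (pz Hu n))); [exact: Kb_pz| |exact: Tshift].
  by apply: eqT_sym; exact: pzS.
have wE : wsym Phi E.
  move=> f g Kf Kg; have [Kf' fi] := Kf; have [Kg' gi] := Kg.
  have f2 := Ku_L2 Kf'; have g2 := Ku_L2 Kg'.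
  have s2 : L2 (conjT Phi \* g) by l2.
  have Ky := op_Ku HBc (op_Ku HAc Kg'); set y := conj_op B _ in Ky.
  have KP := Ku_Pu Hu s2; have y2 := Ku_L2 Ky; have P2' := Ku_L2 KP.
  (* For fixed bounded [g], both functionals of [f] are represented by elements of K_u, so agreement
     on the total family P_u z^n suffices and no bound on the operator of [Phi] is required. *)
  have x0 : eqT (y \- Pu (conjT Phi \* g)) (cst 0).
    apply: (@Ku_total _ _ Hu); first exact: KuB.
    move=> n; have [Kn Tn] := Tpz n; have [Kn' ni] := Kn; have n2 := Ku_L2 Kn'.
    rewrite (dotC n2 (L2B y2 P2')) dotBr // -adjE // Tn // (dot_Pu_r Hu) //.
    by rewrite dot_swap // subrr conjc_0.
  rewrite adjE // -/y dot_swap // -(dot_Pu_r Hu s2 Kf').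
  apply: eq_dotT_eqT => //.
  by apply: aeTS x0 => t /= /eqP; rewrite subr_eq0 => /eqP.
have sE : symbol u Phi E by apply/(symbolP Hu).
split; first by split=> //; exists Phi.
by exists phi, c.
Qed.

End FiniteType.

Lemma type_product alpha A B : of_type u alpha A -> of_type u alpha B ->
  of_type u alpha (fun f => A (B f)).
Proof.
move=> tA tB.
have [[HA _] _] := tA; have [[HB _] _] := tB.
have HAc := bounded_op_conj Hu HA; have HBc := bounded_op_conj Hu HB.
have HE := bounded_op_comp Hu HA HB; have HEc := bounded_op_comp Hu HAc HBc.
have viaconj a : conj_type alpha = Some a -> (exists b : R[i], b * (1 - u0^* * a) = 1) ->
    of_type u alpha (fun f => A (B f)).
  move=> ea a1; have := type_conj tA; have := type_conj tB; rewrite ea => tB' tA'.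
  have := type_conj (type_product_finite a1 tA' tB').
  rewrite -ea conj_typeK => /typed_of_type [Phi [HE' P2 wE tP]].
  apply: (type_of_typed HE P2 _ tP); apply: wsym_eq wE => // f Kf.
  have KC := Ku_Cu Hu Kf.
  apply: eqT_trans (eqT_Cu u (conj_op_comp Hu HA HB KC)) _.
  exact: (conj_opK Hu HE Kf).
case: alpha tA tB viaconj => [a|] tA tB viaconj.
  have [a1|a1] := eqVneq (1 - u0^* * a) 0; last first.
    by apply: type_product_finite => //; exists (1 - u0^* * a)^-1; exact: mulVf.
  have a0 : a != 0.
    by apply/eqP => a0; move: a1; rewrite a0 mulr0 subr0 => /eqP; rewrite oner_eq0.
  (* Here conj(u(0)) a = 1, so the conjugate type 1 / conj(a) is u(0), for which the factor to
     invert is 1 - |u(0)|^2. *)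
  apply: (viaconj (a^*)^-1); first by rewrite /= (negbTE a0).
  have ua : u0^* = a^-1.
    by move/eqP: a1; rewrite subr_eq0 => /eqP e; rewrite -[RHS]mul1r e mulfK.
  by rewrite -conjcV -ua conjcKK.
by apply: (viaconj 0) => //; exists 1; rewrite mulr0 subr0 mulr1.
Qed.

(** Type infinity makes P_u Phi a multiple of [k0], and type 0 does the same for P_u conj(Phi); the
    decomposition then leaves a constant symbol. *)
Lemma scalar_of_typed Phi A : bounded_op u A -> L2 Phi -> wsym Phi A ->
  typed None Phi -> typed (Some 0) Phi -> scalar_op u A.
Proof.
move=> HA P2 wA ti t0.
have Pc2 := L2_conj P2; have k2 : L2 k0 by l2.
have phi2 := Ku_L2 (Ku_Pu Hu P2); have psi2 := Ku_L2 (Ku_Pu Hu Pc2).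
have KC := Ku_Cu Hu (Ku_Pu Hu P2); have C2 := Ku_L2 KC.
have z2 : L2 (@zT R \* C (Pu Phi)) by l2.
have S2 : L2 (Su (C (Pu Phi))) := Ku_L2 (Ku_Pu Hu z2).
have [c' dec] := symbol_decomposition Hu P2.
have [c phiE] := typed_inf_Pu Hu u0n P2 ti.
have [d psiE] := typed_Pu Hu u0n P2 t0.
have {}psiE : eqT (Pu (conjT Phi)) (cst d \* k0).
  by apply: aeTS psiE => t ->; rewrite /= conjc_0 mul0r add0r.
pose x := c + d^* + c'; exists x => f Kf.
have x2 := L2_cst x; have f2 := Ku_L2 Kf.
have wx : wsym (cst x) A.
  move=> p q Kp Kq; have [Kp' pi] := Kp; have [Kq' qi] := Kq.
  have p2 := Ku_L2 Kp'; have q2 := Ku_L2 Kq'.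
  rewrite wA // dec // (eq_symbol_l phi2 _ phiE) // 1?(eq_symbol_l psi2 _ psiE) //; try l2.
  have e r : (cst c \* k0) \* r = cst c \* (k0 \* r) by pointwise.
  have e' r : (cst d \* k0) \* r = cst d \* (k0 \* r) by pointwise.
  rewrite e e' !dotZl ?(k0_symbol Hu) //; try l2.
  by rewrite conjcM -(dotC q2 p2) /x; ring.
apply: (Ku_eq_weak_b Hu); [exact: (op_Ku HA)|exact: KuZ|move=> h Kh].
have [Kh' hi] := Kh; have h2 := Ku_L2 Kh'.
rewrite (wsym_l Hu HA x2 wx) // dotZl //.
have -> : conjT (cst x) \* h = cst x^* \* h by pointwise.
by rewrite dotZr // conjcKK.
Qed.

End Main.

(* A and B are the bounded extensions to K_u^2 of A_Phi and A_Psi. *)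
Theorem theorem5p2 (R : realType) (u Phi Psi : Tfun R)
    (A B : Tfun R -> Tfun R) :
  inner u -> ~ constantT u ->
  L2 Phi -> L2 Psi ->
  bounded_op u A -> symbol u Phi A ->
  bounded_op u B -> symbol u Psi B ->
  (Tu u (fun f => A (B f)) <->
     (scalar_op u A \/ scalar_op u B) \/
     (exists alpha : option R[i], of_type u alpha A /\ of_type u alpha B)) /\
  (forall alpha : option R[i], of_type u alpha A -> of_type u alpha B ->
     of_type u alpha (fun f => A (B f))).
Proof.
move=> Hu Hnc P2 Q2 HA sA HB sB.
have u0n := u0_inv Hu Hnc.
have [_ wA] := (symbolP Hu Phi HA).1 sA; have [_ wB] := (symbolP Hu Psi HB).1 sB.
have HE := bounded_op_comp Hu HA HB.
have prod alpha := @type_product R u Hu u0n alpha A B.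
split=> //; split=> [[_ [Chi sE]]| [ [ [c Ac] | [c Bc] ] | [alpha [tA tB]]]].
- have [T2 wE] := (symbolP Hu Chi HE).1 sE.
  have key := commutator_product Hu HA HB P2 Q2 T2 wA wB wE.
  have tA alpha := @type_of_typed R u Hu u0n alpha Phi A HA P2 wA.
  have tB alpha := @type_of_typed R u Hu u0n alpha Psi B HB Q2 wB.
  have inf Xi : typed u None Xi \/
      exists f, [/\ Ku u f, dotT f (ck0 u) = 0 & Jf u Xi f != 0].
    have [h|h] := pselect (typed u None Xi); [by left|right].
    apply: contrapT => nex; apply: h => f Kf f0; apply/eqP/negPn/negP => J0.
    by apply: nex; exists f.
  case: (inf Phi) => [iA| [h0 [Kh hk Jh]]]; case: (inf Psi) => [iB| [f0 [Kf fk Jf0]]].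
  + by right; exists None; split; [exact: tA|exact: tB].
  (* J_A vanishes on the complement of [ck0]; testing [key] at [f0], where J_B is nonzero, forces
     L_A to vanish there as well. *)
  + left; left; apply: (scalar_of_typed Hu u0n HA P2 wA iA) => h Kh hk.
    have := key f0 h Kf Kh fk hk; rewrite (iA h Kh hk) !mul0r => /esym/eqP.
    by rewrite mulf_eq0 (negbTE Jf0) => /eqP.
  + left; right; apply: (scalar_of_typed Hu u0n HB Q2 wB iB) => f Kf fk.
    have := key f h0 Kf Kh fk hk; rewrite (iB f Kf fk) !mul0r => /eqP.
    by rewrite mulf_eq0 (negbTE Jh) => /eqP.
  (* [key] at [h0] says that L_B / J_B is this same ratio, and [key] at [f0] then carries it back to
     all of [A]. *)
  right; exists (Some (Lf Phi h0 / Jf u Phi h0)).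
  have eB : typed u (Some (Lf Phi h0 / Jf u Phi h0)) Psi.
    move=> f Kf' fk'; apply: (mulfI Jh); rewrite (key f h0 Kf' Kh fk' hk).
    by rewrite mulrC mulrA [Jf u Phi h0 * _]mulrC divfK.
  split; [apply: tA|exact: tB] => h Kh' hk'.
  apply: (mulfI Jf0); rewrite -(key f0 h Kf Kh' fk hk') (eB f0 Kf fk).
  by ring.
- split=> //; exists (cst c \* Psi).
  have cP2 : L2 (cst c \* Psi) by exact: L2Z.
  apply/(symbolP Hu) => //; split=> // f g Kf Kg; have [Kf' fi] := Kf; have [Kg' _] := Kg.
  have g2 := Ku_L2 Kg'; have KBf := op_Ku HB Kf'; have B2 := Ku_L2 KBf.
  have PB2 : L2 (Psi \* f) by exact: L2_infM.
  have -> : (cst c \* Psi) \* f = cst c \* (Psi \* f).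
    by apply: funext => t /=; rewrite mulrA.
  rewrite dotZl // -wB // -dotZl //; apply: eq_dotT_eqT => //.
  + exact/Ku_L2/(op_Ku HA).
  + exact: L2Z.
  + exact: Ac.
- split=> //; exists (cst c \* Phi).
  have cP2 : L2 (cst c \* Phi) by exact: L2Z.
  apply/(symbolP Hu) => //; split=> // f g Kf Kg; have [Kf' fi] := Kf; have [Kg' _] := Kg.
  have g2 := Ku_L2 Kg'; have KBf := op_Ku HB Kf'.
  have PA2 : L2 (Phi \* f) by exact: L2_infM.
  have -> : (cst c \* Phi) \* f = cst c \* (Phi \* f).
    by apply: funext => t /=; rewrite mulrA.
  have Kcf : Ku u (cst c \* f) by exact: KuZ.
  rewrite dotZl // -wA // -(op_scaleE Hu) //; apply: eq_dotT_eqT => //.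
  + exact/Ku_L2/(op_Ku HA).
  + exact/Ku_L2/(op_Ku HA).
  + by apply: (op_eq Hu HA) => //; exact: Bc.
- by have [] := prod alpha tA tB.
Qed.
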